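(* Let $c\in(0,1)$, let $T:[0,1]\to[0,1]$ satisfy conditions (1)-(3) listed in the context, and consider $A:=[0,\delta_A)$, $B:=(1-\delta_B,1]$ with $\delta_A,\delta_B\in(0,1)$. Write $\mathbf{S}_n(E):=\sum_{k=0}^{n-1}1_E\circ T^k$. a) In any case, $$\liminf_{n\to\infty}\frac{\mathbf{S}_n(A)}{\mathbf{S}_n(B)}=0\ \text{ a.e.}\quad\text{or}\quad\limsup_{n\to\infty}\frac{\mathbf{S}_n(A)}{\mathbf{S}_n(B)}=\infty\ \text{ a.e.}\quad\text{(or both)}.$$ b) If $Tx-x=O(1-x-T(1-x))$ as $x\to0^+$, then $$\limsup_{n\to\infty}\frac{\mathbf{S}_n(A)}{\mathbf{S}_n(B)}=\infty\ \text{ a.e.}$$ In particular, if $Tx-x\asymp 1-x-T(1-x)$ as $x\to0^+$, then $$\liminf_{n\to\infty}\frac{\mathbf{S}_n(A)}{\mathbf{S}_n(B)}=0\ \text{ a.e.}\quad\text{and}\quad\limsup_{n\to\infty}\frac{\mathbf{S}_n(A)}{\mathbf{S}_n(B)}=\infty\ \text{ a.e.}$$ c) If $Tx=x+x^{1+p_0}\ell_0(x)$ and $1-T(1-x)=x+x^{1+p_1}\ell_1(x)$ near $0^+$ with $p_1>p_0>1$ and $\ell_0,\ell_1$ slowly varying (at $0^+$), then $$\lim_{n\to\infty}\frac{\mathbf{S}_n(A)}{\mathbf{S}_n(B)}=0\ \text{ a.e.}$$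
   Context: Conditions on $T:[0,1]\to[0,1]$, for some $c\in(0,1)$: (1) The restrictions $T|_{(0,c)}$ and $T|_{(c,1)}$ are $\mathcal{C}^2$-diffeomorphisms onto $(0,1)$, admitting $\mathcal{C}^2$-extensions to the respective closed intervals. (2) $T'>1$ on $(0,c]\cup[c,1)$ (at $c$ in the sense of the one-sided extensions) and $T'(0)=T'(1)=1$. (3) $T$ is convex on some neighbourhood of $0$ and concave on some neighbourhood of $1$. Such a $T$ is conservative and exact with respect to Lebesgue measure $\lambda$ on the Borel sets of $[0,1]$, and it preserves a $\sigma$-finite infinite measure $\mu$ equivalent to $\lambda$. ''a.e.'' refers to $\lambda$ (equivalently $\mu$). A function $\ell$ is slowly varying at $0^+$ if $\ell(sx)/\ell(x)\to1$ as $x\to0^+$ for all $s>0$. $u\asymp v$ means $u=O(v)$ and $v=O(u)$. *)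

(* Defs.v *)
From HB Require Import structures.
From mathcomp Require Import all_boot all_order all_algebra.
From mathcomp Require Import all_classical all_reals all_analysis.

Set Implicit Arguments.
Unset Strict Implicit.
Unset Printing Implicit Defensive.

Import Order.TTheory GRing.Theory Num.Theory.
Import numFieldNormedType.Exports.

Local Open Scope classical_set_scope.
Local Open Scope ring_scope.

Section Defs.
Context {R : realType}.
Implicit Types (D U V : set R) (f g F T : R -> R) (a b c x : R).

(* Differentiation relative to a set: at an interior point of D this is the
   ordinary derivative, at an endpoint of a closed interval D it is the
   one-sided one. *)
Definition diffq_in D f x : set_system R :=
  (f y - f x) / (y - x) @[y --> within D (dnbhs x)].

Definition is_derive_in D f x (l : R) : Prop := diffq_in D f x --> l.

Definition derivable_in D f x : Prop := cvg (diffq_in D f x).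

Definition derive_in D f x : R := lim (diffq_in D f x).

Definition C2_on D f : Prop :=
  [/\ forall x, D x -> derivable_in D f x,
      forall x, D x -> derivable_in D (derive_in D f) x &
      {within D, continuous (derive_in D (derive_in D f))}].

Definition C2_diffeo U V f : Prop :=
  [/\ set_bij U V f, C2_on U f &
      exists2 g, C2_on V g & forall x, U x -> g (f x) = x].

Definition C2_extension a b f F : Prop :=
  C2_on `[a, b] F /\ {in `]a, b[, F =1 f}.

(* T is a self-map of [0,1] represented by a total function on R; its values
   outside [0,1] play no role. The derivatives at 0 and 1 are those of T as a
   function on [0,1], so both points are fixed by T; the value at c is
   unconstrained, and the derivatives there are those of the extensions. *)
Definition indifferent_map c T : Prop :=
  [/\ set_fun `[0, 1] `[0, 1] T,
      C2_diffeo `]0, c[ `]0, 1[ T /\ C2_diffeo `]c, 1[ `]0, 1[ T,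
      exists F0 F1,
        [/\ C2_extension 0 c T F0, C2_extension c 1 T F1,
            forall x, 0 < x <= c -> 1 < derive_in `[0, c] F0 x &
            forall x, c <= x < 1 -> 1 < derive_in `[c, 1] F1 x],
      is_derive_in `[0, 1] T 0 1 /\ is_derive_in `[0, 1] T 1 1 &
      (exists2 e, 0 < e < 1 & convex_function (`[0, e[ : set R) T) /\
      (exists2 e, 0 < e < 1 &
         convex_function (`]1 - e, 1] : set R) (\- T))].

Definition occ T (E : set R) (n : nat) x : R :=
  \sum_(k < n) \1_E (iter k T x).

(* Real division, with u / 0 = 0. For E' of positive measure almost every
   orbit of an indifferent_map visits E', so the denominator is eventually
   positive and the convention does not affect almost everywhere limits. *)
Definition occ_ratio T (E E' : set R) x (n : nat) : R :=
  occ T E n x / occ T E' n x.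

Definition ae_unit (P : R -> Prop) : Prop :=
  {ae @lebesgue_measure R, forall x, 0 <= x <= 1 -> P x}.

Definition slowly_varying0 (l : R -> R) : Prop :=
  forall s, 0 < s -> l (s * x) / l x @[x --> 0^'+] --> (1 : R).

End Defs.

(* Main.v *)
Require Import Defs.
From HB Require Import structures.
From mathcomp Require Import all_boot all_order all_algebra.
From mathcomp Require Import all_classical all_reals all_analysis.
From mathcomp Require Import ring lra zify.

Set Implicit Arguments.
Unset Strict Implicit.
Unset Printing Implicit Defensive.

Import Order.TTheory GRing.Theory Num.Theory.
Import numFieldNormedType.Exports.

Local Open Scope classical_set_scope.
Local Open Scope ring_scope.

(** The point is coded by its itinerary: letter [k] tells on which side of [c] lies
    its [k]-th iterate. The cylinder of a word is an interval, and its length is the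
    mass of the word. Zeros of the itinerary are visits to the side of the fixed
    point [0], ones to the side of [1]; within a run of equal letters, all but the
    last few iterates are close to the fixed point. So the two occupation times are,
    up to a bounded number of steps per run, the numbers of zeros and of ones.

    Dynamics enters only through [cyl_length_law]: past and future are independent
    up to a constant factor [D] at the times at which a run starts, and run lengths
    have infinite mean. Independence up to a factor is bounded distortion. By the
    mean value theorem and the Lipschitz bound on the derivative, [distortion]
    reduces it to bounding the total length of the successive images of an interval.
    Along a run these images are disjoint, and every change of letter contracts by
    a factor [rho < 1] (lemma [suffix_lengths_le]). Infinite mean comes from
    [C^2]-smoothness: the displacement near the fixed points is at most quadratic,
    so tails decrease at most like [1/n].

    Let [u_b(s)] be the probability that a run of the letter [b] starts at time
    [s], and [q_b(n)] the probability that an initial run has length at least [n].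
    The expected number of times [s] that start a run of [b] of length at least
    [M s] is the sum of [u_b(s) q_b(M s)], up to the factor [D]. These series cannot
    converge for both letters ([not_summable_runs_both]): decomposing at the last
    start of a run gives [n <= D U(n) m(n)], where [U] sums the starts and [m] the
    tails, and then [renewal_divergence], a form of a theorem of Kesten on sums of
    variables with infinite mean, applies. If the series of [b] diverges, the second
    moment method finds a long run with a probability bounded below inside every
    cylinder in which a new run starts ([hit_after_base]), hence almost surely
    infinitely often ([miss_mass_small]). At the end of such a run, one side has been
    visited about [M] times as often as the other ([dominating_runs]). As [M] is
    arbitrary, divergence for the letter zero makes the upper limit of the ratio
    infinite, and divergence for the letter one makes its lower limit zero.

    If the displacement at [0] is bounded by a multiple of the one at [1], the tails
    of the runs of ones are bounded by those of the runs of zeros after a linear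
    change of time ([tail_compare]). Since starts of runs alternate, convergence of
    the series of zeros would then imply that of ones, so the series of zeros
    diverges; the other comparison is symmetric.

    Under the power laws with [p0 < p1], tails decay roughly like [n^(-1/p0)] for
    zeros and [n^(-1/p1)] for ones. The number of runs before [n] is at most of
    order [n] over the truncated mean of the runs of ones, so the expected frequency
    of zeros before [2^i] decays geometrically in [i] ([visits_power]). By Markov's
    inequality and Borel--Cantelli it vanishes almost surely ([ratio_cvg0]). *)

(** * Weighted sums and renewal sequences *)

Section RealSequences.
Context {R : realType}.
Implicit Types (a q u : nat -> R).

(** Summation by parts: against a nonincreasing weight, only the partial sums
    of [a] count. *)
Lemma abel_ge a q n B :
    {homo q : i j / (i <= j)%N >-> j <= i} -> (forall i, 0 <= q i) ->
    (forall k, (k <= n)%N -> - B <= \sum_(s < k) a s) -> 0 <= B ->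
  - (B * q 0%N) <= \sum_(s < n) a s * q s.
Proof.
move=> qd q0 hB B0.
have E : \sum_(s < n) a s * q s =
    (\sum_(s < n) a s) * q n
    + \sum_(s < n) (\sum_(i < s.+1) a i) * (q s - q s.+1).
  elim: n {hB} => [|n IH]; first by rewrite !big_ord0 mul0r addr0.
  rewrite big_ord_recr /= IH [X in _ = X * _ + _]big_ord_recr /=.
  rewrite [X in _ = _ + X]big_ord_recr /= (big_ord_recr n) /=.
  ring.
have E2 : B * q 0%N = B * q n + \sum_(s < n) B * (q s - q s.+1).
  rewrite -mulr_sumr -mulrDr; congr (_ * _).
  elim: (n) => [|k IH]; first by rewrite big_ord0 addr0.
  by rewrite big_ord_recr /= IH; ring.
rewrite E E2 opprD -sumrN; apply: lerD.
  by rewrite -mulNr ler_wpM2r // hB.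
apply: ler_sum => -[s sn] _ /=; rewrite -mulNr ler_wpM2r //.
  by rewrite subr_ge0 qd.
exact: hB.
Qed.

Lemma ler_sum_ord (g : nat -> R) i j :
  (forall k, 0 <= g k) -> (i <= j)%N -> \sum_(k < i) g k <= \sum_(k < j) g k.
Proof.
by move=> g0 /subnKC <-; rewrite [leRHS]big_split_ord lerDl sumr_ge0.
Qed.

Lemma bounded_tail (f : nat -> R) B e :
    {homo f : i j / (i <= j)%N >-> i <= j} -> (forall n, f n <= B) -> 0 < e ->
  exists K, forall n, f n <= f K + e.
Proof.
move=> fh fB e0.
have hs : has_sup (range f).
  by split; [exists (f 0%N), 0%N | exists B => _ [n _ <-]].
have [_ [K _ <-] hK] := sup_adherent e0 hs.
exists K => n; rewrite ltrBlDr in hK; apply: le_trans (ltW hK).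
by apply: ub_le_sup; [exact: hs.2 | exists n].
Qed.

(** Suppose that the series converges. Its tail beyond [K] is at most [e], which
    forces [q (M * N) * U N] to be small for large [N]. On the other hand, the
    partial sums of [u] up to [n] dominate those of the constant [c / m n], so
    that summation by parts makes the stretch from [N] to [n] contribute about
    [(c / m n) * (m n / M) = c / M], however small [e] is. *)
Lemma renewal_divergence u q c M :
    (forall s, 0 <= u s) -> (forall s, 0 <= q s) ->
    {homo q : i j / (i <= j)%N >-> j <= i} ->
    (forall e, 0 < e -> exists n, q n <= e) ->
    (forall B, exists n, B <= \sum_(j < n) q j) ->
    0 < c -> (0 < M)%N ->
    (forall n, c * n.+1%:R <= (\sum_(s < n.+1) u s) * \sum_(j < n.+1) q j) ->
  forall B, exists n, B < \sum_(s < n) u s * q (M * s)%N.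
Proof.
move=> u0 q0 qd qsm qdiv c0 M0 hU B.
apply: contrapT => /forallNP hB.
have {}hB n : \sum_(s < n) u s * q (M * s)%N <= B by rewrite leNgt; apply/negP.
pose f n := \sum_(s < n) u s * q (M * s)%N.
pose U n := \sum_(s < n) u s.
pose m n := \sum_(j < n) q j.
have fS n : f n.+1 = f n + u n * q (M * n)%N by rewrite /f big_ord_recr.
have US n : U n.+1 = U n + u n by rewrite /U big_ord_recr.
have mS n : m n.+1 = m n + q n by rewrite /m big_ord_recr.
have fh : {homo f : i j / (i <= j)%N >-> i <= j}.
  by apply: homo_leq => [//||n]; [exact: le_trans | rewrite fS lerDl mulr_ge0].
have mh : {homo m : i j / (i <= j)%N >-> i <= j}.
  by apply: homo_leq => [//||n]; [exact: le_trans | rewrite mS lerDl].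
have Uh : {homo U : i j / (i <= j)%N >-> i <= j}.
  by apply: homo_leq => [//||n]; [exact: le_trans | rewrite US lerDl].
have U0 n : 0 <= U n by apply: sumr_ge0.
have m0 n : 0 <= m n by apply: sumr_ge0.
have MR : 0 < M%:R :> R by rewrite ltr0n.
(* the bounds below add up to [4 * e <= 3 * e] *)
pose e := c / M%:R / 8.
have e0 : 0 < e by rewrite !divr_gt0.
have [K hK] := bounded_tail fh hB e0.
have [N0 hN0] : exists N, q N <= e / (U K + 1).
  by apply: qsm; rewrite divr_gt0 // ltr_pwDr.
pose N := maxn K N0.
have qUK : q (M * N)%N * U K <= e.
  apply: le_trans (_ : e / (U K + 1) * (U K + 1) <= _); last first.
    by rewrite divfK // lt0r_neq0 // ltr_pwDr.
  apply: ler_pM => //; last by rewrite lerDl.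
  apply: le_trans hN0; apply: qd; rewrite /N; nia.
(* the renewals before N carry little weight *)
have qUN : q (M * N)%N * U N <= 2 * e.
  have H n : (K <= n)%N -> q (M * n)%N * (U n - U K) <= f n - f K.
    elim: n => [|n IH]; first by rewrite leqn0 => /eqP ->; rewrite !subrr mulr0.
    rewrite leq_eqVlt => /orP[/eqP <-|]; first by rewrite !subrr mulr0.
    rewrite ltnS => Kn; rewrite fS US.
    have -> : U n + u n - U K = (U n - U K) + u n by ring.
    have -> : f n + u n * q (M * n)%N - f K = (f n - f K) + q (M * n)%N * u n.
      by ring.
    rewrite mulrDr; apply: lerD.
      apply: le_trans (IH Kn); rewrite ler_wpM2r ?subr_ge0 ?Uh //.
      by apply: qd; nia.
    by rewrite ler_wpM2r //; apply: qd; nia.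
  have := H N (leq_maxl _ _); have := hK N.
  by move: qUK; rewrite mulrBr; lra.
have [n0 hn0] := qdiv (2 * m (M * N)%N + 1).
pose n := (maxn n0 N).+1.
have Nn : (N <= n)%N by rewrite /n; lia.
have mn : 2 * m (M * N)%N + 1 <= m n.
  by apply: le_trans hn0 _; apply: mh; rewrite /n; lia.
have mn0 : 0 < m n.
  by apply: lt_le_trans mn; rewrite ltr_wpDl // mulr_ge0.
pose g := c / m n.
have g0 : 0 <= g by rewrite divr_ge0 // ltW.
have Ug k : (k <= n)%N -> g * k%:R <= U k.
  case: k => [_|k kn]; first by rewrite mulr0.
  rewrite /g mulrAC ler_pdivrMr //; apply: le_trans (hU k) _.
  by apply: ler_wpM2l; [exact: U0 | exact: mh].
have [d dE] : exists d, (n = N + d)%N by exists (n - N)%N; lia.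
have Ush k : U (N + k) = U N + \sum_(s < k) u (N + s)%N.
  by rewrite /U big_split_ord.
have key : - (U N * q (M * (N + 0))%N) <=
    \sum_(s < d) (u (N + s)%N - g) * q (M * (N + s))%N.
  apply: (@abel_ge (fun s => u (N + s)%N - g) (fun s => q (M * (N + s))%N)) => //.
    by move=> i j ij; apply: qd; nia.
  move=> k kd; rewrite sumrB sumr_const card_ord -mulr_natr.
  have := Ug (N + k)%N; rewrite dE leq_add2l => /(_ kd); rewrite Ush natrD mulrDr.
  have : 0 <= g * N%:R by rewrite mulr_ge0.
  lra.
have fsh : f n = f N + \sum_(s < d) u (N + s)%N * q (M * (N + s))%N.
  by rewrite dE /f big_split_ord.
have qs k : m (M * (N + k))%N - m (M * N)%N <=
    M%:R * \sum_(s < k) q (M * (N + s))%N.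
  elim: k => [|k IH]; first by rewrite addn0 subrr big_ord0 mulr0.
  rewrite big_ord_recr /= mulrDr.
  have : m (M * (N + k.+1))%N <= m (M * (N + k))%N + M%:R * q (M * (N + k))%N.
    have -> : (M * (N + k.+1) = M * (N + k) + M)%N by ring.
    rewrite /m big_split_ord /= lerD2l.
    apply: le_trans (_ : \sum_(i < M) q (M * (N + k))%N <= _).
      by apply: ler_sum => i _; apply: qd; lia.
    by rewrite sumr_const card_ord mulr_natl.
  by move: IH; lra.
have mMn : m n <= m (M * n)%N by apply: mh; nia.
have := qs d; rewrite -dE => qsd.
have hkn : f n <= f K + e := hK n.
have fKN : f K <= f N by apply: fh; exact: leq_maxl.
have S1 : \sum_(s < d) (u (N + s)%N - g) * q (M * (N + s))%N =
   f n - f N - g * \sum_(s < d) q (M * (N + s))%N.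
  rewrite fsh [f N + _]addrC addrK mulr_sumr -sumrB; apply: eq_bigr => s _.
  by rewrite mulrBl.
rewrite S1 addn0 in key.
have gS : g * (m n / 2) / M%:R <= g * \sum_(s < d) q (M * (N + s))%N.
  rewrite -mulrA ler_wpM2l // ler_pdivrMr // mulrC.
  rewrite mulrC in qsd.
  by lra.
have gE : g * (m n / 2) / M%:R = 4 * e.
  by rewrite /g /e; field; rewrite !lt0r_neq0.
have : U N * q (M * N)%N <= 2 * e by rewrite mulrC.
by lra.
Qed.

End RealSequences.

(** * Words and laws of zero-one sequences *)

Section Words.
Context {R : realType}.
Implicit Types (b : bool) (n s t : nat) (u v w y z : seq bool) (F : seq bool -> R).

Fixpoint words n : seq (seq bool) :=
  if n is n'.+1 then map (cons false) (words n') ++ map (cons true) (words n')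
  else [:: [::]].

Lemma mem_words n w : (w \in words n) = (size w == n).
Proof.
elim: n w => [|n IH] [|b w] //=.
  by rewrite mem_cat; apply/negP => /orP[] /mapP[].
rewrite mem_cat eqSS -IH; apply/orP/idP => [[]/mapP[v vn [_ ->]]//|wn].
by case: b; [right|left]; apply/mapP; exists w.
Qed.

Lemma sum_words0 F : \sum_(w <- words 0) F w = F [::].
Proof. by rewrite big_seq1. Qed.

Lemma sum_wordsS b n F :
  \sum_(w <- words n.+1) F w =
  \sum_(w <- words n) F (b :: w) + \sum_(w <- words n) F (~~ b :: w).
Proof. by rewrite big_cat !big_map; case: b => //=; rewrite addrC. Qed.

Lemma sum_words_cat s t F :
  \sum_(w <- words (s + t)) F w =
  \sum_(u <- words s) \sum_(v <- words t) F (u ++ v).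
Proof.
elim: s F => [|s IH] F; first by rewrite sum_words0.
by rewrite addSn !(sum_wordsS false) !IH.
Qed.

Lemma sum_words_rcons b n F :
  \sum_(w <- words n.+1) F w =
  \sum_(w <- words n) F (rcons w b) + \sum_(w <- words n) F (rcons w (~~ b)).
Proof.
rewrite -addn1 sum_words_cat -big_split; apply: eq_bigr => w _.
by rewrite (sum_wordsS b) !sum_words0 !cats1.
Qed.

Lemma sum_words_nseq k b F :
  \sum_(w <- words k | w == nseq k b) F w = F (nseq k b).
Proof.
rewrite big_mkcond; elim: k F => [|k IH] F; first by rewrite sum_words0 eqxx.
rewrite (sum_wordsS b) /= [X in _ + X]big1 ?addr0.
  rewrite -(IH (fun w => F (b :: w))); apply: eq_bigr => w _.
  by rewrite eqseq_cons eqxx.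
by move=> w _; rewrite eqseq_cons; case: (b).
Qed.

Lemma eqbN (a b : bool) : (a == ~~ b) = (a != b).
Proof. by case: a; case: b. Qed.

Lemma eqNbb b : (~~ b == b) = false. Proof. by case: b. Qed.

Lemma last_rconsb (a b c : bool) w : (last a (rcons w b) == c) = (b == c).
Proof. by rewrite last_rcons. Qed.

Lemma rcons_nseq k b : rcons (nseq k b) b = nseq k.+1 b.
Proof. by elim: k => //= k ->. Qed.

End Words.

(** Masses of cylinders of zero-one sequences. By [law_ub] and [law_lb], past and
    future are independent up to the factor [D] at the start of a run of [b]; the
    default value [~~ b] makes the empty past qualify. Such laws behave like
    alternating renewal processes, whose run lengths have infinite mean by
    [law_heavy]. *)
Record run_law (R : realType) (p : seq bool -> R) (D : R) : Prop := RunLaw {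
  law_nil : p [::] = 1;
  law_ge0 : forall w, 0 <= p w;
  law_split : forall w, p w = p (rcons w false) + p (rcons w true);
  law_suffix : forall w u, p (w ++ u) <= p u;
  law_cst : 1 <= D;
  law_ub : forall w b u, last (~~ b) w = ~~ b ->
    p (w ++ b :: u) <= D * p (rcons w b) * p (b :: u);
  law_lb : forall w b u, last (~~ b) w = ~~ b ->
    p (rcons w b) * p (b :: u) <= D * p (w ++ b :: u);
  law_small : forall b e, 0 < e -> exists n, p (nseq n b) <= e;
  law_heavy : forall b B, exists n, B <= \sum_(j < n) p (nseq j b) }.

Section RunLaw.
Context {R : realType} (p : seq bool -> R) (D : R) (hp : run_law p D).
Implicit Types (b : bool) (n s t : nat) (u v w y z h : seq bool).

Let p0 w : 0 <= p w. Proof. exact: law_ge0 hp w. Qed.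
Let D1 : 1 <= D. Proof. exact: law_cst hp. Qed.
Let D0 : 0 <= D. Proof. exact: le_trans ler01 D1. Qed.

Definition tail b n := p (nseq n b).

(** Mass of the sequences in which a run of [b] starts at time [s]; the default
    value of [last] lets a run start at time [0]. *)
Definition start b s := \sum_(w <- words s | last (~~ b) w == ~~ b) p (rcons w b).

(** Mass of the sequences with letter [b] at time [t - 1]. *)
Definition visit b t := \sum_(w <- words t | last (~~ b) w == b) p w.

(** Up to the factor [D], the sums are the expected numbers of times [s] at which
    starts a run of [b] of length at least [M * s]. *)
Definition summable_runs b M :=
  exists B, forall n, \sum_(s < n) start b s * tail b (M * s) <= B.

Lemma law_splitb b w : p w = p (rcons w b) + p (rcons w (~~ b)).
Proof. by rewrite (law_split hp); case: b => //=; rewrite addrC. Qed.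

Lemma sum_law w n : \sum_(v <- words n) p (w ++ v) = p w.
Proof.
elim: n w => [|n IH] w; first by rewrite sum_words0 cats0.
rewrite (sum_wordsS true) (law_splitb true) -2!IH.
by congr (_ + _); apply: eq_bigr => v _; rewrite cat_rcons.
Qed.

Lemma sum_words_law n : \sum_(v <- words n) p v = 1.
Proof. by rewrite -(law_nil hp) -(sum_law [::] n). Qed.

Lemma law_le w v : p (w ++ v) <= p w.
Proof.
rewrite -(sum_law w (size v)).
rewrite (big_rem v) /=; last by rewrite mem_words.
by rewrite lerDl sumr_ge0.
Qed.

Lemma law_le1 w : p w <= 1.
Proof. by rewrite -(law_nil hp) -[w]cat0s; exact: law_le. Qed.

Lemma tail_ge0 b n : 0 <= tail b n. Proof. exact: p0. Qed.

Lemma tail_le b : {homo tail b : i j / (i <= j)%N >-> j <= i}.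
Proof.
move=> i j ij; rewrite /tail -(subnKC ij) nseqD; exact: law_le.
Qed.

Lemma tail0 b : tail b 0 = 1. Proof. exact: law_nil hp. Qed.

Lemma start_ge0 b s : 0 <= start b s. Proof. exact: sumr_ge0. Qed.

Lemma visit_ge0 b s : 0 <= visit b s. Proof. exact: sumr_ge0. Qed.

Lemma visitD b t : visit b t.+1 + visit (~~ b) t.+1 = 1.
Proof.
rewrite -(sum_words_law t.+1) [RHS](bigID (fun w => last (~~ b) w == b)) /=.
congr (_ + _); rewrite /visit negbK.
rewrite big_seq_cond [RHS]big_seq_cond; apply: eq_bigl => w.
rewrite mem_words; case: w => //= a w; by case: b; case: (last a w).
Qed.

Lemma visit_le1 b t : visit b t <= 1.
Proof.
rewrite -(sum_words_law t) [leRHS](bigID (fun w => last (~~ b) w == b)) /=.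
by rewrite lerDl sumr_ge0.
Qed.

(** Last renewal decomposition: sort the words by the start of their last run. *)
Lemma visit_start_sum b t k :
  \sum_(w <- words t | last (~~ b) w == b) p (w ++ nseq k b) =
  \sum_(s < t) \sum_(w <- words s | last (~~ b) w == ~~ b)
     p (w ++ nseq (t - s + k) b).
Proof.
elim: t k => [|t IH] k; first by rewrite big_mkcond sum_words0 big_ord0 /= eqNbb.
rewrite big_mkcond (sum_words_rcons b) /= [X in _ + X]big1 ?addr0; last first.
  by move=> w _; rewrite last_rconsb eqNbb.
rewrite big_ord_recr /= subSnn add1n.
under eq_bigr do rewrite last_rconsb eqxx cat_rcons.
rewrite (bigID (fun w => last (~~ b) w == b)) /=; congr (_ + _).
  rewrite (IH k.+1); apply: eq_bigr => s _.
  by rewrite addnS -addSn -subSn // ltnW.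
by apply: eq_bigl => w; rewrite eqbN.
Qed.

Lemma start_tail_ub b s k :
  \sum_(w <- words s | last (~~ b) w == ~~ b) p (w ++ nseq k.+1 b) <=
  D * start b s * tail b k.+1.
Proof.
rewrite /start mulr_sumr mulr_suml; apply: ler_sum => w /eqP hw.
exact: law_ub hp _ _ _ hw.
Qed.

Lemma start_tail_lb b s k :
  start b s * tail b k.+1 <=
  D * \sum_(w <- words s | last (~~ b) w == ~~ b) p (w ++ nseq k.+1 b).
Proof.
rewrite /start mulr_sumr mulr_suml; apply: ler_sum => w /eqP hw.
exact: law_lb hp _ _ _ hw.
Qed.

Lemma visit_ub b t : visit b t <= D * \sum_(s < t) start b s * tail b (t - s).
Proof.
have -> : visit b t = \sum_(w <- words t | last (~~ b) w == b) p (w ++ nseq 0 b).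
  by apply: eq_bigr => w _; rewrite cats0.
rewrite visit_start_sum mulr_sumr; apply: ler_sum => s _.
by rewrite addn0 mulrA -(subnSK (ltn_ord s)); exact: start_tail_ub.
Qed.

Lemma visit_lb b t : \sum_(s < t) start b s * tail b (t - s) <= D * visit b t.
Proof.
have -> : visit b t = \sum_(w <- words t | last (~~ b) w == b) p (w ++ nseq 0 b).
  by apply: eq_bigr => w _; rewrite cats0.
rewrite visit_start_sum mulr_sumr; apply: ler_sum => s _.
by rewrite addn0 -(subnSK (ltn_ord s)); exact: start_tail_lb.
Qed.

(** Runs of the two letters alternate. *)
Lemma startS_le b s :
  visit b s + start b s <= visit b s.+1 + start (~~ b) s.
Proof.
rewrite /visit [X in _ <= X + _]big_mkcond (sum_words_rcons b) /=.
rewrite [X in _ <= _ + X + _]big1 ?addr0; last first.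
  by move=> w _; rewrite last_rconsb eqNbb.
under [X in _ <= X + _]eq_bigr do rewrite last_rconsb eqxx.
rewrite [X in _ <= X + _](bigID (fun w => last (~~ b) w == b)) /=.
have -> : \sum_(i <- words s | last (~~ b) i != b) p (rcons i b) = start b s.
  by apply: eq_bigl => w; rewrite eqbN.
rewrite addrAC lerD2r.
under eq_bigr do rewrite (law_splitb b).
rewrite big_split lerD2l /start negbK [leLHS]big_mkcond [leRHS]big_mkcond /=.
apply: ler_sum => w _; case: eqP => [|_]; last by case: ifP.
by case: w => [|a w] /= E; [case: (b) E | rewrite E eqxx].
Qed.

Lemma sum_start_le b n :
  \sum_(s < n) start b s <= \sum_(s < n) start (~~ b) s + 1.
Proof.
suff : \sum_(s < n) start b s <= \sum_(s < n) start (~~ b) s + visit b n.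
  by have := visit_le1 b n; lra.
elim: n => [|n IH]; first by rewrite !big_ord0 add0r visit_ge0.
by rewrite !big_ord_recr /=; have := startS_le b n; lra.
Qed.

(** By alternation, the starts of the runs of one letter can be exchanged for
    those of the other, at the cost of one term. *)
Lemma sum_start_tail_le (q : nat -> R) b n :
    {homo q : i j / (i <= j)%N >-> j <= i} -> (forall i, 0 <= q i) ->
  \sum_(s < n) start b s * q s <= \sum_(s < n) start (~~ b) s * q s + q 0%N.
Proof.
move=> qd q0.
have : - (1 * q 0%N) <= \sum_(s < n) (start (~~ b) s - start b s) * q s.
  apply: (@abel_ge _ (fun s => start (~~ b) s - start b s)) => // k kn; rewrite sumrB.
  by have := sum_start_le b k; lra.
under eq_bigr do rewrite mulrBl.
by rewrite sumrB; lra.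
Qed.

Lemma sum_triangleE (f g : nat -> R) n :
  \sum_(t < n) \sum_(s < t.+1) f s * g (t - s).+1 =
  \sum_(s < n) f s * \sum_(j < n - s) g j.+1.
Proof.
elim: n => [|n IH]; first by rewrite !big_ord0.
rewrite [LHS]big_ord_recr /= IH [RHS]big_ord_recr /= subSnn.
rewrite (big_ord_recr n) /= subnn addrA big_ord1; congr (_ + _).
rewrite -big_split; apply: eq_bigr => s _ /=.
by rewrite subSn 1?ltnW // big_ord_recr /= mulrDr.
Qed.

Lemma sum_triangle_le (f g : nat -> R) n :
    (forall i, 0 <= f i) -> (forall i, 0 <= g i) ->
  \sum_(t < n) \sum_(s < t.+1) f s * g (t - s).+1 <=
  (\sum_(s < n) f s) * \sum_(j < n) g j.+1.
Proof.
move=> f0 g0; rewrite sum_triangleE mulr_suml; apply: ler_sum => s _.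
apply: ler_wpM2l => //; apply: (@ler_sum_ord _ (fun j => g j.+1)) => //.
exact: leq_subr.
Qed.

Lemma sum_triangle_ge (f g : nat -> R) n :
    (forall i, 0 <= f i) -> (forall i, 0 <= g i) ->
  (\sum_(s < n) f s) * \sum_(j < n) g j.+1 <=
  \sum_(t < n + n) \sum_(s < t.+1) f s * g (t - s).+1.
Proof.
move=> f0 g0; rewrite sum_triangleE mulr_suml big_split_ord /=.
rewrite -[leLHS]addr0; apply: lerD; last first.
  by apply: sumr_ge0 => s _; rewrite mulr_ge0 // sumr_ge0.
apply: ler_sum => s _; apply: ler_wpM2l => //.
apply: (@ler_sum_ord _ (fun j => g j.+1)) => //.
by have := ltn_ord s; lia.
Qed.

(** The time spent in [b] is the number of runs of [b] times their truncated mean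
    length, in the mean and up to constants. *)
Lemma sum_visit_ub b n :
  \sum_(t < n) visit b t.+1 <=
  D * (\sum_(s < n) start b s) * \sum_(j < n) tail b j.+1.
Proof.
rewrite -mulrA; apply: le_trans (ler_wpM2l D0 (sum_triangle_le _ _ _)).
- rewrite mulr_sumr; apply: ler_sum => t _; apply: le_trans (visit_ub _ _) _.
  rewrite ler_wpM2l // ler_sum // => s _.
  by rewrite subSn // -ltnS.
- exact: start_ge0.
- exact: tail_ge0.
Qed.

Lemma sum_visit_lb b n :
  (\sum_(s < n) start b s) * \sum_(j < n) tail b j.+1 <=
  D * \sum_(t < n + n) visit b t.+1.
Proof.
apply: le_trans (sum_triangle_ge _ _ _) _.
- exact: start_ge0.
- exact: tail_ge0.
rewrite mulr_sumr; apply: ler_sum => t _; apply: le_trans (visit_lb _ _).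
by apply: ler_sum => s _; rewrite subSn // -ltnS.
Qed.

End RunLaw.

(** * Long runs of at least one letter are not summable *)

Section Dichotomy.
Context {R : realType} (p : seq bool -> R) (D : R) (hp : run_law p D).
Implicit Types (b : bool) (n s t : nat) (u v w y z h : seq bool).

Let D1 : 1 <= D. Proof. exact: law_cst hp. Qed.
Let D0 : 0 < D. Proof. exact: lt_le_trans ltr01 D1. Qed.

(** For the starts and tails of both letters taken together, the last renewal
    decomposition is the hypothesis of [renewal_divergence]. The products of the
    starts of one letter with the tails of the other are removed by
    alternation. *)
Theorem not_summable_runs_both M : (0 < M)%N ->
  summable_runs p false M -> summable_runs p true M -> False.
Proof.
move=> M0 [B0 hB0] [B1 hB1].
pose u s := start p false s + start p true s.
pose q s := tail p false s + tail p true s.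
have qd : {homo q : i j / (i <= j)%N >-> j <= i}.
  by move=> i j ij; apply: lerD; apply: (tail_le hp).
have [] := @renewal_divergence R u q D^-1 M _ _ qd _ _ _ M0 _ (2 * (B0 + B1) + 2).
- by move=> s; apply: addr_ge0; apply: (start_ge0 hp).
- by move=> s; apply: addr_ge0; apply: (tail_ge0 hp).
- move=> e e0.
  have [n0 h0] := law_small hp false (divr_gt0 e0 (ltr0n R 2)).
  have [n1 h1] := law_small hp true (divr_gt0 e0 (ltr0n R 2)).
  exists (maxn n0 n1); rewrite /q [leRHS]splitr; apply: lerD.
    by apply: le_trans h0; apply: (tail_le hp); exact: leq_maxl.
  by apply: le_trans h1; apply: (tail_le hp); exact: leq_maxr.
- move=> B; have [n hn] := law_heavy hp false B.
  exists n; apply: le_trans hn _; apply: ler_sum => j _.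
  by rewrite /q lerDl (tail_ge0 hp).
- by rewrite invr_gt0.
- move=> n; rewrite mulrC ler_pdivrMr //.
  have -> : n.+1%:R = \sum_(t < n.+1) (visit p false t.+1 + visit p true t.+1).
    under eq_bigr do rewrite (visitD hp false).
    by rewrite sumr_const card_ord.
  rewrite big_split /=.
  have := sum_visit_ub hp false n.+1; have := sum_visit_ub hp true n.+1.
  set U0 := \sum_(s < _) start p false s; set U1 := \sum_(s < _) start p true s.
  have U00 : 0 <= U0 by apply: sumr_ge0 => s _; apply: (start_ge0 hp).
  have U10 : 0 <= U1 by apply: sumr_ge0 => s _; apply: (start_ge0 hp).
  have H b : \sum_(j < n.+1) tail p b j.+1 <= \sum_(j < n.+1) tail p b j.
    by apply: ler_sum => j _; apply: (tail_le hp).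
  have q0 b : 0 <= \sum_(j < n.+1) tail p b j.
    by apply: sumr_ge0 => j _; apply: (tail_ge0 hp).
  have := ler_wpM2l (mulr_ge0 (ltW D0) U00) (H false).
  have := ler_wpM2l (mulr_ge0 (ltW D0) U10) (H true).
  rewrite !big_split /= -/U0 -/U1.
  have := mulr_ge0 (ltW D0) (mulr_ge0 U00 (q0 true)).
  have := mulr_ge0 (ltW D0) (mulr_ge0 U10 (q0 false)).
  by lra.
- move=> n; apply/negP; rewrite -leNgt.
  have hd b : {homo (fun s => tail p b (M * s)%N) : i j / (i <= j)%N >-> j <= i}.
    by move=> i j ij; apply: (tail_le hp); rewrite leq_mul2l ij orbT.
  have := @sum_start_tail_le _ _ _ hp _ false n (hd true) (fun i => tail_ge0 hp _ _).
  have := @sum_start_tail_le _ _ _ hp _ true n (hd false) (fun i => tail_ge0 hp _ _).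
  rewrite muln0 !(tail0 hp) /= => c1 c2.
  have h0 := hB0 n; have h1 := hB1 n.
  rewrite /u /q.
  under eq_bigr do rewrite mulrDl !mulrDr.
  by rewrite !big_split /=; lra.
Qed.

Lemma summable_runs_transfer b C j0 M :
    (forall i, tail p (~~ b) (j0 + C * i) <= tail p b i) ->
  summable_runs p b M -> summable_runs p (~~ b) (C * M + j0).
Proof.
move=> hC [B hB]; exists (B + 1) => n.
have hd : {homo (fun s => tail p b (M * s)%N) : i j / (i <= j)%N >-> j <= i}.
  by move=> i j ij; apply: (tail_le hp); rewrite leq_mul2l ij orbT.
apply: le_trans (_ : \sum_(s < n) start p (~~ b) s * tail p b (M * s) <= _).
  apply: ler_sum => s _; apply: ler_wpM2l; first exact: (start_ge0 hp).
  case: (posnP s) => [->|s0]; first by rewrite !muln0 !(tail0 hp).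
  by apply: le_trans (hC _); apply: (tail_le hp); nia.
have := @sum_start_tail_le _ _ _ hp _ (~~ b) n hd (fun i => tail_ge0 hp _ _).
by rewrite muln0 (tail0 hp) negbK; have := hB n; lra.
Qed.

End Dichotomy.

(** * The second moment method *)

Section SecondMoment.
Context {R : realType}.

Lemma sum_sqr (f : nat -> R) n :
  (\sum_(s < n) f s) ^+ 2 =
  \sum_(s < n) f s ^+ 2 + 2 * \sum_(s < n) f s * \sum_(t < n | (s < t)%N) f t.
Proof.
elim: n => [|n IH]; first by rewrite !big_ord0 expr0n mulr0 addr0.
rewrite !big_ord_recr /= sqrrD IH.
rewrite [X in f n * X]big1; last by move=> t; rewrite ltnNge -ltnS ltn_ord.
have -> : \sum_(i < n) f i * \sum_(t < n.+1 | (i < t)%N) f t =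
   \sum_(i < n) f i * \sum_(t < n | (i < t)%N) f t + (\sum_(i < n) f i) * f n.
  rewrite mulr_suml -big_split; apply: eq_bigr => i _ /=.
  by rewrite big_mkcond big_ord_recr /= ltn_ord -big_mkcond mulrDr.
by rewrite mulr0 addr0 -mulr_natr; ring.
Qed.

(** The argument of Kochen and Stone. For the number [N] of events that occur, the
    hypothesis bounds the second moment of [N] by [th = 1 + 2 * C] times its mean;
    then integrate the inequality [2 th N <= th^2 [N > 0] + N^2]. *)
Lemma hit_mass_ge (I : eqType) (r : seq I) (m : I -> R) (F : nat -> I -> bool)
    (n : nat) (C : R) :
    (forall x, 0 <= m x) -> 0 <= C ->
    (forall s, (s < n)%N ->
       \sum_(t < n | (s < t)%N) \sum_(x <- r | F s x && F t x) m x <=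
       C * \sum_(x <- r | F s x) m x) ->
  \sum_(s < n) \sum_(x <- r | F s x) m x <=
  (1 + 2 * C) * \sum_(x <- r | [exists s : 'I_n, F s x]) m x.
Proof.
move=> m0 C0 hC; set th := 1 + 2 * C; set EN := \sum_(s < n) _.
have th0 : 0 < th by rewrite ltr_pwDl // mulr_ge0.
pose f x s : R := (F s x)%:R.
pose N x := \sum_(s < n) f x s.
have sumF (P : pred I) : \sum_(x <- r | P x) m x = \sum_(x <- r) m x * (P x)%:R.
  rewrite big_mkcond; apply: eq_bigr => x _.
  by case: (P x); rewrite ?mulr1 ?mulr0.
have NE : EN = \sum_(x <- r) m x * N x.
  rewrite /EN; under eq_bigr do rewrite sumF.
  by rewrite exchange_big; apply: eq_bigr => x _; rewrite /N mulr_sumr.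
have N2 : \sum_(x <- r) m x * N x ^+ 2 <= th * EN.
  have -> : \sum_(x <- r) m x * N x ^+ 2 = EN +
     2 * \sum_(s < n) \sum_(t < n | (s < t)%N) \sum_(x <- r | F s x && F t x) m x.
    under eq_bigr do rewrite sum_sqr mulrDr.
    rewrite big_split NE /=; congr (_ + _).
      apply: eq_bigr => x _; congr (_ * _); apply: eq_bigr => s _.
      by rewrite /f; case: (F s x); rewrite ?expr1n ?expr0n.
    rewrite mulr_sumr; under [RHS]eq_bigr do rewrite mulr_sumr.
    under [RHS]eq_bigr => s _ do under eq_bigr => t _ do rewrite sumF.
    under [RHS]eq_bigr => s _ do under eq_bigr => t _ do rewrite mulr_sumr.
    under [RHS]eq_bigr do rewrite exchange_big.
    rewrite [RHS]exchange_big; apply: eq_bigr => x _ /=.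
    rewrite mulrA [_ * 2]mulrC -mulrA !mulr_sumr; apply: eq_bigr => s _.
    rewrite !mulr_sumr; apply: eq_bigr => t _.
    by rewrite -mulnb natrM.
  have -> : th * EN = EN + 2 * (C * EN) by rewrite /th; ring.
  rewrite lerD2l ler_wpM2l // mulr_sumr.
  by apply: ler_sum => s _; apply: hC.
have AM : 2 * th * EN <=
    th ^+ 2 * \sum_(x <- r | [exists s : 'I_n, F s x]) m x + th * EN.
  apply: le_trans (lerD (lexx _) N2); rewrite NE sumF !mulr_sumr -big_split /=.
  apply: ler_sum => x _; rewrite mulrCA [th ^+ 2 * _]mulrCA -mulrDr.
  apply: ler_wpM2l => //.
  case: existsP => [_|h].
    rewrite -subr_ge0 (_ : _ - _ = (th - N x) ^+ 2) ?sqr_ge0 //=; ring.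
  have -> : N x = 0.
    rewrite /N big1 // => s _; rewrite /f; case E: (F s x) => //.
    by case: h; exists s.
  by rewrite !mulr0 expr0n addr0.
rewrite -(ler_pM2l th0); move: AM; rewrite expr2 -mulrA; lra.
Qed.

End SecondMoment.

(** * Hitting a long run after a given past *)

Section RunsAt.
Implicit Types (b : bool) (l s t : nat) (x y z g : seq bool).

(** The default value [b] of [last] excludes runs that start at time [0], whose
    past is not determined. *)
Definition runs_at b l s z :=
  (last b (take s z) == ~~ b) && (take l (drop s z) == nseq l b).

Lemma runs_at_size b l s z : (0 < l)%N -> runs_at b l s z -> (s + l <= size z)%N.
Proof.
move=> l0 /andP[_ /eqP/(congr1 size)]; rewrite size_nseq size_take size_drop.
case: (ltnP l) => [lt _|_ E]; first by move: lt; rewrite ltn_subRL => /ltnW.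
by move: l0; rewrite -E subn_gt0 => /ltnW/subnKC ->.
Qed.

Lemma runs_at_cat b l s z y : (0 < l)%N -> runs_at b l s z -> runs_at b l s (z ++ y).
Proof.
move=> l0 h; have hs := runs_at_size l0 h; move: h; rewrite /runs_at.
rewrite takel_cat; last by lia.
rewrite drop_cat; case: ltnP => [sz|]; last by lia.
by rewrite takel_cat // size_drop; lia.
Qed.

Lemma runs_at_shift b l s g x : last b g = b ->
  runs_at b l (size g + s) (g ++ x) = runs_at b l s x.
Proof.
move=> hg; rewrite /runs_at takeD take_size_cat // drop_size_cat //.
by rewrite last_cat hg addnC -drop_drop drop_size_cat.
Qed.

Lemma runs_at_after b l l' s t x : (0 < l)%N -> runs_at b l s x ->
  runs_at b l' (s + l + t) x = runs_at b l' t (drop (s + l) x).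
Proof.
move=> l0 h; have hs := runs_at_size l0 h.
rewrite -{1}(cat_take_drop (s + l) x) -{1}(size_takel hs) runs_at_shift //.
move: h => /andP[_ /eqP E]; rewrite takeD E last_cat.
by rewrite -(prednK l0) -rcons_nseq last_rcons.
Qed.

Lemma runs_at_le b l l' s x : (l <= l')%N -> runs_at b l' s x -> runs_at b l s x.
Proof.
move=> ll /andP[h /eqP E]; rewrite /runs_at h /=.
by rewrite -(take_takel _ ll) E take_nseq.
Qed.

Lemma runs_at_overlap b l l' s t x : (s < t)%N -> (t < s + l)%N ->
  runs_at b l s x -> runs_at b l' t x = false.
Proof.
move=> st tl /andP[_ /eqP E]; apply/negbTE; rewrite negb_and; apply/orP; left.
have -> : take t x = take s x ++ nseq (t - s) b.
  rewrite -{1}(subnKC (ltnW st)) takeD; congr (_ ++ _).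
  have : (t - s <= l)%N by lia.
  by move=> h; rewrite -(take_takel _ h) E take_nseq.
rewrite last_cat; have -> : (t - s = (t - s).-1.+1)%N by lia.
by rewrite -rcons_nseq last_rcons; case: (b).
Qed.

End RunsAt.

Section HitAfterBase.
Context {R : realType} (p : seq bool -> R) (D : R) (hp : run_law p D).
Variables (b : bool) (k : nat -> nat).
Hypothesis k_gt0 : forall s, (0 < k s)%N.
Hypothesis k_le : {homo k : s t / (s <= t)%N}.
Implicit Types (n s t l : nat) (u v w x y z h g : seq bool).

Let p0 w : 0 <= p w. Proof. exact: law_ge0 hp w. Qed.
Let D1 : 1 <= D. Proof. exact: law_cst hp. Qed.
Let D0 : 0 < D. Proof. exact: lt_le_trans ltr01 D1. Qed.

(** As [start], for sequences that begin with the other letter: the situation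
    just after a run of [b] has ended. *)
Definition fstart s :=
  \sum_(x <- words s | (head b x == ~~ b) && (last b x == ~~ b)) p (rcons x b).

Definition potential n := \sum_(s < n) fstart s * tail p b (k s).

Let fstart_ge0 s : 0 <= fstart s. Proof. exact: sumr_ge0. Qed.

Lemma potential_ge0 n : 0 <= potential n.
Proof. by apply: sumr_ge0 => s _; rewrite mulr_ge0 // p0. Qed.

Lemma potential_le : {homo potential : m n / (m <= n)%N >-> m <= n}.
Proof.
move=> m n mn; apply: (@ler_sum_ord _ (fun s => fstart s * tail p b (k s))) => //.
by move=> s; rewrite mulr_ge0 // p0.
Qed.

Lemma fstart0 : fstart 0 = 0.
Proof. by rewrite /fstart big_mkcond sum_words0 /=; case: (b). Qed.

Lemma fstartS s :
  fstart s.+1 = \sum_(x <- words s | last (~~ b) x == ~~ b) p (~~ b :: rcons x b).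
Proof.
rewrite /fstart big_mkcond (sum_wordsS b) /= [X in X + _]big1 ?add0r.
  by rewrite [RHS]big_mkcond; apply: eq_bigr => w _ /=; rewrite eqxx.
by move=> w _; case: (b).
Qed.

(** Mass, up to a factor, of the long runs of [b] that start within [n] steps
    after the word [h]. *)
Definition later n h := \sum_(t < n)
  \sum_(y <- words t | last b y == ~~ b) p (rcons (h ++ y) b) * tail p b (k t).

(** Once the run of [b] in progress has ended, the process starts afresh up to
    the distortion constant. *)
Lemma later_le n h : last (~~ b) h = b -> later n h <= D * p h * potential n.
Proof.
elim: n h => [|n IH] h hb; first by rewrite /later /potential !big_ord0 mulr0.
rewrite /later big_ord_recl /= [X in X + _]big1_seq ?add0r; last first.
  by move=> w; rewrite inE => /andP[E /eqP W]; move: E; rewrite W; case: (b).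
rewrite (law_splitb hp b) mulrDr mulrDl.
have E t F : \sum_(y <- words t.+1 | last b y == ~~ b) F y =
   \sum_(y <- words t | last b y == ~~ b) F (b :: y) +
   \sum_(y <- words t | last (~~ b) y == ~~ b) F (~~ b :: y) :> R.
  by rewrite big_mkcond (sum_wordsS b) -!big_mkcond.
under eq_bigr do rewrite E.
rewrite big_split; apply: lerD.
  apply: le_trans (_ : later n (rcons h b) <= _).
    apply: ler_sum => t _; apply: ler_sum => y _; rewrite cat_rcons.
    by apply: ler_wpM2l => //; apply: (tail_le hp); apply: k_le.
  apply: le_trans (IH _ _) _; first by rewrite last_rcons.
  apply: ler_wpM2l; first by rewrite mulr_ge0 // ltW.
  exact: potential_le.
rewrite /potential big_ord_recl fstart0 mul0r add0r mulr_sumr.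
apply: ler_sum => t _; rewrite fstartS mulr_suml mulr_sumr.
apply: ler_sum => y _; rewrite mulrA; apply: ler_wpM2r; first exact: p0.
rewrite rcons_cat /=; apply: law_ub hp _ _ _ _.
by rewrite !negbK; case: (h) hb.
Qed.

(** A start of a run is preceded by the first run of [~~ b], unless it is at time
    [0]; before this one there may be an initial run of [b]. *)
Lemma sum_start_potential n :
  \sum_(s < n) start p b s * tail p b (k s) <= 1 + (D + 1) * potential n.
Proof.
case: n => [|n].
  by rewrite big_ord0 addr_ge0 // mulr_ge0 ?potential_ge0 // addr_ge0 // ltW.
rewrite big_ord_recl; apply: lerD.
  rewrite -[leRHS]mulr1; apply: ler_pM => //; rewrite ?p0 ?(law_le1 hp) //.
    exact: (start_ge0 hp).
  rewrite /start big_mkcond sum_words0 /=; case: ifP => // _; exact: (law_le1 hp).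
apply: le_trans (_ : later n [:: b] + potential n.+1 <= _); last first.
  rewrite [X in _ <= X * _]addrC mulrDl mul1r addrC lerD2l.
  apply: le_trans (later_le _ _) _; first by case: (b).
  rewrite -mulrA; apply: ler_wpM2l; [exact: ltW | rewrite -[leRHS]mul1r].
  by apply: ler_pM => //; rewrite ?potential_ge0 ?(law_le1 hp) ?potential_le.
rewrite /potential big_ord_recl fstart0 mul0r add0r -big_split /=.
apply: ler_sum => s _; rewrite /bump add1n fstartS.
rewrite /start big_mkcond (sum_wordsS b) mulrDl -!big_mkcond /=; apply: lerD => //.
rewrite -mulr_suml; apply: ler_pM => //; rewrite ?p0 ?sumr_ge0 //.
  by apply: (tail_le hp); apply: k_le.
Qed.

Lemma sum_words_runs_at P Q s l r (F : seq bool -> R) :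
  \sum_(x <- words (s + (l + r)) |
     [&& P (take s x), runs_at b l s x & Q (drop (s + l) x)]) F x =
  \sum_(x <- words s | P x && (last b x == ~~ b))
    \sum_(y <- words r | Q y) F (x ++ nseq l b ++ y).
Proof.
rewrite big_mkcond sum_words_cat [RHS]big_mkcond big_seq [RHS]big_seq.
apply: eq_bigr => x; rewrite mem_words => /eqP sx.
have E v y : v \in words l -> [&& P (take s (x ++ v ++ y)), runs_at b l s (x ++ v ++ y)
     & Q (drop (s + l) (x ++ v ++ y))] =
     [&& P x, last b x == ~~ b, v == nseq l b & Q y].
  rewrite mem_words => /eqP sv.
  rewrite /runs_at [(s + l)%N]addnC -drop_drop !(drop_size_cat _ sx).
  by rewrite !(take_size_cat _ sx) (take_size_cat _ sv) (drop_size_cat _ sv) -!andbA.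
rewrite sum_words_cat.
transitivity (\sum_(v <- words l | v == nseq l b) \sum_(y <- words r)
   if [&& P x, last b x == ~~ b & Q y] then F (x ++ v ++ y) else 0).
  rewrite [RHS]big_mkcond big_seq [RHS]big_seq; apply: eq_bigr => v vl.
  case: eqP => [vE|vE]; last first.
    by rewrite big1 // => y _; rewrite E // (introF eqP vE) /= !andbF.
  by apply: eq_bigr => y _; rewrite E // vE eqxx.
rewrite sum_words_nseq; case: (P x) => /=; last by rewrite big1.
by case: eqP => [_|_]; [rewrite -big_mkcond | rewrite big1].
Qed.

Lemma sum_words_runs_at_law P s l r g :
  \sum_(x <- words (s + (l + r)) | P (take s x) && runs_at b l s x) p (g ++ x) =
  \sum_(x <- words s | P x && (last b x == ~~ b)) p (g ++ x ++ nseq l b).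
Proof.
have := sum_words_runs_at P xpredT s l r (fun x => p (g ++ x)).
under eq_bigl do rewrite andbT; move=> ->; apply: eq_bigr => x _.
by under eq_bigr do rewrite !catA; rewrite (sum_law hp) !catA.
Qed.

Lemma sum_ord_shift_le (a c : nat -> R) s m n :
    (forall t, (s < t < m)%N -> a t = 0) -> (forall t, 0 <= c t) ->
    (forall t, (m + t < n)%N -> a (m + t)%N <= c t) ->
  \sum_(t < n | (s < t)%N) a t <= \sum_(t < n) c t.
Proof.
move=> a0 c0 ac; rewrite big_mkcond; case: (leqP n m) => nm.
  rewrite big1 ?sumr_ge0 // => t _; case: ifP => // st; apply: a0.
  by rewrite st /=; apply: leq_trans nm.
have E := subnKC (ltnW nm); set d := (n - m)%N in E.
rewrite -(big_mkord xpredT (fun t => if (s < t)%N then a t else 0)) -E big_mkord.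
rewrite big_split_ord /= big1 ?add0r; last first.
  by move=> t _; case: ifP => // st; apply: a0; rewrite st /=.
apply: le_trans (_ : \sum_(t < d) c t <= _).
  apply: ler_sum => t _; case: ifP => // _; apply: ac.
  by rewrite -E ltn_add2l.
by apply: ler_sum_ord => //; rewrite leq_addl.
Qed.

Section Base.
Variables (g : seq bool) (H : nat).
Hypothesis g_last : last b g = b.

Let hd x := head b x == ~~ b.

Definition run_mass s := \sum_(x <- words H | hd x && runs_at b (k s) s x) p (g ++ x).

Lemma run_massE s : (0 < s)%N -> (s + k s <= H)%N ->
  run_mass s = \sum_(x <- words s | hd x && (last b x == ~~ b))
                  p (g ++ x ++ nseq (k s) b).
Proof.
move=> s0 /subnKC E; rewrite /run_mass -{1}E -addnA.
rewrite -(sum_words_runs_at_law hd s (k s) (H - (s + k s))); apply: eq_bigl => x; congr (_ && _).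
by case: s s0 {E} => // s _; rewrite /hd; case: x.
Qed.

Lemma run_mass_ge s : (0 < s)%N -> (s + k s <= H)%N ->
  p (rcons g (~~ b)) * (fstart s * tail p b (k s)) <= D ^+ 2 * run_mass s.
Proof.
move=> s0 sH; rewrite run_massE // /fstart mulr_suml !mulr_sumr.
apply: ler_sum => x /andP[hx lx].
have [x' xE] : exists x', x = ~~ b :: x'.
  case: x hx {lx} => [|a x']; rewrite /hd /=; first by case: (b).
  by move=> /eqP ->; exists x'.
have h1 : p (rcons x b) * tail p b (k s) <= D * p (x ++ nseq (k s) b).
  rewrite /tail -(prednK (k_gt0 s)); apply: (law_lb hp).
  by move: lx; rewrite xE /= => /eqP.
have h2 : p (rcons g (~~ b)) * p (x ++ nseq (k s) b) <=
    D * p (g ++ x ++ nseq (k s) b).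
  by rewrite xE; apply: (law_lb hp); rewrite !negbK.
apply: le_trans (ler_wpM2l (p0 _) h1) _.
by rewrite mulrCA expr2 -mulrA (ler_pM2l D0).
Qed.

(** The run that starts at [s] occupies the times before [s + k s]; from there on,
    [later_le] applies to the run in progress. *)
Lemma run_mass_pair s n : (0 < s)%N -> (forall t, (t < n)%N -> (t + k t <= H)%N) ->
    (s < n)%N ->
  \sum_(t < n | (s < t)%N)
    \sum_(x <- words H | hd x && (runs_at b (k s) s x && runs_at b (k t) t x)) p (g ++ x)
  <= D ^+ 2 * potential n * run_mass s.
Proof.
move=> s0 nH sn; set l := k s; have l0 : (0 < l)%N := k_gt0 s.
pose S := [seq x <- words s | hd x && (last b x == ~~ b)].
pose base x := g ++ x ++ nseq l b.
pose c t := \sum_(x <- S) D * \sum_(y <- words t | last b y == ~~ b)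
    p (rcons (base x ++ y) b) * tail p b (k t).
have c0 t : 0 <= c t.
  apply: sumr_ge0 => x _; apply: mulr_ge0; first exact: ltW.
  by apply: sumr_ge0 => y _; rewrite mulr_ge0 // p0.
apply: le_trans (_ : \sum_(t < n) c t <= _).
  apply: (@sum_ord_shift_le (fun t => \sum_(x <- words H |
    hd x && (runs_at b l s x && runs_at b (k t) t x)) p (g ++ x)) c s (s + l)) => //.
    move=> t /andP[st tl]; rewrite big1 // => x /and3P[_ h1 h2].
    by move: h2; rewrite (runs_at_overlap _ st tl h1).
  move=> t tn; set t' := (s + l + t)%N.
  have [r rE] : exists r, (H = s + (l + (t + (k t' + r))))%N.
    by exists (H - (t' + k t'))%N; have := nH _ tn; rewrite -/t' /t'; lia.
  have -> : \sum_(x <- words H | hd x && (runs_at b l s x && runs_at b (k t') t' x))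
       p (g ++ x) = \sum_(x <- words (s + (l + (t + (k t' + r)))) |
     [&& hd (take s x), runs_at b l s x & runs_at b (k t') t (drop (s + l) x)])
       p (g ++ x).
    rewrite -rE; apply: eq_bigl => x; congr (_ && _).
      by case: (s) s0 => // ? _; rewrite /hd; case: (x).
    by case E : runs_at => //=; rewrite /t' (runs_at_after _ _ l0).
  rewrite (sum_words_runs_at hd (runs_at b (k t') t)) -big_filter -/S.
  apply: ler_sum => x _.
  under eq_bigr do rewrite [x ++ _]catA catA.
  have -> := sum_words_runs_at_law xpredT t (k t') r (g ++ x ++ nseq l b).
  rewrite -/(base x) mulr_sumr; apply: ler_sum => y /eqP ly.
  apply: le_trans (_ : D * p (rcons (base x ++ y) b) * tail p b (k t') <= _).
    rewrite /tail -(prednK (k_gt0 t')) catA; apply: (law_ub hp).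
    by rewrite last_cat; case: (y) ly => //= /esym; case: (b).
  rewrite -mulrA (ler_pM2l D0) ler_wpM2l //; apply: (tail_le hp).
  by apply: k_le; rewrite /t'; lia.
rewrite exchange_big /= run_massE ?nH // mulr_sumr -[leRHS]big_filter -/S.
apply: ler_sum => x _; rewrite -mulr_sumr -/(later n (base x)).
rewrite expr2 -2!mulrA (ler_pM2l D0) [_ * p _]mulrC mulrA.
apply: later_le; rewrite /base !last_cat.
by rewrite -(prednK l0) -rcons_nseq last_rcons.
Qed.

End Base.

Definition hit_rate : R := (6 * D ^+ 4)^-1.

Lemma hit_rate_gt0 : 0 < hit_rate.
Proof. by rewrite invr_gt0 mulr_gt0 // exprn_gt0. Qed.

Lemma hit_rate_le1 : hit_rate <= 1.
Proof.
rewrite invf_le1 ?mulr_gt0 ?exprn_gt0 //.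
have : 1 <= D ^+ 4 by rewrite exprn_ege1.
lra.
Qed.

(** Up to powers of [D], the potential is both the expected number of long runs
    and a bound for the expected number of those that follow a given one. So the
    second moment method yields a proportion of hits that depends on [D] only.
    Its divergence makes up for leaving out the runs that start before [s0]. *)
Lemma hit_after_base g s0 : last b g = b -> (0 < s0)%N ->
    (forall B, exists n, B <= potential n) ->
  exists n, forall H, (n + k n <= H)%N ->
    \sum_(x <- words H | (head b x == ~~ b) &&
        ~~ [exists s : 'I_n, (s0 <= s)%N && runs_at b (k s) s x]) p (g ++ x) <=
    (1 - hit_rate) * p (rcons g (~~ b)).
Proof.
move=> gb s00 hdiv; have [n hn] := hdiv (2 * potential s0 + 1).
exists n => H nH.
have tH t : (t < n)%N -> (t + k t <= H)%N.
  by move=> tn; apply: leq_trans nH; apply: leq_add; [|apply: k_le]; exact: ltnW.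
pose r := [seq x <- words H | head b x == ~~ b].
pose F s x := (s0 <= s)%N && runs_at b (k s) s x.
pose Hit := \sum_(x <- r | [exists s : 'I_n, F s x]) p (g ++ x).
have A0 := potential_ge0 s0.
have An : 1 <= potential n by lra.
have An0 := potential_ge0 n.
have total : \sum_(x <- r) p (g ++ x) = p (rcons g (~~ b)).
  have H0 : (0 < H)%N by have := k_gt0 n; lia.
  rewrite big_filter -(prednK H0) big_mkcond (sum_wordsS b) /= big1 ?add0r; last first.
    by move=> x _; case: (b).
  under eq_bigr do rewrite eqxx -cat_rcons.
  exact: (sum_law hp).
have mE s : (s0 <= s)%N -> \sum_(x <- r | F s x) p (g ++ x) = run_mass g H s.
  by move=> ss; rewrite big_filter_cond /F ss.
have m0 s : (s < s0)%N -> \sum_(x <- r | F s x) p (g ++ x) = 0.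
  by move=> ss; rewrite big1 // => x; rewrite /F leqNgt ss.
have EN : \sum_(s < n) \sum_(x <- r | F s x) p (g ++ x) <=
    (1 + 2 * (D ^+ 2 * potential n)) * Hit.
  apply: hit_mass_ge => // [|s sn]; first by rewrite mulr_ge0 // exprn_ge0 // ltW.
  case: (leqP s0 s) => ss; last first.
    rewrite (m0 s ss) mulr0 big1 // => t _; rewrite big1 // => x.
    by rewrite /F leqNgt ss.
  rewrite mE //; apply: le_trans (run_mass_pair gb _ tH sn); last exact: leq_trans ss.
  rewrite le_eqVlt; apply/orP; left; apply/eqP; apply: eq_bigr => t st.
  rewrite big_filter_cond; apply: eq_bigl => x.
  by rewrite /F ss (leq_trans ss (ltnW st)).
have low : p (rcons g (~~ b)) * (potential n - potential s0) <=
    D ^+ 2 * \sum_(s < n) \sum_(x <- r | F s x) p (g ++ x).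
  case: (leqP n s0) => ns.
    apply: le_trans (_ : 0 <= _).
      by rewrite mulr_ge0_le0 // subr_le0 potential_le.
    apply: mulr_ge0; first by rewrite exprn_ge0 // ltW.
    by apply: sumr_ge0 => s _; exact: sumr_ge0.
  have E := subnKC (ltnW ns); set d := (n - s0)%N in E.
  have pE : potential n = potential s0 +
      \sum_(s < d) fstart (s0 + s) * tail p b (k (s0 + s)).
    by rewrite -E /potential big_split_ord.
  rewrite pE [potential s0 + _]addrC addrK.
  rewrite -(big_mkord xpredT (fun s => \sum_(x <- r | F s x) p (g ++ x))).
  rewrite -E big_mkord big_split_ord /=.
  rewrite [X in _ * (X + _)]big1 ?add0r; last by move=> s _; rewrite m0.
  rewrite !mulr_sumr; apply: ler_sum => s _.
  rewrite mE ?leq_addr //; apply: run_mass_ge => //; first by lia.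
  by apply: tH; rewrite -E ltn_add2l.
have split : \sum_(x <- words H | (head b x == ~~ b) &&
        ~~ [exists s : 'I_n, (s0 <= s)%N && runs_at b (k s) s x]) p (g ++ x) =
    p (rcons g (~~ b)) - Hit.
  rewrite -total [X in _ = X - _](bigID (fun x => [exists s : 'I_n, F s x])) /=.
  by rewrite -/Hit [Hit + _]addrC addrK big_filter_cond.
rewrite split mulrBl mul1r lerD2l lerN2.
have D2 : 1 <= D ^+ 2 by rewrite exprn_ege1.
rewrite /hit_rate mulrC ler_pdivrMr ?mulr_gt0 ?exprn_gt0 //.
have Hit0 : 0 <= Hit by apply: sumr_ge0.
have p0' := p0 (rcons g (~~ b)).
(* both constants are absorbed because the potential is at least 1 *)
have h1 : p (rcons g (~~ b)) * (potential n / 2) <=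
    p (rcons g (~~ b)) * (potential n - potential s0).
  by apply: ler_wpM2l => //; lra.
have h2 : (1 + 2 * (D ^+ 2 * potential n)) * Hit <=
    3 * (D ^+ 2 * potential n) * Hit.
  apply: ler_wpM2r => //.
  have : 1 * 1 <= D ^+ 2 * potential n by apply: ler_pM.
  by lra.
have h3 := ler_wpM2l (le_trans ler01 D2) (le_trans EN h2).
have h4 := le_trans (le_trans h1 low) h3.
have An' : 0 < potential n by lra.
rewrite -(ler_pM2r An').
have -> : Hit * (6 * D ^+ 4) * potential n =
   2 * (D ^+ 2 * (3 * (D ^+ 2 * potential n) * Hit)) by ring.
lra.
Qed.

End HitAfterBase.

(** * Almost every sequence has infinitely many long runs *)

Section InfinitelyManyLongRuns.
Context {R : realType} (p : seq bool -> R) (D : R) (hp : run_law p D).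
Context (b : bool) (K : nat -> nat) (K_gt0 : forall s, (0 < K s)%N)
  (K_le : {homo K : s t / (s <= t)%N}).
Implicit Types (n s t l : nat) (u v w x y z h g : seq bool).

Let p0 w : 0 <= p w. Proof. exact: law_ge0 hp w. Qed.

Definition miss S z :=
  all (fun s => (S <= s)%N ==> ~~ runs_at b (K s) s z) (iota 0 (size z)).

Lemma missP S z :
  reflect (forall s, (S <= s)%N -> ~~ runs_at b (K s) s z) (miss S z).
Proof.
apply: (iffP allP) => [h s Ss|h s _]; last by apply/implyP; exact: h.
case: (ltnP s (size z)) => sz.
  by apply: (implyP (h s _) Ss); rewrite mem_iota.
by apply/negP => /(runs_at_size (K_gt0 s)); have := K_gt0 s; lia.
Qed.

Lemma miss_cat S z y : miss S (z ++ y) -> miss S z.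
Proof.
move=> /missP h; apply/missP => s /h; apply: contra.
exact: runs_at_cat.
Qed.

Definition miss_mass S n z := \sum_(y <- words n | miss S (z ++ y)) p (z ++ y).

Lemma miss_mass_ge0 S n z : 0 <= miss_mass S n z.
Proof. exact: sumr_ge0. Qed.

Lemma miss_mass_le_law S n z : miss_mass S n z <= p z.
Proof.
rewrite -(sum_law hp z n) [leRHS](bigID (fun y => miss S (z ++ y))) /=.
by rewrite lerDl sumr_ge0.
Qed.

Lemma miss_massD S n m z :
  miss_mass S (n + m) z = \sum_(y <- words n) miss_mass S m (z ++ y).
Proof.
rewrite /miss_mass big_mkcond sum_words_cat; apply: eq_bigr => y _.
rewrite [RHS]big_mkcond; apply: eq_bigr => x _.
by rewrite -catA.
Qed.

Lemma miss_massDl S n m z :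
  miss_mass S (n + m) z <= \sum_(y <- words n | miss S (z ++ y)) miss_mass S m (z ++ y).
Proof.
rewrite miss_massD [leRHS]big_mkcond; apply: ler_sum => y _.
case: ifPn => // h; rewrite /miss_mass big1 // => x hx.
by rewrite (miss_cat hx) in h.
Qed.

Lemma miss_mass_le S n m z : (n <= m)%N -> miss_mass S m z <= miss_mass S n z.
Proof.
move=> /subnKC <-; apply: le_trans (miss_massDl _ _ _ _) _.
by apply: ler_sum => y _; exact: miss_mass_le_law.
Qed.

Lemma miss_massS c S n z :
  miss_mass S n.+1 z = miss_mass S n (rcons z c) + miss_mass S n (rcons z (~~ c)).
Proof. by rewrite -add1n miss_massD (sum_wordsS c) !sum_words0 !cats1. Qed.

Hypothesis heavy_runs :
  forall B : R, exists n, B <= \sum_(s < n) start p b s * tail p b (K (s + s)).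

Let k s := K (s + s).
Let k_gt0 s : (0 < k s)%N. Proof. exact: K_gt0. Qed.
Let k_le : {homo k : s t / (s <= t)%N}.
Proof. by move=> s t st; apply: K_le; apply: leq_add. Qed.
Let rate := @hit_rate R D.

(** Asymptotically, the sequences without long run make up at most the fraction
    [1 - rate] of the cylinder. *)
Definition reduced S z := forall e : R, 0 < e ->
  exists n, miss_mass S n z <= (1 - rate) * p z + e.

(** At time [size g + s] a run of length [K (size g + s)] is required, which is at
    most [K (s + s)] as soon as [size g <= s]. *)
Lemma reduced_base S g : last b g = b -> reduced S (rcons g (~~ b)).
Proof.
move=> gb e e0.
have D1 := law_cst hp.
have pot B : exists n, B <= potential p b k n.
  have [n hn] := heavy_runs (1 + (D + 1) * B); exists n.
  have := le_trans hn (sum_start_potential hp b k_le n).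
  by rewrite lerD2l ler_pM2l // ltr_wpDl // (le_trans ler01).
pose s0 := maxn 1 (maxn (size g) S).
have s0P : [/\ (0 < s0)%N, (size g <= s0)%N & (S <= s0)%N].
  by rewrite /s0; split; lia.
case: s0P => s00 gs0 Ss0.
have [n hn] := hit_after_base hp k_gt0 k_le gb s00 pot.
set H := (n + k n)%N in hn; have H0 : (0 < H)%N by have := k_gt0 n; rewrite /H; lia.
exists H.-1; apply: le_trans (_ : (1 - rate) * p (rcons g (~~ b)) <= _); last first.
  by rewrite lerDl ltW.
apply: le_trans (hn H (leqnn _)); rewrite /miss_mass -{2}(prednK H0).
rewrite [leRHS]big_mkcond (sum_wordsS b) /= -[leLHS]add0r; apply: lerD.
  by apply: sumr_ge0 => y _; case: ifP.
rewrite big_mkcond; apply: ler_sum => y _; rewrite eqxx /= cat_rcons.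
case: ifPn => [hy|_]; last by case: ifP.
case: ifPn => // /negPn/existsP[s /andP[ss hs]].
move: hs; rewrite -(runs_at_shift _ _ _ gb) => hs.
have /missP/(_ (size g + s)%N) := hy.
rewrite (leq_trans Ss0) ?(leq_trans ss) ?leq_addl // => /(_ isT).
rewrite (runs_at_le _ hs) //; apply: K_le; rewrite leq_add2r.
exact: leq_trans ss.
Qed.

Let rate0 : 0 < rate. Proof. exact: (hit_rate_gt0 hp). Qed.
Let rate1 : rate <= 1. Proof. exact: (hit_rate_le1 hp). Qed.

(** The run in progress almost surely ends. *)
Lemma reduced_run S c z : (forall j, reduced S (rcons (z ++ nseq j c) (~~ c))) ->
  reduced S z.
Proof.
move=> hz e e0; have e2 : 0 < e / 2 by rewrite divr_gt0.
suff H i : exists n, miss_mass S n z <= (1 - rate) * p z + p (z ++ nseq i c) + e / 2.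
  have [j hj] := law_small hp c e2; have [n hn] := H j; exists n.
  have : p (z ++ nseq j c) <= e / 2 by apply: le_trans hj; exact: law_suffix hp _ _.
  by lra.
move: (e / 2) e2 => {e0} {}e e0.
elim: i z hz e e0 => [|i IH] z hz e e0.
  exists 0%N; rewrite cats0; apply: le_trans (miss_mass_le_law _ _ _) _.
  have : 0 <= (1 - rate) * p z by rewrite mulr_ge0 // subr_ge0.
  by lra.
have e2 : 0 < e / 2 by rewrite divr_gt0.
have [|n0 h0] := IH (rcons z c) _ _ e2.
  by move=> j; rewrite cat_rcons; exact: (hz j.+1).
have [n1] := hz 0%N _ e2; rewrite cats0 => h1.
exists (maxn n0 n1).+1; rewrite (miss_massS c) (law_splitb hp c z).
have := le_trans (miss_mass_le S (rcons z c) (leq_maxl n0 n1)) h0.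
have := le_trans (miss_mass_le S (rcons z (~~ c)) (leq_maxr n0 n1)) h1.
by rewrite cat_rcons /=; lra.
Qed.

Lemma reduced_all S z : reduced S z.
Proof.
apply: (@reduced_run _ (~~ b)) => j; apply: (@reduced_run _ b) => i.
by apply: reduced_base; rewrite last_cat last_rcons negbK; elim: (i).
Qed.

Lemma reduced_uniform S (l : seq (seq bool)) (e : R) : 0 < e ->
  exists n, forall z, z \in l -> miss_mass S n z <= (1 - rate) * p z + e.
Proof.
move=> e0; elim: l => [|z l [n hn]]; first by exists 0%N.
have [m hm] := reduced_all S z e0; exists (maxn n m) => y.
rewrite inE => /orP[/eqP ->|yl].
  exact: le_trans (miss_mass_le _ _ (leq_maxr _ _)) hm.
exact: le_trans (miss_mass_le _ _ (leq_maxl _ _)) (hn y yl).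
Qed.

(** The words of length [n] without long run nearly have the limit mass [a]; each of
    their cylinders later loses the proportion [rate], so [a <= (1 - rate) * a]. *)
Theorem miss_mass_small S (e : R) : 0 < e -> exists n, miss_mass S n [::] <= e.
Proof.
move=> e0; set A := range (fun n => miss_mass S n [::]).
have hA : has_inf A.
  split; first by exists (miss_mass S 0 [::]), 0%N.
  by exists 0 => _ [n _ <-]; exact: miss_mass_ge0.
pose a := inf A.
have aP n : a <= miss_mass S n [::] by apply: ge_inf; [exact: hA.2 | exists n].
suff a0 : a <= 0.
  have [_ [n _ <-] hn] := inf_adherent e0 hA; exists n.
  by rewrite ltW // (lt_le_trans hn) // gerDr.
rewrite leNgt; apply/negP => a0.
pose d := rate * a / 4; have d0 : 0 < d by rewrite divr_gt0 // mulr_gt0.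
have [_ [n _ <-] hn] := inf_adherent d0 hA; rewrite -/a in hn.
pose c : R := (size (words n)).+1%:R.
have [m hm] := reduced_uniform S (words n) (divr_gt0 d0 (ltr0Sn R (size (words n)))).
have : a <= (1 - rate) * miss_mass S n [::] + d.
  apply: le_trans (aP (n + m)%N) _; apply: le_trans (miss_massDl _ _ _ _) _.
  apply: le_trans (_ : \sum_(y <- words n | miss S y) ((1 - rate) * p y + d / c) <= _).
    rewrite big_seq_cond [leRHS]big_seq_cond; apply: ler_sum => y /andP[yn _].
    exact: hm.
  rewrite big_split /= -mulr_sumr lerD2l.
  apply: le_trans (_ : \sum_(y <- words n) d / c <= _).
    rewrite [leLHS]big_mkcond; apply: ler_sum => y _; case: ifP => // _.
    by rewrite divr_ge0 // ltW.
  rewrite big_const_seq count_predT iter_addr addr0 -[leLHS]mulr_natr mulrAC.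
  by rewrite ler_pdivrMr ?ltr0Sn // ler_pM2l // ler_nat.
have : (1 - rate) * miss_mass S n [::] <= (1 - rate) * (a + d).
  by apply: ler_wpM2l; [rewrite subr_ge0 | exact: ltW].
have dE : rate * a = 4 * d by rewrite /d; field.
have : 0 <= rate * d by rewrite mulr_ge0 // ltW.
by rewrite !mulrBl !mul1r !mulrDr dE; lra.
Qed.

End InfinitelyManyLongRuns.

(** * Expected frequency of a letter *)

Section VisitFrequency.
Context {R : realType} (p : seq bool -> R) (D : R) (hp : run_law p D).
Implicit Types (b : bool) (n i t : nat) (w z : seq bool).

Let p0 w : 0 <= p w. Proof. exact: law_ge0 hp w. Qed.
Let D1 : 1 <= D. Proof. exact: law_cst hp. Qed.
Let D0 : 0 < D. Proof. exact: lt_le_trans ltr01 D1. Qed.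

Definition tail_sum b n := \sum_(j < n) tail p b j.+1.

Lemma tail_sum_ge0 b n : 0 <= tail_sum b n.
Proof. by apply: sumr_ge0 => j _; exact: p0. Qed.

Lemma tail_sum_le b n : tail_sum b n <= n%:R.
Proof.
rewrite /tail_sum -[n in leRHS]card_ord -sumr_const.
by apply: ler_sum => j _; exact: (law_le1 hp).
Qed.

(** Up to constants, the time spent in [b] is the number of runs times
    [tail_sum b n], and the total time [n + n] is at least the number of runs
    times [tail_sum (~~ b) n]; both letters have the same number of runs up to
    one. *)
Lemma visits_tail_sum b n :
  (\sum_(t < n) visit p b t.+1) * tail_sum (~~ b) n <=
  D * (2 * D + 1) * n%:R * tail_sum b n.
Proof.
set m0 := tail_sum b n; set m1 := tail_sum (~~ b) n.
have m00 : 0 <= m0 by exact: tail_sum_ge0.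
have m10 : 0 <= m1 by exact: tail_sum_ge0.
have := sum_visit_ub hp b n; rewrite -/m0.
have := sum_visit_lb hp (~~ b) n; rewrite -/m1.
have := sum_start_le hp b n.
set U0 := \sum_(s < n) start p b s; set U1 := \sum_(s < n) start p (~~ b) s.
set E := \sum_(t < n) visit p b t.+1 => U01 lb ub.
have h1 : U1 * m1 <= D * (n + n)%:R.
  apply: le_trans lb _; rewrite ler_pM2l // -[(n + n)%N in leRHS]card_ord -sumr_const.
  by apply: ler_sum => t _; exact: (visit_le1 hp).
have h2 : U0 * m1 <= (2 * D + 1) * n%:R.
  apply: le_trans (ler_wpM2r m10 U01) _; rewrite mulrDl mul1r.
  rewrite natrD in h1; have hm : m1 <= n%:R := tail_sum_le _ _.
  by rewrite [leRHS]mulrDl mul1r; lra.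
apply: le_trans (ler_wpM2r m10 ub) _.
have -> : D * U0 * m0 * m1 = D * m0 * (U0 * m1) by ring.
have -> : D * (2 * D + 1) * n%:R * m0 = D * m0 * ((2 * D + 1) * n%:R) by ring.
by apply: ler_wpM2l => //; rewrite mulr_ge0 // ltW.
Qed.

Lemma tail_sum_double b n : tail_sum b (n + n) <= tail_sum b n + n%:R * tail p b n.
Proof.
have -> : n%:R * tail p b n = \sum_(j < n) tail p b n.
  by rewrite sumr_const card_ord mulr_natl.
rewrite /tail_sum big_split_ord lerD2l.
by apply: ler_sum => j _; apply: (tail_le hp); rewrite /= -addnS leq_addr.
Qed.

Lemma tail_sum_dyadic_le b (C a : R) : 0 <= C -> 2^-1 < a ->
    (forall l, tail p b (2 ^ l) <= C * a ^+ l) ->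
  exists C', 0 <= C' /\ forall i, tail_sum b (2 ^ i) <= C' * (2 * a) ^+ i.
Proof.
move=> C0 a2 hC.
have a1 : 0 < 2 * a - 1 by rewrite subr_gt0 -ltr_pdivrMl // mulr1.
pose C' := 1 + C / (2 * a - 1).
have C'0 : 0 <= C' by rewrite addr_ge0 // divr_ge0 // ltW.
exists C'; split => //; elim=> [|i IH].
  rewrite expn0 expr0 mulr1; apply: le_trans (tail_sum_le _ _) _.
  by rewrite lerDl divr_ge0 // ltW.
rewrite expnS mul2n -addnn; apply: le_trans (tail_sum_double _ _) _.
apply: le_trans (_ : C' * (2 * a) ^+ i + C * (2 * a) ^+ i <= _).
  apply: lerD => //; rewrite exprMn mulrCA natrX.
  by apply: ler_wpM2l => //; rewrite exprn_ge0.
have -> : C' * (2 * a) ^+ i.+1 = C' * (2 * a) * (2 * a) ^+ i by rewrite exprS mulrA.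
rewrite -mulrDl; apply: ler_wpM2r.
  by rewrite exprn_ge0 // mulr_ge0 // ltW // (lt_trans _ a2).
have -> : C' * (2 * a) = C' + (2 * a - 1) + C.
  by rewrite /C'; field; rewrite lt0r_neq0.
by rewrite lerD2r lerDl ltW.
Qed.

Lemma visits_dyadic b (C0 C1 a0 a1 : R) :
    0 <= C0 -> 0 < C1 -> 2^-1 < a0 -> a0 < a1 ->
    (forall l, tail p b (2 ^ l) <= C0 * a0 ^+ l) ->
    (forall l, C1 * a1 ^+ l <= tail p (~~ b) (2 ^ l)) ->
  exists C, 0 <= C /\ forall i,
    \sum_(t < 2 ^ i) visit p b t.+1 <= C * (2 ^ i)%:R * (a0 / a1) ^+ i.
Proof.
move=> C00 C10 ha0 a01 h0 h1.
have [C' [C'0 hC']] := tail_sum_dyadic_le C00 ha0 h0.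
have a00 : 0 < a0 by apply: lt_trans ha0; rewrite invr_gt0.
have a10 : 0 < a1 by apply: lt_trans a01.
exists (D * (2 * D + 1) * C' / C1); split.
  rewrite divr_ge0 ?(ltW C10) //; apply: mulr_ge0 => //; apply: mulr_ge0.
    exact: ltW.
  by rewrite addr_ge0 // mulr_ge0 // ltW.
move=> i; set E := \sum_(t < _) _.
have Ege : 0 <= E by apply: sumr_ge0 => t _; exact: (visit_ge0 hp).
have m1 : C1 * (2 * a1) ^+ i <= tail_sum (~~ b) (2 ^ i).
  apply: le_trans (_ : (2 ^ i)%:R * tail p (~~ b) (2 ^ i) <= _).
    by rewrite exprMn mulrCA natrX ler_wpM2l // exprn_ge0.
  rewrite mulr_natl -[(2 ^ i)%N in X in _ *+ X]card_ord -sumr_const.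
  by apply: ler_sum => j _; apply: (tail_le hp).
have P1 : 0 < C1 * (2 * a1) ^+ i by rewrite mulr_gt0 // exprn_gt0 // mulr_gt0.
rewrite -(ler_pM2r P1); apply: le_trans (ler_wpM2l Ege m1) _.
apply: le_trans (visits_tail_sum b (2 ^ i)) _.
have -> : D * (2 * D + 1) * C' / C1 * (2 ^ i)%:R * (a0 / a1) ^+ i *
    (C1 * (2 * a1) ^+ i) = D * (2 * D + 1) * (2 ^ i)%:R * (C' * (2 * a0) ^+ i).
  rewrite !exprMn exprVn; field.
  by rewrite !lt0r_neq0 // exprn_gt0.
apply: ler_wpM2l => //; apply: mulr_ge0 => //.
by rewrite mulr_ge0 ?addr_ge0 ?mulr_ge0 // ltW.
Qed.

Lemma sum_count b n :
  \sum_(z <- words n) p z * (count_mem b z)%:R = \sum_(t < n) visit p b t.+1.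
Proof.
elim: n => [|n IH]; first by rewrite sum_words0 big_ord0 mulr0.
have vE : visit p b n.+1 = \sum_(z <- words n) p (rcons z b).
  rewrite /visit big_mkcond (sum_words_rcons b) -big_split.
  by apply: eq_bigr => z _; rewrite /= !last_rcons eqxx eqNbb addr0.
rewrite (sum_words_rcons b) big_ord_recr -IH /= vE -!big_split.
apply: eq_bigr => z _ /=.
rewrite -!cats1 !count_cat /= eqxx eqNbb /= !addn0 natrD !cats1.
by rewrite [p z](law_splitb hp b); ring.
Qed.

Lemma count_mass_le b n (e : R) : 0 < e ->
  e * \sum_(z <- words n | e <= (count_mem b z)%:R) p z <=
  \sum_(t < n) visit p b t.+1.
Proof.
move=> e0; rewrite -sum_count mulr_sumr big_mkcond; apply: ler_sum => z _.
by case: ifP => [h|_]; [rewrite mulrC ler_wpM2l | rewrite mulr_ge0].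
Qed.

End VisitFrequency.

(** * Cylinder lengths of a map with two expanding branches *)

Definition width (R : realType) (c : R) (b : bool) : R := if b then 1 - c else c.

(** Inverse branches [g b] of a full two-branch map, seen through the derivative
    [d b] of the branch and through its displacement [gap b] at distance [z]
    from its fixed point. *)
Record inverse_branches (R : realType) (c : R) (g d gap : bool -> R -> R)
    (K rho : R) : Prop := InverseBranches {
  ib_c : 0 < c < 1;
  ib_00 : g false 0 = 0;
  ib_01 : g false 1 = c;
  ib_10 : g true 0 = c;
  ib_11 : g true 1 = 1;
  ib_K : 0 <= K;
  ib_rho : 0 <= rho < 1;
  ib_mvt : forall b x y, 0 <= x -> x < y -> y <= 1 ->
    exists xi, [/\ g b x < xi, xi < g b y & y - x = d b xi * (g b y - g b x)];
  ib_d : forall b x, g b 0 <= x <= g b 1 -> 1 <= d b x;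
  ib_lip : forall b x y, g b 0 <= x <= g b 1 -> g b 0 <= y <= g b 1 ->
    d b x <= d b y + K * `|x - y|;
  ib_contr : forall b x y, g (~~ b) 0 <= x -> x < y -> y <= g (~~ b) 1 ->
    g b y - g b x <= rho * (y - x);
  ib_gap0 : forall u, 0 <= u <= 1 -> g false u + gap false (g false u) = u;
  ib_gap1 : forall u, 0 <= u <= 1 ->
    1 - g true u + gap true (1 - g true u) = 1 - u;
  ib_gap_gt0 : forall b z, 0 < z <= width c b -> 0 < gap b z;
  ib_gap_le : forall b z z', 0 <= z -> z <= z' -> z' <= width c b ->
    gap b z <= gap b z';
  ib_gap_sqr : forall b z, 0 <= z <= width c b -> gap b z <= K * z ^+ 2 }.

Section Cylinders.
Context {R : realType} (c : R) (g d gap : bool -> R -> R) (K rho : R)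
  (hg : inverse_branches c g d gap K rho).
Implicit Types (b : bool) (u w : seq bool) (x y : R).

Definition ibranch w x := foldr g x w.

Definition cyl_length w := ibranch w 1 - ibranch w 0.

Let c01 : 0 < c < 1. Proof. exact: ib_c hg. Qed.
Let K0 : 0 <= K. Proof. exact: ib_K hg. Qed.

Lemma ibranch_cat u w x : ibranch (u ++ w) x = ibranch u (ibranch w x).
Proof. by rewrite /ibranch foldr_cat. Qed.

Lemma ibranch_rcons w b x : ibranch (rcons w b) x = ibranch w (g b x).
Proof. by rewrite -cats1 ibranch_cat. Qed.

Lemma g_lt b x y : 0 <= x -> x < y -> y <= 1 -> g b x < g b y.
Proof.
by move=> x0 xy y1; have [xi [h1 h2 _]] := ib_mvt hg b x0 xy y1; exact: lt_trans h2.
Qed.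

Lemma g_le b x y : 0 <= x -> x <= y -> y <= 1 -> g b x <= g b y.
Proof.
by move=> x0; rewrite le_eqVlt => /orP[/eqP -> //|xy y1]; exact/ltW/g_lt.
Qed.

Lemma g_end b : [/\ 0 <= g b 0, g b 0 < g b 1 & g b 1 <= 1].
Proof.
have /andP[c0 c1] := c01; case: b.
  by rewrite (ib_10 hg) (ib_11 hg); split => //; exact: ltW.
by rewrite (ib_00 hg) (ib_01 hg); split => //; exact: ltW.
Qed.

Lemma g_width b : g b 1 - g b 0 = width c b.
Proof.
by case: b; rewrite /width ?(ib_10 hg) ?(ib_11 hg) ?(ib_00 hg) ?(ib_01 hg) ?subr0.
Qed.

Lemma g_itv b x : 0 <= x <= 1 -> g b 0 <= g b x <= g b 1.
Proof. by move=> /andP[x0 x1]; rewrite !g_le. Qed.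

Lemma g_unit b x : 0 <= x <= 1 -> 0 <= g b x <= 1.
Proof.
move=> /(g_itv b)/andP[h1 h2]; have [h3 _ h4] := g_end b.
by rewrite (le_trans h3 h1) (le_trans h2 h4).
Qed.

Lemma g_nonexpanding b x y : 0 <= x -> x <= y -> y <= 1 -> g b y - g b x <= y - x.
Proof.
move=> x0; rewrite le_eqVlt => /orP[/eqP -> //|xy y1]; first by rewrite !subrr.
have [xi [h1 h2 ->]] := ib_mvt hg b x0 xy y1.
have gg := g_lt b x0 xy y1.
have hx : 0 <= x <= 1 by rewrite x0 ltW // (lt_le_trans xy).
have hy : 0 <= y <= 1 by rewrite y1 (le_trans x0) // ltW.
have /andP[a1 _] := g_itv b hx; have /andP[_ a2] := g_itv b hy.
rewrite ler_peMl ?subr_ge0 ?(ltW gg) //; apply: (ib_d hg).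
by rewrite (le_trans a1) ?(le_trans _ a2) ?ltW.
Qed.

Lemma ibranch_unit w x : 0 <= x <= 1 -> 0 <= ibranch w x <= 1.
Proof. by move=> hx; elim: w => //= b w; exact: g_unit. Qed.

Lemma ibranch0 w : 0 <= ibranch w 0 <= 1.
Proof. by apply: ibranch_unit; rewrite lexx ler01. Qed.

Lemma ibranch1 w : 0 <= ibranch w 1 <= 1.
Proof. by apply: ibranch_unit; rewrite lexx ler01. Qed.

Lemma ibranch_lt w x y : 0 <= x -> x < y -> y <= 1 -> ibranch w x < ibranch w y.
Proof.
move=> x0 xy y1; elim: w => //= b w IH; apply: g_lt => //.
  by apply: (andP (ibranch_unit w _)).1; rewrite x0 ltW // (lt_le_trans xy).
by apply: (andP (ibranch_unit w _)).2; rewrite y1 (le_trans x0) // ltW.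
Qed.

Lemma ibranch_le w x y : 0 <= x -> x <= y -> y <= 1 -> ibranch w x <= ibranch w y.
Proof.
by move=> x0; rewrite le_eqVlt => /orP[/eqP -> //|xy y1]; exact/ltW/ibranch_lt.
Qed.

Lemma ibranch_nonexpanding w x y : 0 <= x -> x <= y -> y <= 1 ->
  ibranch w y - ibranch w x <= y - x.
Proof.
move=> x0 xy y1; elim: w => //= b w; apply: le_trans; apply: g_nonexpanding.
- by apply: (andP (ibranch_unit w _)).1; rewrite x0 (le_trans xy).
- exact: ibranch_le.
- by apply: (andP (ibranch_unit w _)).2; rewrite y1 (le_trans x0).
Qed.

(** Total length of the successive images of an interval under the inverse
    branches of the letters of [w], last letter first. *)
Fixpoint suffix_lengths w x y : R :=
  if w is b :: w' then
    (ibranch w y - ibranch w x) + suffix_lengths w' x y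
  else 0.

Lemma suffix_lengths_cat u w x y : suffix_lengths (u ++ w) x y =
  suffix_lengths u (ibranch w x) (ibranch w y) + suffix_lengths w x y.
Proof.
elim: u => [|b u IH] /=; first by rewrite add0r.
by rewrite IH !ibranch_cat addrA.
Qed.

(** The mean value points of two intervals at the same stage lie in a common
    image, so the Lipschitz bound on the derivative compares their expansion. *)
Lemma distortion w l h x y x' y' : 0 <= l -> h <= 1 ->
    l <= x -> x < y -> y <= h -> l <= x' -> x' < y' -> y' <= h ->
  (ibranch w y - ibranch w x) * (y' - x') <=
  expR (K * suffix_lengths w l h) * (ibranch w y' - ibranch w x') * (y - x).
Proof.
move=> l0 h1 lx xy yh lx' xy' yh'.
elim: w => [|b w IH]; first by rewrite /= mulr0 expR0 mul1r mulrC.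
have L z : l <= z -> z <= h -> [/\ 0 <= ibranch w z, ibranch w z <= 1,
    ibranch (b :: w) l <= ibranch (b :: w) z &
    ibranch (b :: w) z <= ibranch (b :: w) h].
  move=> lz zh; have z01 : 0 <= z <= 1 by rewrite (le_trans l0) ?(le_trans zh).
  have /andP[-> ->] := ibranch_unit w z01; split => //.
    by apply: ibranch_le => //; exact: le_trans zh h1.
  by apply: ibranch_le => //; exact: le_trans l0 lz.
have [X0 X1 Xl Xh] := L x lx (le_trans (ltW xy) yh).
have [Y0 Y1 Yl Yh] := L y (le_trans lx (ltW xy)) yh.
have [X0' X1' Xl' Xh'] := L x' lx' (le_trans (ltW xy') yh').
have [Y0' Y1' Yl' Yh'] := L y' (le_trans lx' (ltW xy')) yh'.
have XY : ibranch w x < ibranch w y.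
  by apply: ibranch_lt; rewrite ?(le_trans l0 lx) ?(le_trans yh h1).
have XY' : ibranch w x' < ibranch w y'.
  by apply: ibranch_lt; rewrite ?(le_trans l0 lx') ?(le_trans yh' h1).
have [xi [a1 a2 a3]] := ib_mvt hg b X0 XY Y1.
have [xi' [a1' a2' a3']] := ib_mvt hg b X0' XY' Y1'.
rewrite a3 a3' in IH.
rewrite /= -/(ibranch w _) in Xl Xh Yl Yh Xl' Xh' Yl' Yh' a1 a2 a1' a2' *.
set G := g b (ibranch w y) - g b (ibranch w x) in IH *.
set G' := g b (ibranch w y') - g b (ibranch w x') in IH *.
have G0 : 0 < G by rewrite subr_gt0 g_lt.
have G0' : 0 < G' by rewrite subr_gt0 g_lt.
set delta := g b (ibranch w h) - g b (ibranch w l).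
have in_b z z1 z2 : 0 <= z1 -> z2 <= 1 -> g b z1 < z -> z < g b z2 ->
    0 <= z2 -> z1 <= 1 -> g b 0 <= z <= g b 1.
  move=> ? ? zz1 zz2 ? ?; apply/andP; split.
    by apply: le_trans (ltW zz1); exact: g_le.
  by apply: le_trans (ltW zz2) _; exact: g_le.
have i1 := in_b _ _ _ X0 Y1 a1 a2 Y0 X1.
have i2 := in_b _ _ _ X0' Y1' a1' a2' Y0' X1'.
have d1 := ib_d hg i1.
have dd : d b xi' <= d b xi * expR (K * delta).
  apply: le_trans (ib_lip hg i2 i1) _.
  have Kd : K * `|xi' - xi| <= K * delta.
    apply: ler_wpM2l => //; rewrite ler_norml /delta; lra.
  apply: le_trans (_ : d b xi * (1 + K * delta) <= _); last first.
    by rewrite ler_wpM2l ?expR_ge1Dx // (le_trans ler01).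
  have Kd0 : 0 <= K * delta by apply: le_trans Kd; rewrite mulr_ge0.
  by rewrite mulrDr mulr1 lerD2l; apply: (le_trans Kd); rewrite ler_peMl.
set E := expR _ in IH; rewrite -/delta [K * (_ + _)]mulrDr expRD -/E.
have E0 : 0 < E by exact: expR_gt0.
have d0 : 0 < d b xi by exact: lt_le_trans d1.
rewrite -(ler_pM2l d0) mulrA; apply: le_trans IH _.
have -> : E * (d b xi' * G') * (y - x) = d b xi' * (E * G' * (y - x)) by ring.
have -> : d b xi * (expR (K * delta) * E * G' * (y - x)) =
  d b xi * expR (K * delta) * (E * G' * (y - x)) by ring.
apply: ler_wpM2r => //.
by rewrite mulr_ge0 ?subr_ge0 ?(ltW xy) // mulr_ge0 // ltW.
Qed.

(** The images of one side under the powers of the other branch are adjacent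
    intervals. *)
Lemma suffix_lengths_nseq m b :
  suffix_lengths (nseq m b) (g (~~ b) 0) (g (~~ b) 1) <= 1.
Proof.
have E i : ibranch (nseq i b) (g (~~ b) 1) - ibranch (nseq i b) (g (~~ b) 0) =
    cyl_length (nseq i b) - cyl_length (nseq i.+1 b).
  rewrite /cyl_length -rcons_nseq !ibranch_rcons.
  by case: b; rewrite ?(ib_00 hg) ?(ib_01 hg) ?(ib_10 hg) ?(ib_11 hg); ring.
have len0 w : 0 <= cyl_length w by rewrite subr_ge0 ibranch_le.
have len1 w : cyl_length w <= 1.
  by have := ibranch_nonexpanding w (lexx 0) ler01 (lexx 1); rewrite subr0.
suff : suffix_lengths (nseq m b) (g (~~ b) 0) (g (~~ b) 1) =
    cyl_length (nseq 1 b) - cyl_length (nseq m.+1 b).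
  by move=> ->; have := len0 (nseq m.+1 b); have := len1 (nseq 1 b); lra.
elim: m => [|m IH]; first by rewrite subrr.
by rewrite [LHS]/= IH (E m.+1); ring.
Qed.

Definition min_width := Num.min c (1 - c).

Lemma min_width_gt0 : 0 < min_width.
Proof. by have /andP[c0 c1] := c01; rewrite lt_min c0 subr_gt0. Qed.

Lemma min_width_le b : min_width <= g b 1 - g b 0.
Proof. by rewrite g_width ge_min; case: b; rewrite lexx ?orbT. Qed.

(** By the bound on the whole side, the branch has bounded distortion along the
    run; so a subinterval keeps its proportion of each image. *)
Lemma suffix_lengths_run m b x y :
    g (~~ b) 0 <= x -> x < y -> y <= g (~~ b) 1 ->
  suffix_lengths (nseq m b) x y <= expR K / min_width * (y - x).
Proof.
move=> lx xy yh; have [e0 e01 e1] := g_end (~~ b).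
have mw0 := min_width_gt0; have mw := min_width_le (~~ b).
set l := g (~~ b) 0 in lx e0 e01 mw *; set h := g (~~ b) 1 in yh e1 e01 mw *.
have yx : 0 < y - x by rewrite subr_gt0.
suff : suffix_lengths (nseq m b) x y * (h - l) <=
    expR K * suffix_lengths (nseq m b) l h * (y - x).
  have := suffix_lengths_nseq m b; rewrite -/l -/h => s1 s2.
  have s0 : 0 <= suffix_lengths (nseq m b) x y.
    elim: m {s1 s2} => //= m IH; rewrite addr_ge0 // subr_ge0.
    apply: (@ibranch_le (b :: nseq m b)); last exact: le_trans e1.
      exact: le_trans lx.
    exact: ltW.
  rewrite mulrAC ler_pdivlMr //; apply: le_trans (ler_wpM2l s0 mw) _.
  apply: le_trans s2 _; rewrite ler_wpM2r ?(ltW yx) //.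
  by rewrite -[leRHS]mulr1 ler_wpM2l // expR_ge0.
elim: m => [|m IH]; first by rewrite !(mul0r, mulr0).
have dist : (ibranch (nseq m.+1 b) y - ibranch (nseq m.+1 b) x) * (h - l) <=
    expR K * (ibranch (nseq m.+1 b) h - ibranch (nseq m.+1 b) l) * (y - x).
  have := @distortion (nseq m.+1 b) l h x y l h e0 e1 lx xy yh (lexx _) e01 (lexx _).
  move=> /le_trans; apply; apply: ler_wpM2r; first exact: ltW.
  apply: ler_wpM2r; first by rewrite subr_ge0 ibranch_le // ltW.
  by rewrite ler_expR -[leRHS]mulr1 ler_wpM2l // suffix_lengths_nseq.
apply: le_trans (_ : (ibranch (nseq m.+1 b) y - ibranch (nseq m.+1 b) x) * (h - l)
  + suffix_lengths (nseq m b) x y * (h - l) <= _); first by rewrite -mulrDl.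
apply: le_trans (lerD dist IH) _.
by rewrite -mulrDl -mulrDr.
Qed.

Lemma last_run b w :
  exists m w', w = w' ++ nseq m b /\ last (~~ b) w' = ~~ b.
Proof.
elim/last_ind: w => [|w a [m [w' [-> hw]]]]; first by exists 0%N, [::].
have [->|ab] := eqVneq a b.
  by exists m.+1, w'; rewrite -cats1 -catA cats1 rcons_nseq.
exists 0%N, (rcons (w' ++ nseq m b) a); rewrite cats0 last_rcons; split => //.
by move: ab; case: a; case: (b).
Qed.

Definition suffix_cst := expR K / min_width / (1 - rho).

(** Every passage from a run to the previous one contracts by [rho], so the runs
    contribute a geometric series. *)
Lemma suffix_lengths_le w b x y : last (~~ b) w = ~~ b ->
    g b 0 <= x -> x < y -> y <= g b 1 ->
  suffix_lengths w x y <= suffix_cst * (y - x).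
Proof.
have /andP[r0 r1] := ib_rho hg; have mw0 := min_width_gt0.
have cst0 : 0 <= suffix_cst.
  by rewrite !divr_ge0 ?expR_ge0 ?subr_ge0 // ltW.
have cstE : expR K / min_width + suffix_cst * rho = suffix_cst.
  rewrite /suffix_cst; field; rewrite !lt0r_neq0 // ?subr_gt0 //.
have [n] := ubnP (size w); elim: n w b x y => // n IH w b x y sw hw lx xy yh.
have yx : 0 <= y - x by rewrite subr_ge0 ltW.
have [m [w' [wE hw']]] := last_run (~~ b) w; rewrite negbK in hw'.
case: m wE => [|m] wE.
  case: w wE sw hw hw' => [|a w] wE sw hw hw'; first by rewrite mulr_ge0.
  rewrite cats0 in wE; rewrite -wE in hw'.
  by move: hw; rewrite -[LHS]/(last b (a :: w)) hw'; case: (b).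
have [e0 e01 e1] := g_end b.
have x0 := le_trans e0 lx; have y1 := le_trans yh e1.
set z := nseq m.+1 (~~ b) in wE.
rewrite wE suffix_lengths_cat.
have zlt : ibranch z x < ibranch z y by exact: ibranch_lt.
have x01 : 0 <= x <= 1 by rewrite x0 ltW // (lt_le_trans xy).
have y01 : 0 <= y <= 1 by rewrite y1 ltW // (le_lt_trans x0).
have IHz : suffix_lengths w' (ibranch z x) (ibranch z y) <=
    suffix_cst * (ibranch z y - ibranch z x).
  apply: (IH _ (~~ b)); rewrite ?negbK //.
  - by move: sw; rewrite wE size_cat size_nseq ltnS addnS; apply: leq_ltn_trans; exact: leq_addr.
  - by rewrite /z /=; have /andP[] := g_itv (~~ b) (ibranch_unit (nseq m (~~ b)) x01).
  - by rewrite /z /=; have /andP[] := g_itv (~~ b) (ibranch_unit (nseq m (~~ b)) y01).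
have zrho : ibranch z y - ibranch z x <= rho * (y - x).
  rewrite /z -rcons_nseq !ibranch_rcons; apply: le_trans (_ : g (~~ b) y - g (~~ b) x <= _).
    apply: ibranch_nonexpanding.
    - by have /andP[] := g_unit (~~ b) x01.
    - by apply: g_le => //; exact: ltW.
    - by have /andP[] := g_unit (~~ b) y01.
  by apply: (ib_contr hg); rewrite ?negbK.
have run : suffix_lengths z x y <= expR K / min_width * (y - x).
  by apply: suffix_lengths_run; rewrite ?negbK.
have := ler_wpM2l cst0 zrho.
have -> : suffix_cst * (rho * (y - x)) = suffix_cst * rho * (y - x) by rewrite mulrA.
have -> : suffix_cst * (y - x) =
    expR K / min_width * (y - x) + suffix_cst * rho * (y - x).
  by rewrite -{1}cstE mulrDl.
by lra.
Qed.

Definition law_constant := expR (K * suffix_cst) / min_width.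

Lemma cyl_length_ge0 w : 0 <= cyl_length w.
Proof. by rewrite subr_ge0 ibranch_le. Qed.

(** The sum of lengths that controls the distortion of the branch of [w] on the
    side of [b] is bounded independently of [w]. *)
Lemma quasi_bernoulli w b u : last (~~ b) w = ~~ b ->
  cyl_length (w ++ b :: u) <= law_constant * cyl_length (rcons w b) * cyl_length (b :: u)
  /\
  cyl_length (rcons w b) * cyl_length (b :: u) <= law_constant * cyl_length (w ++ b :: u).
Proof.
move=> hw; have [e0 e01 e1] := g_end b.
have mw0 := min_width_gt0; have mw := min_width_le b.
rewrite /cyl_length !ibranch_cat !ibranch_rcons.
set l := g b 0 in e0 e01 mw *; set h := g b 1 in e1 e01 mw *.
have xy : ibranch (b :: u) 0 < ibranch (b :: u) 1 by exact: ibranch_lt.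
have lx : l <= ibranch (b :: u) 0.
  by have /andP[] := g_itv b (ibranch0 u).
have yh : ibranch (b :: u) 1 <= h.
  by have /andP[] := g_itv b (ibranch1 u).
set x := ibranch (b :: u) 0 in lx xy *; set y := ibranch (b :: u) 1 in yh xy *.
have sl : expR (K * suffix_lengths w l h) <= expR (K * suffix_cst).
  rewrite ler_expR ler_wpM2l //.
  apply: le_trans (suffix_lengths_le hw (lexx _) e01 (lexx _)) _.
  rewrite -[leRHS]mulr1 ler_wpM2l; first by [].
    rewrite !divr_ge0 ?expR_ge0 ?(ltW mw0) // subr_ge0 ltW //.
    by have /andP[] := ib_rho hg.
  by rewrite -/l -/h; lra.
have V : 0 <= ibranch w h - ibranch w l by rewrite subr_ge0 ibranch_le // ltW.
have y1 := le_trans yh e1; have x0 := le_trans e0 lx.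
have v : 0 <= ibranch w y - ibranch w x by rewrite subr_ge0 ibranch_le // ltW.
have yx : 0 <= y - x by rewrite subr_ge0 ltW.
have hl : h - l <= 1 by lra.
have := @distortion w l h x y l h e0 e1 lx xy yh (lexx _) e01 (lexx _).
have := @distortion w l h l h x y e0 e1 (lexx _) e01 (lexx _) lx xy yh.
set E := expR (K * suffix_lengths w l h) in sl *.
have E0 : 0 <= E by exact: expR_ge0.
move=> d2 d1; rewrite /law_constant; split.
  have -> : expR (K * suffix_cst) / min_width * (ibranch w h - ibranch w l) * (y - x) =
     expR (K * suffix_cst) * (ibranch w h - ibranch w l) * (y - x) / min_width by ring.
  rewrite ler_pdivlMr //; apply: le_trans (ler_wpM2l v mw) _; apply: le_trans d1 _.
  by apply: ler_wpM2r => //; apply: ler_wpM2r.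
rewrite mulrAC ler_pdivlMr //.
apply: le_trans (_ : (ibranch w h - ibranch w l) * (y - x) * 1 <= _).
  by apply: ler_wpM2l; [exact: mulr_ge0 | lra].
rewrite mulr1; apply: le_trans d2 _; rewrite -[leRHS]mulr1.
apply: ler_pM => //; first by rewrite mulr_ge0.
  by rewrite subr_ge0 ltW.
by apply: ler_wpM2r.
Qed.

Let t b n := cyl_length (nseq n b).

Lemma tail_gap b n : t b n = t b n.+1 + gap b (t b n.+1).
Proof.
have E0 m : ibranch (nseq m false) 0 = 0 by elim: m => //= m ->; exact: ib_00 hg.
have E1 m : ibranch (nseq m true) 1 = 1 by elim: m => //= m ->; exact: ib_11 hg.
rewrite /t /cyl_length; case: b.
  rewrite !E1 /=; apply/esym; apply: (ib_gap1 hg).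
  exact: ibranch0.
rewrite !E0 !subr0 /=; apply/esym; apply: (ib_gap0 hg).
exact: ibranch1.
Qed.

Lemma tail_gt0 b n : 0 < t b n.
Proof. by rewrite subr_gt0; exact: ibranch_lt. Qed.

Lemma tailS_width b n : t b n.+1 <= width c b.
Proof.
rewrite -g_width /t /cyl_length -rcons_nseq !ibranch_rcons.
have [? e01 ?] := g_end b.
by apply: ibranch_nonexpanding => //; exact: ltW.
Qed.

Lemma tail_antimono b i j : (i <= j)%N -> t b j <= t b i.
Proof.
move=> /subnKC <-; elim: (j - i)%N => [|k]; first by rewrite addn0.
apply: le_trans; rewrite addnS [leRHS]tail_gap lerDl ltW //.
by apply: (ib_gap_gt0 hg); rewrite tail_gt0 tailS_width.
Qed.

(** If the tails stayed above [e], each step would decrease them by [gap b e] at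
    least. *)
Lemma tail_small b (e : R) : 0 < e -> exists n, t b n <= e.
Proof.
move=> e0; apply: contrapT => /forallNP H.
have {}H n : e < t b n by rewrite ltNge; apply/negP.
have e1 : e <= width c b by apply: le_trans (tailS_width b 0); exact: ltW.
have ge0 : 0 < gap b e by apply: (ib_gap_gt0 hg); rewrite e0.
have dec n : t b n <= 1 - gap b e * n%:R.
  elim: n => [|n IH]; first by rewrite mulr0 subr0 /t /cyl_length /= subr0.
  have : gap b e <= gap b (t b n.+1).
    by apply: (ib_gap_le hg); rewrite ?tailS_width // ltW.
  by move: IH; rewrite (tail_gap b n) -natr1; lra.
have [n hn] : exists n, (gap b e)^-1 <= n%:R.
  by exists (Num.bound (gap b e)^-1); rewrite ltW // archi_boundP // invr_ge0 ltW.
have := dec n; have := tail_gt0 b n.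
have : 1 <= gap b e * n%:R by rewrite -ler_pdivrMl // mulr1.
by lra.
Qed.

(** The displacement is at most quadratic, so the inverse of the tail grows by at
    most [K] at each step. *)
Lemma tail_ge_harmonic b n : ((1 + K) * n.+1%:R)^-1 <= t b n.
Proof.
have t0 := tail_gt0 b.
have inc m : (t b m.+1)^-1 <= (t b m)^-1 + K.
  have ts := tail_gap b m; have := t0 m; have := t0 m.+1.
  have tm := tail_antimono b (leqnSn m).
  have hs : gap b (t b m.+1) <= K * t b m.+1 ^+ 2.
    by apply: (ib_gap_sqr hg); rewrite tailS_width ltW.
  set x := t b m.+1 in ts hs tm *; set y := t b m in ts tm * => x0 y0.
  have xy0 : 0 < x * y by rewrite mulr_gt0.
  rewrite -(ler_pM2r xy0).
  have -> : x^-1 * (x * y) = y by field; rewrite lt0r_neq0.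
  have -> : (y^-1 + K) * (x * y) = x + K * x * y by field; rewrite lt0r_neq0.
  rewrite {1}ts lerD2l; apply: le_trans hs _; rewrite expr2 mulrA.
  by rewrite ler_wpM2l // mulr_ge0 // ltW.
have H : (t b n)^-1 <= 1 + K * n%:R.
  elim: n => [|n IH]; first by rewrite mulr0 addr0 /t /cyl_length /= subr0 invr1.
  by apply: le_trans (inc n) _; rewrite -natr1; lra.
have P : 0 < (1 + K) * n.+1%:R by rewrite mulr_gt0 // ltr_wpDr.
rewrite invf_ple ?posrE //; apply: le_trans H _.
have n0 : 0 <= n%:R :> R by [].
rewrite -[n.+1]addn1 natrD mulrDl mul1r mulrDr mulr1; have := K0; lra.
Qed.

Theorem cyl_length_law : run_law cyl_length law_constant.
Proof.
split.
- by rewrite /cyl_length /= subr0.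
- exact: cyl_length_ge0.
- move=> w; rewrite /cyl_length !ibranch_rcons.
  by rewrite (ib_00 hg) (ib_01 hg) (ib_10 hg) (ib_11 hg); ring.
- move=> w u; rewrite /cyl_length !ibranch_cat; apply: ibranch_nonexpanding.
  + by have /andP[] := ibranch0 u.
  + exact: ibranch_le.
  + by have /andP[] := ibranch1 u.
- have mw0 := min_width_gt0; rewrite /law_constant ler_pdivlMr // mul1r.
  have [e0 e01 e1] := g_end true; have mw := min_width_le true.
  apply: le_trans (_ : 1 <= _); first by lra.
  apply: le_trans (expR_ge1Dx _); rewrite lerDl mulr_ge0 // !divr_ge0 ?expR_ge0 ?(ltW mw0) //.
  by rewrite subr_ge0 ltW //; have /andP[] := ib_rho hg.
- by move=> w b u /(quasi_bernoulli u)[].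
- by move=> w b u /(quasi_bernoulli u)[].
- exact: tail_small.
- move=> b B; have K1 : 0 < 1 + K by rewrite ltr_wpDr.
  have dbl k : k%:R / (2 * (1 + K)) <= \sum_(j < 2 ^ k) t b j.
    elim: k => [|k IH]; first by rewrite mul0r sumr_ge0 // => j _; exact: cyl_length_ge0.
    rewrite expnS mul2n -addnn big_split_ord /= -natr1 mulrDl; apply: lerD => //.
    apply: le_trans (_ : \sum_(i < 2 ^ k) ((1 + K) * (2 ^ k.+1)%:R)^-1 <= _).
      rewrite sumr_const card_ord -mulr_natl expnS natrM.
      rewrite le_eqVlt; apply/orP; left; apply/eqP; field.
      by rewrite natrX expf_neq0 //= lt0r_neq0.
    apply: ler_sum => i _; apply: le_trans (tail_ge_harmonic _ _).
    rewrite lef_pV2 ?posrE ?mulr_gt0 ?ltr0n ?expn_gt0 //.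
    rewrite ler_pM2l // ler_nat expnS mul2n -addnn -addnS leq_add2l.
    exact: ltn_ord.
  have [k hk] : exists k, B * (2 * (1 + K)) <= k%:R.
    exists (Num.bound `|B * (2 * (1 + K))|); apply: le_trans (ler_norm _) _.
    by rewrite ltW // archi_boundP.
  exists (2 ^ k)%N; apply: le_trans (dbl k).
  by rewrite ler_pdivlMr // mulr_gt0.
Qed.

End Cylinders.

(** * Differentiation relative to a segment *)

Section Segment.
Context {R : realType}.
Implicit Types (D : set R) (f F T : R -> R) (a b x y l : R).

Lemma is_derive_inP D f x l : is_derive_in D f x l ->
  forall e, 0 < e -> exists2 r, 0 < r & forall y, D y -> y != x ->
    `|x - y| < r -> `|l - (f y - f x) / (y - x)| < e.
Proof.
move=> /cvgrPdist_lt H e e0; have := H e e0.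
rewrite near_withinE near_withinE => /nbhs_ballP[r /= r0 hr].
exists r => // y Dy yx xy; exact: (hr y xy yx Dy).
Qed.

Lemma derivable_inP D f x : derivable_in D f x ->
  is_derive_in D f x (derive_in D f x).
Proof. by []. Qed.

Lemma derivable_in_continuous a b f :
  (forall x, `[a, b]%classic x -> derivable_in `[a, b] f x) ->
  {within `[a, b], continuous f}.
Proof.
move=> df; apply/subspace_continuousP => x Dx.
have := is_derive_inP (derivable_inP (df x Dx)).
set l := derive_in _ _ _ => H; have [r r0 hr] := H 1 ltr01.
apply/cvgrPdist_lt => e e0; rewrite near_withinE.
pose B := `|l| + 1; have B0 : 0 < B by rewrite ltr_wpDl.
apply/nbhs_ballP; exists (Num.min r (e / B)) => /=.
  by rewrite lt_min r0 divr_gt0.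
move=> y /=; rewrite /ball /= lt_min => /andP[xyr xye] Dy.
have [->|yx] := eqVneq y x; first by rewrite subrr normr0.
have q : `|(f y - f x) / (y - x)| <= B.
  have := ltW (hr y Dy yx xyr); have := ler_normB l (l - (f y - f x) / (y - x)).
  by rewrite opprB addrC subrK /B; lra.
have yx0 : y - x != 0 by rewrite subr_eq0.
have -> : f x - f y = (f y - f x) / (y - x) * (x - y) by field.
rewrite normrM; apply: le_lt_trans (ler_wpM2r _ q) _ => //.
by rewrite mulrC -ltr_pdivlMr.
Qed.

Lemma derivable_in_is_derive a b f x : a < x < b ->
  derivable_in `[a, b] f x -> is_derive x 1 f (derive_in `[a, b] f x).
Proof.
move=> /andP[ax xb] df; set l := derive_in _ _ _.
suff H : h^-1 *: (f (h *: 1 + x) - f x) @[h --> 0^'] --> l.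
  by apply: DeriveDef; [exact: cvgP H | exact: cvg_lim H].
apply/cvgrPdist_lt => e e0; rewrite near_withinE.
have [r r0 hr] := is_derive_inP (derivable_inP df) e0.
apply/nbhs_ballP; exists (Num.min r (Num.min (x - a) (b - x))) => /=.
  by rewrite !lt_min r0 !subr_gt0 ax xb.
move=> h /=; rewrite /ball /= sub0r normrN !lt_min => /and3P[hr' ha hb] h0.
rewrite /GRing.scale /= mulr1.
have := hr (h + x); rewrite addrK mulrC; apply.
- by move: ha hb; rewrite !ltr_norml /= in_itv /=; lra.
- by rewrite -subr_eq0 addrK.
- by rewrite opprD addrCA subrr addr0 normrN.
Qed.

Lemma derivable_in_MVT a b f : 
  (forall x, `[a, b]%classic x -> derivable_in `[a, b] f x) ->
  forall x y, a <= x -> x < y -> y <= b ->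
  exists xi, [/\ x < xi, xi < y & f y - f x = derive_in `[a, b] f xi * (y - x)].
Proof.
move=> df x y ax xy yb.
have [||xi] := @MVT _ f (derive_in `[a, b] f) x y xy.
- move=> z; rewrite in_itv /= => /andP[xz zy]; apply: derivable_in_is_derive.
    by rewrite (le_lt_trans ax xz) (lt_le_trans zy yb).
  by apply: df; rewrite /= in_itv /= (le_trans ax (ltW xz)) (le_trans (ltW zy) yb).
- apply: continuous_subspaceW (derivable_in_continuous df).
  by apply: subset_itv; rewrite bnd_simp.
by rewrite in_itv /= => /andP[h1 h2] E; exists xi.
Qed.

Lemma C2_on_lipschitz a b f : a <= b -> C2_on `[a, b] f ->
  exists2 K, 0 <= K & forall x y, a <= x <= b -> a <= y <= b ->
    `|derive_in `[a, b] f x - derive_in `[a, b] f y| <= K * `|x - y|.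
Proof.
move=> ab [_ d2 c2]; set d := derive_in `[a, b] f in d2 c2 *.
have [m1 m1P h1] := EVT_max ab c2; have [m2 m2P h2] := EVT_min ab c2.
set dd := derive_in `[a, b] d in h1 h2.
pose K := `|dd m1| + `|dd m2|; exists K; first by rewrite addr_ge0.
suff H x y : a <= x -> x < y -> y <= b -> `|d x - d y| <= K * `|x - y|.
  move=> x y /andP[ax xb] /andP[ay yb]; case: (ltgtP x y) => [xy|yx|->].
  - exact: H.
  - by rewrite distrC [`|x - y|]distrC; exact: H.
  - by rewrite !subrr normr0 mulr0.
move=> ax xy yb; have [xi [h3 h4 E]] := derivable_in_MVT d2 ax xy yb.
rewrite distrC [`|x - y|]distrC E normrM ler_wpM2r // -/dd.
have xiP : xi \in `[a, b] by rewrite in_itv /= (le_trans ax (ltW h3)) (le_trans (ltW h4) yb).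
have := h1 _ xiP; have := h2 _ xiP => l1 l2; rewrite /K ler_norml.
have := ler_norm (dd m1); have := ler_norm (- dd m2); rewrite normrN => n1 n2.
have := normr_ge0 (dd m1); have := normr_ge0 (dd m2) => n3 n4.
by apply/andP; split; lra.
Qed.

(** The quotients of [T] and [F] are bounded near [x], so the values at [x] agree;
    then the quotients coincide along points that tend to [x]. *)
Lemma derive_in_unique D D' T F x l l' :
    is_derive_in D T x l -> is_derive_in D' F x l' ->
    (forall r, 0 < r -> exists y,
       [/\ D y, D' y, y != x, `|x - y| < r & T y = F y]) ->
  T x = F x /\ l = l'.
Proof.
move=> /is_derive_inP HT /is_derive_inP HF Hy.
have TF : T x = F x.
  apply/eqP; rewrite -subr_eq0 -normr_le0 leNgt; apply/negP.
  set dl := `|_| => dl0.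
  have [r1 r10 h1] := HT 1 ltr01; have [r2 r20 h2] := HF 1 ltr01.
  pose B := `|l| + `|l'| + 2; have B0 : 0 < B by rewrite ltr_wpDl // addr_ge0.
  have [|y [Dy Dy' yx]] := Hy (Num.min (Num.min r1 r2) (dl / B)).
    by rewrite !lt_min r10 r20 divr_gt0.
  rewrite !lt_min => /andP[/andP[y1 y2] y3] E.
  have q1 := h1 y Dy yx y1; have q2 := h2 y Dy' yx y2; rewrite E in q1.
  have yx0 : y - x != 0 by rewrite subr_eq0.
  have : dl <= B * `|x - y|.
    have -> : dl = `|((F y - F x) / (y - x) - (F y - T x) / (y - x)) * (x - y)|.
      rewrite /dl; have -> : ((F y - F x) / (y - x) - (F y - T x) / (y - x)) * (x - y) =
        F x - T x by field.
      exact: distrC.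
    rewrite normrM ler_wpM2r //.
    set A := (F y - F x) / _ in q2 *; set A' := (F y - T x) / _ in q1 *.
    have -> : A - A' = (l' - l) - (l' - A) + (l - A') by ring.
    apply: le_trans (ler_normD _ _) _; have := ler_normB (l' - l) (l' - A).
    have := ler_normB l' l; rewrite /B; lra.
  rewrite -ler_pdivrMl // mulrC leNgt.
  by rewrite y3.
split=> //; apply/eqP; rewrite -subr_eq0 -normr_le0 leNgt; apply/negP.
set dl := `|_| => dl0; have d2 : 0 < dl / 2 by rewrite divr_gt0.
have [r1 r10 h1] := HT _ d2; have [r2 r20 h2] := HF _ d2.
have [|y [Dy Dy' yx]] := Hy (Num.min r1 r2); first by rewrite lt_min r10.
rewrite lt_min => /andP[y1 y2] E.
have q1 := h1 y Dy yx y1; have q2 := h2 y Dy' yx y2; rewrite E TF in q1.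
move: q1 q2; set A := (_ / _) => q1 q2.
have := ler_normB (l - A) (l' - A).
have -> : l - A - (l' - A) = l - l' by ring.
by rewrite -/dl; lra.
Qed.

(** A value of [F a] other than [0] would either be attained inside or, by the
    intermediate value theorem, force the value [0] inside; likewise at [b]. *)
Lemma branch_ends F a b : a < b -> {within `[a, b], continuous F} ->
    (forall x y, a <= x -> x < y -> y <= b -> F x < F y) ->
    (forall x, a < x < b -> 0 < F x < 1) ->
    (forall y, 0 < y < 1 -> exists2 x, a < x < b & F x = y) ->
  F a = 0 /\ F b = 1.
Proof.
move=> ab cF Flt F01 Fsurj.
pose m := (a + b) / 2; have [am mb] := midf_lt ab; rewrite -/m in am mb.
have mab : a < m < b by rewrite am.
have /andP[m0 m1] := F01 m mab.
have Fam := Flt a m (lexx _) am (ltW mb); have Fmb := Flt m b (ltW am) mb (lexx _).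
split; apply/eqP; rewrite eq_le !leNgt; apply/andP; split; apply/negP => h.
- have [|x /andP[ax xb] Fx] := Fsurj (F a); first by rewrite h (lt_trans Fam).
  by have := Flt a x (lexx _) ax (ltW xb); rewrite Fx ltxx.
- have [||z] := @IVT _ F a m 0 (ltW am).
  + by apply: continuous_subspaceW cF; apply: subset_itv; rewrite bnd_simp // ltW.
  + by rewrite ge_min le_max (ltW h) (ltW m0) orbT.
  rewrite in_itv /= le_eqVlt => /andP[/orP[/eqP za|az] zm] Fz.
    by move: h; rewrite za Fz ltxx.
  by have := F01 z; rewrite az (le_lt_trans zm mb) Fz ltxx => /(_ isT).
- have [||z] := @IVT _ F m b 1 (ltW mb).
  + by apply: continuous_subspaceW cF; apply: subset_itv; rewrite bnd_simp // ltW.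
  + by rewrite ge_min le_max (ltW h) (ltW m1) orbT.
  rewrite in_itv /= [(z <= b)%R]le_eqVlt => /andP[mz /orP[/eqP za|zb]] Fz.
    by move: h; rewrite -za Fz ltxx.
  by have := F01 z; rewrite (lt_le_trans am mz) zb Fz ltxx andbF => /(_ isT).
- have [|x /andP[ax xb] Fx] := Fsurj (F b); first by rewrite h (lt_trans m0).
  by have := Flt x b (ltW ax) xb (lexx _); rewrite Fx ltxx.
Qed.

End Segment.

(** * The branches of an indifferent map and their inverses *)

Definition lo (R : realType) (c : R) (b : bool) : R := if b then c else 0.
Definition hi (R : realType) (c : R) (b : bool) : R := if b then 1 else c.
Definition fixpt (R : realType) (b : bool) : R := b%:R.

Record branches (R : realType) (c : R) (T : R -> R) (F d : bool -> R -> R) (K : R)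
    : Prop := Branches {
  br_T : forall b x, lo c b < x < hi c b -> T x = F b x;
  br_T01 : forall b x, lo c b < x < hi c b -> 0 < T x < 1;
  br_lo : forall b, F b (lo c b) = 0;
  br_hi : forall b, F b (hi c b) = 1;
  br_cont : forall b, {within `[lo c b, hi c b], continuous (F b)};
  br_dcont : forall b, {within `[lo c b, hi c b], continuous (d b)};
  br_mvt : forall b x y, lo c b <= x -> x < y -> y <= hi c b ->
    exists xi, [/\ x < xi, xi < y & F b y - F b x = d b xi * (y - x)];
  br_d : forall b x, lo c b <= x <= hi c b -> x != fixpt R b -> 1 < d b x;
  br_dfix : forall b, d b (fixpt R b) = 1;
  br_K : 0 <= K;
  br_lip : forall b x y, lo c b <= x <= hi c b -> lo c b <= y <= hi c b ->
    `|d b x - d b y| <= K * `|x - y| }.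

Lemma indifferent_map_branches (R : realType) (c : R) (T : R -> R) :
    0 < c < 1 -> indifferent_map c T ->
  exists F d K, branches c T F d K.
Proof.
move=> /andP[c0 c1] [_ [D0 D1] [F0 [F1 [[C0 E0] [C1 E1] d0 d1]]] [T0 T1] _].
pose F b := if b then F1 else F0.
pose d b := derive_in `[lo c b, hi c b] (F b).
have lohi b : lo c b < hi c b by case: b.
have C2 b : C2_on `[lo c b, hi c b] (F b) by case: b.
have TF b x : lo c b < x < hi c b -> T x = F b x.
  by case: b => /= xb; [rewrite E1 | rewrite E0]; rewrite ?in_itv.
have bij b : set_bij `]lo c b, hi c b[ `]0, 1[ T by case: b; [case: D1 | case: D0].
have T01 b x : lo c b < x < hi c b -> 0 < T x < 1.
  move=> xb; have [h _ _] := bij b.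
  by have := h x; rewrite /= !in_itv /= => /(_ xb).
have Fsurj b y : 0 < y < 1 -> exists2 x, lo c b < x < hi c b & F b x = y.
  move=> yb; have [_ _ h] := bij b.
  have [|x] := h y; first by rewrite /= in_itv.
  by rewrite /= in_itv /= => xb Tx; exists x => //; rewrite -TF.
have der b : forall x, `[lo c b, hi c b]%classic x -> derivable_in `[lo c b, hi c b] (F b) x.
  by case: (C2 b).
have dgt b x : lo c b <= x <= hi c b -> x != fixpt R b -> 1 < d b x.
  rewrite /fixpt; case: b => /= /andP[h1 h2] h3.
    by apply: d1; rewrite h1 lt_neqAle h3.
  by apply: d0; rewrite h2 andbT lt_neqAle eq_sym h3.
have Flt b x y : lo c b <= x -> x < y -> y <= hi c b -> F b x < F b y.
  move=> lx xy yh; have [xi [h1 h2 E]] := derivable_in_MVT (der b) lx xy yh.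
  rewrite -subr_gt0 E mulr_gt0 ?subr_gt0 // (lt_trans ltr01) //; apply: dgt.
    by rewrite (le_trans lx (ltW h1)) (le_trans (ltW h2) yh).
  move: lx xy yh h1 h2; rewrite /fixpt; case: (b) => /= ? ? ? ? ?.
    by rewrite lt_eqF //; lra.
  by rewrite gt_eqF //; lra.
have ends b : F b (lo c b) = 0 /\ F b (hi c b) = 1.
  have F01 x : lo c b < x < hi c b -> 0 < F b x < 1.
    by move=> xb; rewrite -TF // (T01 b).
  exact: (branch_ends (lohi b) (derivable_in_continuous (der b)) (Flt b) F01 (Fsurj b)).
have [K0 K00 L0] := C2_on_lipschitz (ltW (lohi false)) (C2 false).
have [K1 K10 L1] := C2_on_lipschitz (ltW (lohi true)) (C2 true).
exists F, d, (K0 + K1); split => //.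
- by move=> b; have [] := ends b.
- by move=> b; have [] := ends b.
- by move=> b; exact: derivable_in_continuous (der b).
- by move=> b; case: (C2 b) => _ h _; exact: derivable_in_continuous h.
- by move=> b x y; exact: (derivable_in_MVT (der b)).
- move=> b; rewrite /fixpt.
  have near_fix b0 r : 0 < r -> exists y, [/\ lo c b0 < y < hi c b0, y != b0%:R & `|b0%:R - y| < r].
    move=> r0; case: b0 => /=.
      exists (1 - Num.min (r / 2) ((1 - c) / 2)).
      have m0 : 0 < Num.min (r / 2) ((1 - c) / 2) by rewrite lt_min !divr_gt0 ?subr_gt0.
      have m1 : Num.min (r / 2) ((1 - c) / 2) <= r / 2 by rewrite ge_min lexx.
      have m2 : Num.min (r / 2) ((1 - c) / 2) <= (1 - c) / 2 by rewrite ge_min lexx orbT.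
      set m := Num.min _ _ in m0 m1 m2 *.
      split; [by apply/andP; split; lra | by rewrite lt_eqF //; lra |].
      by rewrite opprB addrCA subrr addr0 gtr0_norm //; lra.
    exists (Num.min (r / 2) (c / 2)).
    have m0 : 0 < Num.min (r / 2) (c / 2) by rewrite lt_min !divr_gt0.
    have m1 : Num.min (r / 2) (c / 2) <= r / 2 by rewrite ge_min lexx.
    have m2 : Num.min (r / 2) (c / 2) <= c / 2 by rewrite ge_min lexx orbT.
    set m := Num.min _ _ in m0 m1 m2 *.
    split; [by apply/andP; split; lra | by rewrite gt_eqF |].
    by rewrite sub0r normrN gtr0_norm //; lra.
  have TD : is_derive_in `[0, 1] T b%:R 1 by case: b.
  have FD : is_derive_in `[lo c b, hi c b] (F b) b%:R (d b b%:R).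
    by apply/derivable_inP/der; rewrite /= in_itv /=; case: (b) => /=; rewrite lexx ltW.
  suff H : forall r, 0 < r -> exists y, [/\ `[0, 1]%classic y,
      `[lo c b, hi c b]%classic y, y != b%:R, `|b%:R - y| < r & T y = F b y].
    by have [_ <-] := derive_in_unique TD FD H.
  move=> r /(near_fix b)[y [yb yf yr]]; exists y; split => //; last exact: TF.
    have /andP[h1 h2] := yb; rewrite /= in_itv /=; move: h1 h2.
    by case: (b) => /= h1 h2; apply/andP; split; lra.
  by have /andP[h1 h2] := yb; rewrite /= in_itv /= !ltW.
- by rewrite addr_ge0.
- move=> b x y xb yb; rewrite mulrDl; case: b xb yb => xb yb.
    by apply: le_trans (L1 x y xb yb) _; rewrite lerDr mulr_ge0.
  by apply: le_trans (L0 x y xb yb) _; rewrite lerDl mulr_ge0.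
Qed.

Definition displacement (R : realType) (F : bool -> R -> R) (b : bool) (z : R) : R :=
  if b then 1 - z - F true (1 - z) else F false z - z.

Lemma branches_inverse (R : realType) (c : R) (T : R -> R) (F d : bool -> R -> R) (K : R) :
    0 < c < 1 -> branches c T F d K ->
  exists g rho, inverse_branches c g d (displacement F) K rho /\
    forall b x, lo c b < x < hi c b -> g b (T x) = x.
Proof.
move=> c01 h; have /andP[c0 c1] := c01.
have lohi b : lo c b < hi c b by case: b.
have lohile b := ltW (lohi b).
have [g hg] : {g : bool -> R -> R | forall b y, 0 <= y <= 1 ->
    lo c b <= g b y <= hi c b /\ F b (g b y) = y}.
  have H (by_ : bool * R) : exists x, 0 <= by_.2 <= 1 ->
      lo c by_.1 <= x <= hi c by_.1 /\ F by_.1 x = by_.2.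
    case: by_ => b y /=; case: (boolP (0 <= y <= 1)) => [yb|_]; last by exists 0.
    have [||x] := @IVT _ (F b) (lo c b) (hi c b) y (lohile b).
    - exact: (br_cont h).
    - by rewrite (br_lo h) (br_hi h) minElt maxElt ltr01.
    by rewrite in_itv /= => xb Fx; exists x.
  have [f hf] := choice H; exists (fun b y => f (b, y)) => b y.
  exact: (hf (b, y)).
have gF b y (yb : 0 <= y <= 1) := (hg b y yb).2.
have gI b y (yb : 0 <= y <= 1) := (hg b y yb).1.
have d1 b x : lo c b <= x <= hi c b -> 1 <= d b x.
  move=> xb; have [->|xe] := eqVneq x (fixpt R b); first by rewrite (br_dfix h).
  by rewrite ltW // (br_d h).
have sub_itv b x y z : lo c b <= x -> x <= y -> y <= z -> z <= hi c b ->
    lo c b <= y <= hi c b.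
  by move=> h1 h2 h3 h4; rewrite (le_trans h1 h2) (le_trans h3 h4).
have Fgrow b x y : lo c b <= x -> x <= y -> y <= hi c b -> y - x <= F b y - F b x.
  move=> lx; rewrite le_eqVlt => /orP[/eqP ->|xy yh]; first by rewrite !subrr.
  have [xi [h1 h2 ->]] := br_mvt h lx xy yh.
  rewrite ler_peMl ?subr_ge0 ?(ltW xy) //; apply: d1.
  exact: sub_itv lx (ltW h1) (ltW h2) yh.
have Finj b x y : lo c b <= x <= hi c b -> lo c b <= y <= hi c b ->
    F b x = F b y -> x = y.
  move=> /andP[x1 x2] /andP[y1 y2] E; case: (ltgtP x y) => // xy.
    by have := Fgrow b x y x1 (ltW xy) y2; rewrite E subrr subr_le0 leNgt xy.
  by have := Fgrow b y x y1 (ltW xy) x2; rewrite E subrr subr_le0 leNgt xy.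
have loI b : lo c b <= lo c b <= hi c b by rewrite lexx /=.
have hiI b : lo c b <= hi c b <= hi c b by rewrite lexx andbT.
have I0 : 0 <= (0 : R) <= 1 by rewrite lexx ler01.
have I1 : 0 <= (1 : R) <= 1 by rewrite lexx ler01.
have cI : 0 <= c <= 1 by rewrite !ltW.
have g0 b : g b 0 = lo c b by apply: (Finj b) => //; [exact: gI | rewrite gF // (br_lo h)].
have g1 b : g b 1 = hi c b by apply: (Finj b) => //; [exact: gI | rewrite gF // (br_hi h)].
have glt b x y : 0 <= x <= 1 -> 0 <= y <= 1 -> x < y -> g b x < g b y.
  move=> xb yb xy; rewrite ltNge; apply/negP => gyx.
  have /andP[a1 _] := gI b y yb; have /andP[_ a2] := gI b x xb.
  have := Fgrow b _ _ a1 gyx a2; rewrite !gF // => q.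
  have : 0 <= g b x - g b y by rewrite subr_ge0.
  by move: q xy; lra.
have gmvt b x y : 0 <= x -> x < y -> y <= 1 ->
    exists xi, [/\ g b x < xi, xi < g b y & y - x = d b xi * (g b y - g b x)].
  move=> x0 xy y1.
  have xb : 0 <= x <= 1 by rewrite x0 (le_trans (ltW xy)).
  have yb : 0 <= y <= 1 by rewrite y1 (le_trans x0 (ltW xy)).
  have /andP[a1 _] := gI b x xb; have /andP[_ a2] := gI b y yb.
  have [xi [h1 h2 E]] := br_mvt h a1 (glt b x y xb yb xy) a2.
  by exists xi; split => //; rewrite -E !gF.
(* the image of the other side is a segment that avoids the fixed point, so that
   the derivative has a minimum greater than 1 there *)
have [rho [rho01 hrho]] : exists rho, 0 <= rho < 1 /\ forall b x,
    g b (lo c (~~ b)) <= x <= g b (hi c (~~ b)) -> 1 <= rho * d b x.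
  have H b : exists2 m, 1 < m & forall x,
      g b (lo c (~~ b)) <= x <= g b (hi c (~~ b)) -> m <= d b x.
    have lI : 0 <= lo c (~~ b) <= 1 by case: (b) => /=; rewrite ?lexx ?ler01 ?ltW.
    have hI : 0 <= hi c (~~ b) <= 1 by case: (b) => /=; rewrite ?lexx ?ler01 ?ltW.
    have ll := glt b _ _ lI hI (lohi (~~ b)).
    have /andP[l1 l2] := gI b _ lI; have /andP[h1 h2] := gI b _ hI.
    have [|m mP hm] := @EVT_min _ (d b) _ _ (ltW ll).
      have dc := br_dcont h (b := b); apply: continuous_subspaceW dc.
      by apply: subset_itv; rewrite bnd_simp.
    exists (d b m); last by move=> x xb; apply: hm; rewrite in_itv.
    move: mP; rewrite in_itv /= => /andP[m1 m2].
    apply: (br_d h); first exact: sub_itv l1 m1 m2 h2.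
    case: (b) ll m1 m2 => /= ll m1 m2; rewrite /fixpt /=.
      rewrite lt_eqF // (le_lt_trans m2) // -[ltRHS](g1 true).
      exact: glt cI I1 c1.
    rewrite gt_eqF // (lt_le_trans _ m1) // -[ltLHS](g0 false).
    exact: glt I0 cI c0.
  have [m0 m01 hm0] := H false; have [m1 m11 hm1] := H true.
  have p0 : 0 < m0 by exact: lt_trans m01.
  have p1 : 0 < m1 by exact: lt_trans m11.
  exists (Num.max m0^-1 m1^-1); split.
    by rewrite le_max invr_ge0 ltW // gt_max !invf_lt1 // m01.
  move=> b x xb; case: b xb => xb.
    apply: le_trans (_ : m1^-1 * d true x <= _).
      by rewrite ler_pdivlMl // mulr1 hm1.
    by rewrite ler_wpM2r ?le_max ?lexx ?orbT // (le_trans _ (hm1 x xb)) // ltW.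
  apply: le_trans (_ : m0^-1 * d false x <= _).
    by rewrite ler_pdivlMl // mulr1 hm0.
  by rewrite ler_wpM2r ?le_max ?lexx ?orbT // (le_trans _ (hm0 x xb)) // ltW.
exists g, rho; split; last first.
  move=> b x xb; apply: (Finj b).
  - by apply: gI; have /andP[t0 t1] := br_T01 h xb; rewrite !ltW.
  - by have /andP[x1 x2] := xb; rewrite !ltW.
  - rewrite gF; first exact: (br_T h).
    by have /andP[t0 t1] := br_T01 h xb; rewrite !ltW.
have lip b x y : lo c b <= x <= hi c b -> lo c b <= y <= hi c b ->
    d b x <= d b y + K * `|x - y|.
  move=> xb yb; have := br_lip h xb yb; have := ler_norm (d b x - d b y).
  by move=> h1 h2; have := le_trans h1 h2; lra.
split => //.
- exact: (br_K h).
- by move=> b x; rewrite g0 g1; exact: d1.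
- by move=> b x y; rewrite g0 g1; exact: lip.
- move=> b x y; rewrite g0 g1 => lx xy yh.
  have lI : 0 <= lo c (~~ b) <= 1 by case: (b) => /=; rewrite ?lexx ?ler01 ?ltW.
  have hI : 0 <= hi c (~~ b) <= 1 by case: (b) => /=; rewrite ?lexx ?ler01 ?ltW.
  have /andP[l0 _] := lI; have /andP[_ h1] := hI.
  have x0 := le_trans l0 lx; have y1 := le_trans yh h1.
  have xb : 0 <= x <= 1 by rewrite x0 (le_trans (ltW xy)).
  have yb : 0 <= y <= 1 by rewrite y1 (le_trans x0 (ltW xy)).
  have [xi [a1 a2 ->]] := gmvt b x y x0 xy y1.
  have gg : 0 <= g b y - g b x by rewrite subr_ge0 ltW // glt.
  rewrite mulrA -{1}[g b y - g b x]mul1r; apply: ler_wpM2r => //; apply: hrho.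
  have gle u v : 0 <= u <= 1 -> 0 <= v <= 1 -> u <= v -> g b u <= g b v.
    by move=> ub vb; rewrite le_eqVlt => /orP[/eqP -> //|uv]; rewrite ltW // glt.
  by rewrite (le_trans _ (ltW a1)) ?gle // (le_trans (ltW a2)) // gle.
- by move=> u ub; rewrite /displacement gF //; ring.
- move=> u ub; rewrite /displacement.
  have -> : 1 - (1 - g true u) = g true u by ring.
  by rewrite gF //; ring.
- have strict b x y : lo c b <= x -> x < y -> y <= hi c b -> y - x < F b y - F b x.
    move=> lx xy yh; have [xi [h1 h2 ->]] := br_mvt h lx xy yh.
    rewrite ltr_pMl ?subr_gt0 //; apply: (br_d h).
      exact: sub_itv lx (ltW h1) (ltW h2) yh.
    move: lx yh h1 h2; rewrite /fixpt; case: (b) => /= l1 l2 l3 l4.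
      by rewrite lt_eqF //; lra.
    by rewrite gt_eqF //; lra.
  move=> b z; rewrite /displacement /width; case: b => /andP[z0 zw].
    have := strict true (1 - z) 1; rewrite /= (br_hi h true : F true 1 = 1).
    move=> H; have : 1 - (1 - z) < 1 - F true (1 - z) by apply: H => //; lra.
    by lra.
  have := strict false 0 z; rewrite /= (br_lo h false : F false 0 = 0) !subr0 => H.
  by rewrite subr_gt0; exact: H.
- move=> b z z' z0 zz zw; rewrite /displacement; move: zw; rewrite /width; case: b => zw.
    have := Fgrow true (1 - z') (1 - z) => /= H.
    have : 1 - z - (1 - z') <= F true (1 - z) - F true (1 - z') by apply: H; lra.
    by lra.
  by have := Fgrow false z z' z0 zz zw; lra.
- move=> b z /andP[]; rewrite le_eqVlt => /orP[/eqP <- _|z0].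
    rewrite expr0n mulr0 /displacement; case: b.
      by rewrite !subr0 (br_hi h true : F true 1 = 1) subrr.
    by rewrite (br_lo h false : F false 0 = 0) subrr.
  have K0 := br_K h; rewrite /width /displacement; case: b => zw.
    have l1 : c <= 1 - z by lra.
    have l2 : 1 - z < 1 by lra.
    have [xi [h1 h2]] := @br_mvt _ _ _ _ _ _ h true (1 - z) 1 l1 l2 (lexx _).
    rewrite (br_hi h true : F true 1 = 1) opprB addrCA subrr addr0 => E.
    have := lip true xi 1; rewrite (br_dfix h true : d true 1 = 1) /= => H.
    have {}H : d true xi <= 1 + K * `|xi - 1| by apply: H; apply/andP; split; lra.
    have n : `|xi - 1| <= z by rewrite ler_norml; apply/andP; split; lra.
    have Kz := ler_wpM2l K0 n.
    have : d true xi * z <= (1 + K * z) * z by apply: ler_wpM2r; lra.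
    by rewrite expr2; move: E; lra.
  have [xi [h1 h2]] := @br_mvt _ _ _ _ _ _ h false 0 z (lexx _) z0 zw.
  rewrite (br_lo h false : F false 0 = 0) !subr0 => E.
  have := lip false xi 0; rewrite (br_dfix h false : d false 0 = 1) /= => H.
  have {}H : d false xi <= 1 + K * `|xi - 0| by apply: H; apply/andP; split; lra.
  have n : `|xi - 0| <= z by rewrite ler_norml; apply/andP; split; lra.
  have Kz := ler_wpM2l K0 n.
  have : d false xi * z <= (1 + K * z) * z by apply: ler_wpM2r; lra.
  by rewrite expr2; move: E; lra.
Qed.

(** * Itineraries and null sets *)

Section Itineraries.
Context {R : realType} (c : R) (T : R -> R).
Implicit Types (x : R) (n m k : nat).

Fixpoint itinerary n x : seq bool :=
  if n is n'.+1 then (c < x) :: itinerary n' (T x) else [::].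

Lemma size_itinerary n x : size (itinerary n x) = n.
Proof. by elim: n x => //= n IH x; rewrite IH. Qed.

Lemma mem_itinerary n x : itinerary n x \in words n.
Proof. by rewrite mem_words size_itinerary. Qed.

Lemma itineraryD n m x :
  itinerary (n + m) x = itinerary n x ++ itinerary m (iter n T x).
Proof. by elim: n x => //= n IH x; rewrite IH -iterS iterSr. Qed.

(** Points with an unambiguous itinerary. *)
Definition generic : set R :=
  [set x | forall k, 0 < iter k T x < 1 /\ iter k T x != c].

Lemma generic_iter k x : generic x -> generic (iter k T x).
Proof. by move=> gx n; rewrite -iterD; exact: gx. Qed.

Context (g d gap : bool -> R -> R) (K rho : R)
  (hg : inverse_branches c g d gap K rho)
  (gT : forall b x, lo c b < x < hi c b -> g b (T x) = x)
  (T01 : forall b x, lo c b < x < hi c b -> 0 < T x < 1).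

Local Notation mu := (@lebesgue_measure R).
Local Notation len := (cyl_length g).

Lemma lo_hi_symbol x : 0 < x < 1 -> x != c -> lo c (c < x) < x < hi c (c < x).
Proof.
move=> /andP[x0 x1] xc; case: (ltP c x) => h /=; first by rewrite h.
by rewrite x0 lt_neqAle xc.
Qed.

Lemma generic_branch x : generic x -> g (c < x) (T x) = x.
Proof. by move=> /(_ 0%N)[/= x01 xc]; apply/gT/lo_hi_symbol. Qed.

Lemma ibranch_itinerary n x : generic x ->
  x = ibranch g (itinerary n x) (iter n T x).
Proof.
elim: n x => //= n IH x gx; rewrite -iterS iterSr.
by rewrite -/(ibranch g _ _) -IH ?(generic_branch gx) //; exact: (generic_iter 1).
Qed.

Definition cylinder w : set R := `[ibranch g w 0, ibranch g w 1]%classic.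

Lemma generic_cylinder n x : generic x -> cylinder (itinerary n x) x.
Proof.
move=> gx; rewrite /cylinder /= in_itv /= {2 3}(ibranch_itinerary n gx).
have [/andP[h0 h1] _] := gx n.
by rewrite !(ibranch_le hg) // ltW.
Qed.

Definition cylinders n (P : pred (seq bool)) : set R :=
  \big[setU/set0]_(w <- words n | P w) cylinder w.

Lemma measurable_cylinders n P : measurable (cylinders n P).
Proof. by apply: bigsetU_measurable => w _; exact: measurable_itv. Qed.

Lemma measure_cylinder w : mu (cylinder w) = (len w)%:E.
Proof.
rewrite /cylinder lebesgue_measure_itv /= lte_fin.
by rewrite (ibranch_lt hg) //= EFinN EFinB.
Qed.

Lemma measure_cylinders n P :
  (mu (cylinders n P) <= (\sum_(w <- words n | P w) len w)%:E)%E.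
Proof.
rewrite /cylinders; elim: (words n) => [|w l IH]; first by rewrite !big_nil measure0.
rewrite !big_cons; case: ifP => // _.
apply: le_trans (measureU2 _ _ _) _.
- exact: measurable_itv.
- by apply: bigsetU_measurable => v _; exact: measurable_itv.
have cw : (mu (cylinder w) <= (len w)%:E)%E by rewrite measure_cylinder.
by rewrite EFinD; apply: leeD; [exact: cw | exact: IH].
Qed.

Lemma generic_cylinders n (P : pred (seq bool)) x : generic x -> P (itinerary n x) -> cylinders n P x.
Proof.
move=> gx Px; rewrite /cylinders -bigcup_seq_cond.
by exists (itinerary n x); [rewrite /= mem_itinerary | exact: generic_cylinder].
Qed.

(** Apart from the end points, the exceptional points are preimages of [c], that
    is, values of the countably many inverse branches at [c]. *)
Lemma nongeneric_negligible : mu.-negligible (`[0, 1] `\` generic).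
Proof.
have cn (A : set R) : countable A -> mu.-negligible A.
  move=> cA; exists A; split => //; last exact: countable_lebesgue_measure0.
  by apply: countable_measurable => // t; exact: measurable_set1.
have nC : mu.-negligible (range (fun w => ibranch g w c) `|` ([set 0] `|` [set 1])).
  apply: negligibleU; first exact: cn (sub_countable (card_image_le _ _) (countableP _)).
  by apply: negligibleU; apply: cn; exact: countable1.
apply: negligibleS nC.
move=> x [x01 ng]; apply: contrapT => nC; apply: ng => k.
have x0 : 0 < x < 1.
  move: x01; rewrite /= in_itv /= => /andP[h0 h1]; rewrite !lt_neqAle h0 h1 !andbT.
  by apply/andP; split; apply/eqP => e; apply: nC; right; [left|right]; rewrite /= e.
suff : exists w, x = ibranch g w (iter k T x) /\ 0 < iter k T x < 1.
  move=> [w [xw h01]]; split => //; apply/eqP => ec.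
  by apply: nC; left; exists w; rewrite // -ec.
elim: k => [|k [w [xw h01]]]; first by exists [::].
have kc : iter k T x != c.
  by apply/eqP => ec; apply: nC; left; exists w; rewrite // -ec.
have sb := lo_hi_symbol h01 kc.
exists (rcons w (c < iter k T x)); rewrite ibranch_rcons iterS gT //; split => //.
exact: T01 sb.
Qed.

Lemma ae_unit_generic (P : R -> Prop) (N : set R) : mu.-negligible N ->
  (forall x, generic x -> ~ N x -> P x) -> ae_unit P.
Proof.
move=> hN hP; apply: (negligibleS _ (negligibleU nongeneric_negligible hN)).
move=> x /= /not_implyP[x01 nP].
have [gx|ngx] := pselect (generic x); [right|left].
  by apply: contrapT => nN; exact/nP/hP.
by split => //=; rewrite in_itv.
Qed.

Lemma negligible_le_small (A : set R) :
    (forall e : R, 0 < e -> exists n (P : pred (seq bool)),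
      A `<=` cylinders n P /\ \sum_(w <- words n | P w) len w <= e) ->
  mu.-negligible A.
Proof.
move=> h.
have {}h k : exists E, [/\ measurable E, A `<=` E & (mu E <= (k.+1%:R^-1)%:E)%E].
  have [|n [P [AP hP]]] := h k.+1%:R^-1; first by rewrite invr_gt0.
  exists (cylinders n P); split => //; first exact: measurable_cylinders.
  by apply: le_trans (measure_cylinders n P) _; rewrite lee_fin.
have [E hE] := choice h.
exists (\bigcap_k E k); split.
- by apply: bigcap_measurable => // k _; case: (hE k).
- apply/eqP; rewrite eq_le measure_ge0 andbT; apply/lee_addgt0Pr => e e0.
  rewrite add0e; have [k hk] : exists k, k.+1%:R^-1 <= e.
    exists (Num.bound e^-1); rewrite invf_ple ?posrE //.
    by rewrite ltW // (lt_trans (archi_boundP _)) ?invr_ge0 ?ltW // ltr_nat.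
  have [mE AE lE] := hE k.
  apply: (@le_trans _ _ (mu (E k))); last by apply: le_trans lE _; rewrite lee_fin.
  apply: le_measure; rewrite ?inE //; last exact: bigcap_inf.
  by apply: bigcap_measurable => // j _; case: (hE j).
- by move=> x Ax k _; have [_ AE _] := hE k; exact: AE.
Qed.

Lemma limsup_negligible (n : nat -> nat) (P : nat -> pred (seq bool)) (C th : R) :
    0 <= th < 1 -> 0 <= C ->
    (forall i, \sum_(w <- words (n i) | P i w) len w <= C * th ^+ i) ->
  mu.-negligible (lim_sup_set (fun i => cylinders (n i) (P i))).
Proof.
move=> /andP[th0 th1] C0 hC.
have mF k : measurable (cylinders (n k) (P k)) by exact: measurable_cylinders.
exists (lim_sup_set (fun i => cylinders (n i) (P i))); split => //.
  apply: bigcapT_measurable => k; apply: bigcup_measurable => j _; exact: mF.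
apply: lim_sup_set_cvg0 => //.
apply: (@le_lt_trans _ _ (C / (1 - th))%:E); last exact: ltry.
apply: lime_le; first by apply: is_cvg_nneseries.
near=> m; apply: (@le_trans _ _ (\sum_(0 <= i < m) (C * th ^+ i)%:E)%E).
  apply: lee_sum => i _; apply: le_trans (measure_cylinders _ _) _.
  by rewrite lee_fin.
rewrite sumEFin lee_fin ler_pdivlMr ?subr_gt0 //.
have -> : (\sum_(0 <= i < m) C * th ^+ i) * (1 - th) = C * (1 - th ^+ m).
  elim: (m) => [|i IH]; first by rewrite big_nil expr0 subrr mul0r mulr0.
  by rewrite big_nat_recr //= mulrDl IH exprS; ring.
by rewrite -[leRHS]mulr1 ler_wpM2l // lerBlDr lerDl exprn_ge0.
Unshelve. all: by end_near. Qed.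

End Itineraries.

(** * Occupation times and long runs *)

Section UpperLowerLimits.
Context {R : realType}.
Implicit Types u : nat -> R.

Lemma limn_esup_pinfty u :
    (forall (M : R) N, exists n, (N <= n)%N /\ M <= u n) ->
  limn_esup (fun n => (u n)%:E) = +oo%E.
Proof.
move=> hu; rewrite /limn_esup limf_esupE; apply/eqP; rewrite -leye_eq.
apply: le_ereal_inf_tmp => /= _ [V [N _ NV] <-].
suff -> : ereal_sup [set (u n)%:E | n in V] = +oo%E by [].
apply: eq_infty => M; have [n [Nn Mn]] := hu M N.
apply: (@le_trans _ _ (u n)%:E); first by rewrite lee_fin.
by apply: ereal_sup_ubound; exists n => //; exact: NV.
Qed.

Lemma limn_einf_eq0 u : (forall n, 0 <= u n) ->
    (forall (e : R) N, 0 < e -> exists n, (N <= n)%N /\ u n <= e) ->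
  limn_einf (fun n => (u n)%:E) = 0%E.
Proof.
move=> u0 hu; rewrite /limn_einf /limn_esup limf_esupE.
apply/eqP; rewrite oppe_eq0 eq_le; apply/andP; split.
  apply: ge_ereal_inf.
  exists (ereal_sup [set (- (u n)%:E)%E | n in setT]).
    by exists setT => //; exact: filterT.
  apply: ge_ereal_sup => _ [n _ <-].
  by rewrite oppe_le0 lee_fin.
apply: le_ereal_inf_tmp => /= _ [V [N _ NV] <-].
apply/lee_subgt0Pr => e e0; rewrite sub0e.
have [n [Nn un]] := hu e N e0.
apply: (@le_trans _ _ (- (u n)%:E)%E); first by rewrite leeN2 lee_fin.
by apply: ereal_sup_ubound; exists n => //; exact: NV.
Qed.

End UpperLowerLimits.

Section LongRuns.
Context {R : realType} (c : R) (T : R -> R) (g d gap : bool -> R -> R) (K rho : R)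
  (hg : inverse_branches c g d gap K rho)
  (gT : forall b x, lo c b < x < hi c b -> g b (T x) = x)
  (T01 : forall b x, lo c b < x < hi c b -> 0 < T x < 1).
Implicit Types (b : bool) (x : R) (l m n s S M : nat).

Local Notation mu := (@lebesgue_measure R).
Local Notation len := (cyl_length g).
Local Notation law := (cyl_length_law hg).

Lemma infinitely_often_runs b (L : nat -> nat) :
    (forall s, (0 < L s)%N) -> {homo L : s t / (s <= t)%N} ->
    (forall B : R, exists n,
       B <= \sum_(s < n) start len b s * tail len b (L (s + s)%N)) ->
  exists2 N, mu.-negligible N & forall x, generic c T x -> ~ N x ->
    forall S, exists s n, (S <= s)%N /\ runs_at b (L s) s (itinerary c T n x).
Proof.
move=> L0 Lle hL.
pose N S := [set x | generic c T x /\ forall n, miss b L S (itinerary c T n x)].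
exists (\bigcup_S N S).
  apply: negligible_bigcup => S; apply: (negligible_le_small hg) => e e0.
  have [n hn] := miss_mass_small law L0 Lle hL S e0.
  exists n, (miss b L S); split => // x [gx hx].
  exact: (generic_cylinders hg gT).
move=> x gx nN S; apply: contrapT => nex; apply: nN; exists S => //; split => // n.
apply/(missP b L0) => s Ss; apply/negP => h.
by apply: nex; exists s, n.
Qed.

(** With boundedly many runs in the mean, the series of both letters would
    converge. *)
Lemma sum_start_unbounded b (B : R) : exists n, B <= \sum_(s < n) start len b s.
Proof.
apply: contrapT => /forallNP hB.
have {}hB n : \sum_(s < n) start len b s <= B.
  by rewrite ltW // ltNge; apply/negP.
have H a n : \sum_(s < n) start len a s <= B + 1.
  have [<-|ab] := eqVneq b a; first by apply: le_trans (hB n) _; rewrite lerDl.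
  have -> : a = ~~ b by case: a b ab {hB} => -[].
  by have := sum_start_le law (~~ b) n; rewrite negbK; have := hB n; lra.
have H2 a : summable_runs len a 1.
  exists (B + 1) => n; apply: le_trans (H a n); apply: ler_sum => s _.
  rewrite -[leRHS]mulr1; apply: ler_wpM2l; first exact: (start_ge0 law).
  exact: (law_le1 law).
exact: (not_summable_runs_both law (ltn0Sn 0) (H2 false) (H2 true)).
Qed.

Lemma visits_blocks b m : (0 < m)%N ->
  exists2 N, mu.-negligible N & forall x, generic c T x -> ~ N x ->
    exists s, itinerary c T m (iter s T x) = nseq m b.
Proof.
move=> m0; have tm : 0 < tail len b m := tail_gt0 hg b m.
have [||B|N hN h] := @infinitely_often_runs b (fun=> m) => //.
  have [n hn] := sum_start_unbounded b (B / tail len b m); exists n.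
  by rewrite -mulr_suml -ler_pdivrMr.
exists N => // x gx nN; have [s [n [_ hs]]] := h x gx nN 0%N; exists s.
have sn := runs_at_size m0 hs; rewrite size_itinerary in sn.
move: hs => /andP[_ /eqP]; rewrite -(subnKC sn) -addnA itineraryD.
by rewrite drop_size_cat ?size_itinerary // itineraryD take_size_cat // size_itinerary.
Qed.

Lemma infinitely_often_long_runs b :
    (forall M, (0 < M)%N -> ~ summable_runs len b M) ->
  exists2 N, mu.-negligible N & forall x, generic c T x -> ~ N x ->
    forall M S, exists s, [/\ (S <= s)%N &
      itinerary c T (M * s).+1 (iter s T x) = nseq (M * s).+1 b].
Proof.
move=> hb.
have H M : exists N, mu.-negligible N /\ forall x, generic c T x -> ~ N x ->
    forall S, exists s n, (S <= s)%N /\ runs_at b (M * s).+1 s (itinerary c T n x).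
  have [||B|N hN h] := @infinitely_often_runs b (fun s => (M * s).+1).
  - by [].
  - by move=> s t st; rewrite ltnS leq_mul2l st orbT.
  - have [n hn] : exists n, B + 1 <= \sum_(s < n) start len b s * tail len b ((M + M).+1 * s).
      apply: contrapT => /forallNP hB; apply: (hb (M + M).+1) => //.
      by exists (B + 1) => n; rewrite ltW // ltNge; apply/negP.
    exists n; case: n hn => [|n].
      by rewrite !big_ord0; apply: le_trans; rewrite lerDl.
    rewrite !big_ord_recl /= !muln0 => hn.
    have s0 : 0 <= start len b 0 by exact: (start_ge0 law).
    have t1 : 0 <= tail len b 1 by exact: (law_ge0 law).
    have s1 : start len b 0 * tail len b 0 <= 1.
      rewrite (tail0 law) mulr1 /start big_mkcond sum_words0 /=.
      by case: ifP => // _; exact: (law_le1 law).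
    have : \sum_(i < n) start len b (bump 0 i) * tail len b ((M + M).+1 * bump 0 i) <=
       \sum_(i < n) start len b (bump 0 i) *
           tail len b (M * (bump 0 i + bump 0 i)).+1.
      apply: ler_sum => i _; apply: ler_wpM2l; first exact: (start_ge0 law).
      by apply: (tail_le law); rewrite /bump /=; nia.
    by have := mulr_ge0 s0 t1; lra.
  by exists N.
have [N hN] := choice H; exists (\bigcup_M N M).
  by apply: negligible_bigcup => M; case: (hN M).
move=> x gx nN M S.
have [|s [n [Ss hs]]] := (hN M).2 x gx _ S.
  by move=> NM; apply: nN; exists M.
exists s; split => //.
have sn := runs_at_size (ltn0Sn _) hs; rewrite size_itinerary in sn.
move: hs => /andP[_ /eqP]; rewrite -(subnKC sn) -addnA itineraryD.
by rewrite drop_size_cat ?size_itinerary // itineraryD take_size_cat // size_itinerary.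
Qed.

Context (dA dB : R) (hA : 0 < dA < 1) (hB : 0 < dB < 1).

Definition side b : set R :=
  if b then `]1 - dB, 1]%classic else `[0, dA[%classic.

(** A run that lasts [m] more steps keeps the point within a tail of the fixed
    point. *)
Lemma side_block : exists2 m, (0 < m)%N & forall b x, generic c T x ->
  itinerary c T m x = nseq m b -> side b x /\ ~ side (~~ b) x.
Proof.
have /andP[a0 a1] := hA; have /andP[b0 b1] := hB.
pose e := Num.min (Num.min dA (1 - dA)) (Num.min dB (1 - dB)).
have e0 : 0 < e by rewrite !lt_min a0 b0 !subr_gt0 a1 b1.
have [n0 h0] := tail_small hg false (divr_gt0 e0 (ltr0n R 2)).
have [n1 h1] := tail_small hg true (divr_gt0 e0 (ltr0n R 2)).
have eh : e / 2 < e by rewrite ltr_pdivrMr // ltr_pMr // ltr1n.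
have [e1 e2 e3 e4] : [/\ e <= dA, e <= 1 - dA, e <= dB & e <= 1 - dB].
  by rewrite /e !ge_min !lexx ?orbT.
exists (maxn n0 n1).+1 => //; set m := (maxn n0 n1).+1 => b x gx E.
have [/andP[x0 x1] _] := gx 0%N; rewrite /= in x0 x1.
have := ibranch_itinerary gT m gx; rewrite E.
set z := iter m T x => xE.
have [/andP[z0 z1] _] := gx m; rewrite -/z in z0 z1.
have tm a : cyl_length g (nseq m a) <= e / 2.
  by case: a; [apply: le_trans h1 | apply: le_trans h0];
     apply: (tail_antimono hg); rewrite /m leqW // ?leq_maxl ?leq_maxr.
have := tm b; rewrite /cyl_length; case: b {E} xE => xE.
  have -> : ibranch g (nseq m true) 1 = 1.
    by elim: (m) => //= k ->; exact: ib_11 hg.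
  have : ibranch g (nseq m true) 0 <= x.
    by rewrite xE; apply: (ibranch_le hg) => //; exact: ltW.
  rewrite /side /= !in_itv /= => h2 h3.
  by split; [apply/andP; split; lra | move=> /andP[_]; lra].
have -> : ibranch g (nseq m false) 0 = 0.
  by elim: (m) => //= k ->; exact: ib_00 hg.
have : x <= ibranch g (nseq m false) 1.
  by rewrite xE; apply: (ibranch_le hg) => //; exact: ltW.
rewrite /side /= !in_itv /= => h2 h3.
by split; [apply/andP; split; lra | move=> /andP[h4 _]; lra].
Qed.

Lemma occ_ge0 (E : set R) n x : 0 <= occ T E n x.
Proof. by apply: sumr_ge0 => k _; rewrite indicE. Qed.

Lemma occ_le (E : set R) n m x : (n <= m)%N -> occ T E n x <= occ T E m x.
Proof.
by move=> nm; apply: (@ler_sum_ord _ (fun k => \1_E (iter k T x))) => // k; rewrite indicE.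
Qed.

(** During a run all but the last [m] positions are spent deep in the
    corresponding side. *)
Lemma occ_run m b s l x : generic c T x ->
    (forall a y, generic c T y -> itinerary c T m y = nseq m a ->
       side a y /\ ~ side (~~ a) y) ->
    itinerary c T (l + m) (iter s T x) = nseq (l + m) b ->
  l%:R <= occ T (side b) (s + l + m) x /\
  occ T (side (~~ b)) (s + l + m) x <= (s + m)%:R.
Proof.
move=> gx hm E.
have blk k : (k < l)%N -> itinerary c T m (iter (s + k) T x) = nseq m b.
  move=> kl; have kE : (l + m = k + (m + (l - k)))%N by lia.
  have := congr1 (take m \o drop k) E.
  rewrite /= kE itineraryD drop_size_cat ?size_itinerary //.
  rewrite itineraryD take_size_cat ?size_itinerary // -iterD addnC => ->.
  by rewrite drop_nseq take_nseq //; lia.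
have sd k : (k < l)%N -> side b (iter (s + k) T x) /\ ~ side (~~ b) (iter (s + k) T x).
  by move=> kl; apply: hm; [exact: generic_iter | exact: blk].
rewrite /occ !big_split_ord /=; split.
  apply: le_trans (_ : \sum_(i < l) \1_(side b) (iter (s + i) T x) <= _).
    rewrite -[l in leLHS]card_ord -sumr_const; apply: ler_sum => i _.
    by rewrite indicE mem_set //; have [] := sd i (ltn_ord i).
  rewrite -addrA addrCA lerDl addr_ge0 // sumr_ge0 // => i _; rewrite indicE //.
rewrite [X in _ + X + _]big1 ?addr0; last first.
  by move=> i _; rewrite indicE memNset //; have [] := sd i (ltn_ord i).
rewrite natrD; apply: lerD.
  rewrite -[s in leRHS]card_ord -sumr_const; apply: ler_sum => i _.
  by rewrite indicE; case: (_ \in _).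
rewrite -[m in leRHS]card_ord -sumr_const; apply: ler_sum => i _.
by rewrite indicE; case: (_ \in _).
Qed.

(** A run of length [M * s] that starts at time [s] leaves at most [s + m] visits
    to the other side by its end. *)
Lemma dominating_runs b :
    (forall M, (0 < M)%N -> ~ summable_runs len b M) ->
  exists2 N, mu.-negligible N & forall x, generic c T x -> ~ N x ->
    forall (C : R) S, exists n, (S <= n)%N /\
      exists2 s : R, 0 < s & C * s <= occ T (side b) n x /\
        occ T (side (~~ b)) n x <= s.
Proof.
move=> hb; have [N hN h] := infinitely_often_long_runs hb.
have [m m0 hm] := side_block.
exists N => // x gx nN C S.
pose M := (Num.bound `|2 * C|).+1.
have [s [Ss E]] := h x gx nN M (maxn S m).
have [Ss' ms] : (S <= s)%N /\ (m <= s)%N by lia.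
have Ml : ((M * s).+1 - m + m = (M * s).+1)%N by apply: subnK; rewrite /M; nia.
rewrite -Ml in E; have [h1 h2] := occ_run gx hm E.
exists (s + ((M * s).+1 - m) + m)%N; split; first by lia.
have s0 : (0 < s)%N by exact: leq_trans ms.
exists (2 * s%:R); first by rewrite mulr_gt0 // ltr0n.
split; last first.
  apply: le_trans h2 _; rewrite -natrM ler_nat; lia.
apply: le_trans h1.
apply: le_trans (_ : (Num.bound `|2 * C|)%:R * s%:R <= _).
  rewrite mulrCA mulrA ler_wpM2r //; apply: le_trans (ler_norm _) _.
  by rewrite ltW // archi_boundP.
by rewrite -natrM ler_nat /M; nia.
Qed.

Theorem limsup_of_runs : (forall M, (0 < M)%N -> ~ summable_runs len false M) ->
  ae_unit (fun x => limn_esup (fun n =>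
    (occ_ratio T (side false) (side true) x n)%:E) = +oo%E).
Proof.
move=> /dominating_runs[N1 hN1 h1].
have [m m0 hm] := side_block.
have [N2 hN2 h2] := visits_blocks true m0.
apply: (ae_unit_generic gT T01 (negligibleU hN1 hN2)) => x gx /not_orP[nN1 nN2].
have [s hs] := h2 x gx nN2.
apply: limn_esup_pinfty => M S.
have [n [Sn [r r0 [own other]]]] := h1 x gx nN1 (Num.max M 0) (maxn S s.+1).
exists n; split; first by lia.
have pos : 0 < occ T (side true) n x.
  apply: (@lt_le_trans _ _ 1) => //; apply: le_trans (occ_le _ _ (_ : s.+1 <= n)%N); last by lia.
  rewrite /occ big_ord_recr /= -[leLHS]add0r lerD ?occ_ge0 //.
  by rewrite indicE mem_set //; have [] := hm true _ (generic_iter s gx) hs.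
rewrite /occ_ratio ler_pdivlMr //; apply: le_trans own.
apply: le_trans (_ : Num.max M 0 * occ T (side true) n x <= _).
  by apply: ler_wpM2r; [exact: ltW | rewrite le_max lexx].
by rewrite ler_wpM2l // le_max lexx orbT.
Qed.

Theorem liminf_of_runs : (forall M, (0 < M)%N -> ~ summable_runs len true M) ->
  ae_unit (fun x => limn_einf (fun n =>
    (occ_ratio T (side false) (side true) x n)%:E) = 0%E).
Proof.
move=> /dominating_runs[N hN h].
apply: (ae_unit_generic gT T01 hN) => x gx nN.
apply: limn_einf_eq0 => [n|e S e0]; first by rewrite divr_ge0 ?occ_ge0.
have [n [Sn [r r0 [own other]]]] := h x gx nN e^-1 S.
exists n; split => //; rewrite /occ_ratio.
have pos : 0 < occ T (side true) n x.
  by apply: lt_le_trans own; rewrite mulr_gt0 // invr_gt0.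
rewrite ler_pdivrMr //; apply: le_trans other _.
by rewrite -ler_pdivrMl.
Qed.

Lemma summable_runs_le b M M' : (M <= M')%N ->
  summable_runs len b M -> summable_runs len b M'.
Proof.
move=> MM [B hB']; exists B => n; apply: le_trans (hB' n).
apply: ler_sum => s _; apply: ler_wpM2l; first exact: (start_ge0 law).
by apply: (tail_le law); rewrite leq_mul2r MM orbT.
Qed.

Lemma not_summable_runs b M M' : (0 < M)%N ->
  summable_runs len b M -> ~ summable_runs len (~~ b) M'.
Proof.
move=> M0 h h'.
have h1 := summable_runs_le (leq_maxl M M') h.
have h2 := summable_runs_le (leq_maxr M M') h'.
have MM : (0 < maxn M M')%N by rewrite leq_max M0.
by case: b h1 h2 {h h'} => h1 h2; exact: (not_summable_runs_both law MM).
Qed.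

Lemma runs_dichotomy :
  (forall M, (0 < M)%N -> ~ summable_runs len false M) \/
  (forall M, (0 < M)%N -> ~ summable_runs len true M).
Proof.
have [h|] := pselect (forall M, (0 < M)%N -> ~ summable_runs len false M); first by left.
move=> /existsNP[M /not_implyP[M0 /contrapT hM]]; right => M' _.
exact: not_summable_runs M0 hM.
Qed.

Lemma not_summable_of_transfer b C j0 :
    (forall i, tail len (~~ b) (j0 + C * i) <= tail len b i) ->
  forall M, (0 < M)%N -> ~ summable_runs len b M.
Proof.
move=> hC M M0 hM; apply: (not_summable_runs M0 hM (summable_runs_transfer law hC hM)).
Qed.

End LongRuns.

(** * Regularly varying displacements *)

Section RegularVariation.
Context {R : realType}.
Implicit Types (h l : R -> R) (p r z : R).

Lemma near0_right (P : R -> Prop) : (\forall x \near 0^'+, P x) ->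
  exists2 e, 0 < e & forall x, 0 < x -> x < e -> P x.
Proof.
rewrite near_withinE => /nbhs_ballP[e /= e0 he]; exists e => // x x0 xe.
by apply: he => //=; rewrite /ball /= sub0r normrN gtr0_norm.
Qed.

Lemma dyadic_bracket (w z : R) : 0 < z -> z <= w ->
  exists i, w * 2^-1 ^+ i.+1 < z /\ z <= w * 2^-1 ^+ i.
Proof.
move=> z0 zw; have w0 : 0 < w := lt_le_trans z0 zw.
have ex : exists i, w * 2^-1 ^+ i.+1 < z.
  exists (Num.bound (w / z)); rewrite exprVn ltr_pdivrMr ?exprn_gt0 // mulrC -ltr_pdivrMr //.
  apply: lt_trans (archi_boundP _) _; first by rewrite divr_ge0 // ltW.
  by rewrite -natrX ltr_nat (leq_trans (ltnSn _)) // ltnW // ltn_expl.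
exists (ex_minn ex); case: ex_minnP => i hi himin; split => //.
case: i hi himin => [|i] _ hmin; first by rewrite expr0 mulr1.
by rewrite leNgt; apply/negP => /hmin; rewrite ltnn.
Qed.

Lemma powR_half_pow r i : (2^-1 ^+ i : R) `^ r = (2^-1 `^ r) ^+ i.
Proof.
elim: i => [|i IH]; first by rewrite !expr0 powR1.
by rewrite !exprS powRM ?IH // ?exprn_ge0 // invr_ge0.
Qed.

Lemma slowly_varying_half h l p e : 0 < e ->
    (forall z, 0 < z -> z < e -> 0 < h z) ->
    (forall z, 0 < z -> z < e -> h z = z `^ (1 + p) * l z) ->
    slowly_varying0 l ->
  h (2^-1 * z) / h z @[z --> 0^'+] --> (2^-1 : R) `^ (1 + p).
Proof.
move=> e0 hpos hl svl.
have lim : (2^-1 : R) `^ (1 + p) * (l (2^-1 * z) / l z) @[z --> 0^'+] -->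
    (2^-1 : R) `^ (1 + p) * 1.
  by apply: cvgMr; apply: svl; rewrite invr_gt0.
rewrite mulr1 in lim; apply: cvg_trans lim; apply: near_eq_cvg.
near=> z.
have z0 : 0 < z by near: z; exact: nbhs_right_gt.
have ze : z < e by near: z; exact: nbhs_right_lt.
have z20 : 0 < 2^-1 * z by rewrite mulr_gt0 // invr_gt0.
have z2e : 2^-1 * z < e by lra.
have hz := hpos z z0 ze; rewrite hl // in hz.
have lz : l z != 0.
  by apply/eqP => E; move: hz; rewrite E mulr0 ltxx.
have zp : z `^ (1 + p) != 0 by rewrite lt0r_neq0 // powR_gt0.
rewrite !hl // powRM ?invr_ge0 ?(ltW z0) //; field.
by rewrite zp lz.
Unshelve. all: by end_near. Qed.

(** Slow variation at the scale [1/2] makes [h] lose at most the factor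
    [2^-(1 + r)] from [z] to [z / 2]; monotonicity of [h] then fills the gaps of
    the geometric sequence. *)
Lemma regular_lower h l p r w : 0 < w ->
    (forall z, 0 < z -> z <= w -> 0 < h z) ->
    (forall z z', 0 < z -> z <= z' -> z' <= w -> h z <= h z') ->
    (forall z, 0 < z -> z < w -> h z = z `^ (1 + p) * l z) ->
    slowly_varying0 l -> p < r -> 0 <= 1 + r ->
  exists kappa e, [/\ 0 < kappa, 0 < e &
    forall z, 0 < z -> z < e -> kappa * z `^ (1 + r) <= h z].
Proof.
move=> w0 hpos hmon hl svl pr r0.
have hpos' z : 0 < z -> z < w -> 0 < h z by move=> z0 /ltW; exact: hpos.
have lim := slowly_varying_half w0 hpos' hl svl.
have half0 : 0 < 2^-1 :> R by rewrite invr_gt0.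
have half1 : 2^-1 < 1 :> R by rewrite invf_lt1 // ltr1n.
set q : R := 2^-1 `^ (1 + r); have q0 : 0 < q by exact: powR_gt0.
have qlt : q < 2^-1 `^ (1 + p).
  by rewrite /q /powR !gt_eqF // ltr_expR ltr_nM2r ?ltrD2l // ln_lt0 // half0.
have [e e0 he] : exists2 e, 0 < e & forall x, 0 < x -> x < e ->
    q < h (2^-1 * x) / h x.
  by apply: near0_right; apply: (cvgr_gt _ lim).
pose v := Num.min (w / 2) (e / 2).
have v0 : 0 < v by rewrite lt_min !divr_gt0.
have vw : v <= w / 2 by rewrite ge_min lexx.
have ve : v <= e / 2 by rewrite ge_min lexx orbT.
have dec i : q ^+ i * h v <= h (v * 2^-1 ^+ i).
  elim: i => [|i IH]; first by rewrite !expr0 mul1r mulr1.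
  have x0 : 0 < v * 2^-1 ^+ i by rewrite mulr_gt0 // exprn_gt0.
  have xv : v * 2^-1 ^+ i <= v.
    by rewrite ger_pMr // exprn_ile1 // ltW.
  have xe : v * 2^-1 ^+ i < e by lra.
  have hx : 0 < h (v * 2^-1 ^+ i) by apply: hpos => //; lra.
  have := he _ x0 xe; rewrite ltr_pdivlMr // => hq.
  rewrite exprS -mulrA; apply: le_trans (ler_wpM2l (ltW q0) IH) _.
  by apply: le_trans (ltW hq) _; rewrite exprS mulrCA.
have hv : 0 < h v by apply: hpos => //; lra.
exists (q * h v / v `^ (1 + r)), v; split => //.
  by rewrite divr_gt0 ?mulr_gt0 // powR_gt0.
move=> z z0 zv; have [i [iz zi]] := dyadic_bracket z0 (ltW zv).
apply: le_trans (_ : h (v * 2^-1 ^+ i.+1) <= _); last first.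
  apply: hmon (ltW iz) _; last by lra.
  by rewrite mulr_gt0 // exprn_gt0.
apply: le_trans (dec i.+1).
rewrite mulrAC ler_pdivrMr ?powR_gt0 //.
rewrite exprS -!mulrA ler_pM2l // mulrCA ler_pM2l //.
rewrite mulrC -powR_half_pow -powRM ?(ltW v0) ?exprn_ge0 ?(ltW half0) //.
by apply: ge0_ler_powR; rewrite ?nnegrE // ?(ltW z0) // mulr_ge0 ?(ltW v0) // exprn_ge0 // ltW.
Qed.

Lemma regular_upper h l p r w : 0 < w ->
    (forall z, 0 < z -> z <= w -> 0 < h z) ->
    (forall z z', 0 < z -> z <= z' -> z' <= w -> h z <= h z') ->
    (forall z, 0 < z -> z < w -> h z = z `^ (1 + p) * l z) ->
    slowly_varying0 l -> r < p -> 0 <= 1 + r ->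
  exists C e, [/\ 0 < C, 0 < e &
    forall z, 0 < z -> z < e -> h z <= C * z `^ (1 + r)].
Proof.
move=> w0 hpos hmon hl svl pr r0.
have hpos' z : 0 < z -> z < w -> 0 < h z by move=> z0 /ltW; exact: hpos.
have lim := slowly_varying_half w0 hpos' hl svl.
have half0 : 0 < 2^-1 :> R by rewrite invr_gt0.
have half1 : 2^-1 < 1 :> R by rewrite invf_lt1 // ltr1n.
set q : R := 2^-1 `^ (1 + r); have q0 : 0 < q by exact: powR_gt0.
have qlt : 2^-1 `^ (1 + p) < q.
  by rewrite /q /powR !gt_eqF // ltr_expR ltr_nM2r ?ltrD2l // ln_lt0 // half0.
have [e e0 he] : exists2 e, 0 < e & forall x, 0 < x -> x < e ->
    h (2^-1 * x) / h x < q.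
  by apply: near0_right; apply: (cvgr_lt _ lim).
pose v := Num.min (w / 2) (e / 2).
have v0 : 0 < v by rewrite lt_min !divr_gt0.
have vw : v <= w / 2 by rewrite ge_min lexx.
have ve : v <= e / 2 by rewrite ge_min lexx orbT.
have xv i : v * 2^-1 ^+ i <= v.
  by rewrite ger_pMr // exprn_ile1 // ltW.
have dec i : h (v * 2^-1 ^+ i) <= q ^+ i * h v.
  elim: i => [|i IH]; first by rewrite !expr0 mul1r mulr1.
  have x0 : 0 < v * 2^-1 ^+ i by rewrite mulr_gt0 // exprn_gt0.
  have xe : v * 2^-1 ^+ i < e by have := xv i; lra.
  have hx : 0 < h (v * 2^-1 ^+ i) by apply: hpos => //; have := xv i; lra.
  have := he _ x0 xe; rewrite ltr_pdivrMr // => hq.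
  rewrite exprS [q ^+ i.+1]exprS -mulrA; apply: le_trans (ler_wpM2l (ltW q0) IH).
  by apply: le_trans (ltW hq); rewrite mulrCA.
have hv : 0 < h v by apply: hpos => //; lra.
exists (q^-1 * h v / v `^ (1 + r)), v; split => //.
  by rewrite divr_gt0 ?powR_gt0 // mulr_gt0 // invr_gt0.
move=> z z0 zv; have [i [iz zi]] := dyadic_bracket z0 (ltW zv).
apply: le_trans (_ : h (v * 2^-1 ^+ i) <= _).
  by apply: hmon => //; have := xv i; lra.
apply: le_trans (dec i) _.
rewrite mulrAC ler_pdivlMr ?powR_gt0 //.
have -> : q^-1 * h v * z `^ (1 + r) = h v * (q^-1 * z `^ (1 + r)) by ring.
rewrite -mulrA mulrCA ler_pM2l // ler_pdivlMl // mulrA -exprS.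
rewrite mulrC -powR_half_pow -powRM ?(ltW v0) ?exprn_ge0 ?(ltW half0) //.
apply: ge0_ler_powR; rewrite ?nnegrE // ?(ltW z0) // ?(ltW iz) //.
by rewrite mulr_ge0 ?(ltW v0) // exprn_ge0 // ltW.
Qed.

End RegularVariation.

(** * Tails and displacements *)

Section TailDecay.
Context {R : realType} (c : R) (g d gap : bool -> R -> R) (K rho : R)
  (hg : inverse_branches c g d gap K rho).
Implicit Types (b : bool) (z r : R) (n l : nat).

Local Notation len := (cyl_length g).
Local Notation t := (tail len).

Let t0 b n : 0 < t b n. Proof. exact: (tail_gt0 hg). Qed.
Let tle b : {homo t b : i j / (i <= j)%N >-> j <= i}.
Proof. by move=> i j; exact: (tail_antimono hg). Qed.
Let tgap b n : t b n = t b n.+1 + gap b (t b n.+1).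
Proof. exact: (tail_gap hg). Qed.
Let twidth b n : t b n.+1 <= width c b. Proof. exact: (tailS_width hg). Qed.
Let t1 b n : t b n <= 1.
Proof. by apply: le_trans (tle b (leq0n n)) _; rewrite /tail /cyl_length /= subr0. Qed.

(** As long as the tail of [~~ b] stays above [z = t b n.+1], each of its steps
    loses at least [gap (~~ b) z]; [C] such steps lose at least
    [gap b z = t b n - t b n.+1]. *)
Lemma tail_compare b (C : nat) (e : R) : 0 < e ->
    (forall z, 0 < z -> z < e -> gap b z <= C%:R * gap (~~ b) z) ->
  exists j0, forall i, t (~~ b) (j0 + C * i) <= t b i.
Proof.
move=> e0 hC.
have [n0 hn0] := tail_small hg b (divr_gt0 e0 (ltr0n R 2)).
have [j0 hj0] := tail_small hg (~~ b) (t0 b n0).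
exists j0 => i; apply: le_trans (_ : t b (n0 + i) <= _); last first.
  by apply: tle; exact: leq_addl.
elim: i => [|i IH]; first by rewrite muln0 !addn0.
rewrite mulnS addnS addnCA addnC; set j := (j0 + C * i)%N in IH *; set n := (n0 + i)%N in IH *.
rewrite leNgt; apply/negP; set z := t b n.+1 => hz.
have z0 : 0 < z := t0 _ _.
have ze : z < e.
  have : z <= t b n0 by apply: tle; rewrite /n -addnS leq_addr.
  move: hn0; rewrite -/(t b n0) => hn0 zn; lra.
have step k : (k <= C)%N -> t (~~ b) (j + k) <= t (~~ b) j - k%:R * gap (~~ b) z.
  elim: k => [|k IHk] kC; first by rewrite addn0 mul0r subr0.
  have zk : z <= t (~~ b) (j + k).+1.
    by rewrite (le_trans (ltW hz)) // tle // -addnS leq_add2l.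
  have := ib_gap_le hg (ltW z0) zk (twidth _ _).
  have := IHk (ltnW kC); have := tgap (~~ b) (j + k).
  by rewrite addnS -natr1 mulrDl mul1r; lra.
have := step C (leqnn C); have := hC z z0 ze; have := tgap b n.
by rewrite -/z; move: hz IH; lra.
Qed.

Lemma tail_le_grow b n : t b n <= (1 + K) * t b n.+1.
Proof.
have K0 := ib_K hg.
have h : gap b (t b n.+1) <= K * t b n.+1 ^+ 2.
  by apply: (ib_gap_sqr hg); rewrite twidth ltW.
rewrite {1}tgap mulrDl mul1r lerD2l; apply: le_trans h _.
by rewrite ler_wpM2l // expr2 ler_piMl // ltW.
Qed.

(** The quantity [t b n `^ (- r)] grows by at least a fixed amount at each step
    from [n0] on. *)
Lemma tail_power_le b r kappa e : 0 < kappa -> 1 <= r -> 0 < e ->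
    (forall z, 0 < z -> z < e -> kappa * z `^ (1 + r) <= gap b z) ->
  exists2 k, 0 < k & forall n, k * n%:R * t b n `^ r <= 1.
Proof.
move=> kap0 r1 e0 hgap; have K0 := ib_K hg.
have r0 : 0 < r by exact: lt_le_trans r1.
have [n0 hn0] := tail_small hg b (divr_gt0 e0 (ltr0n R 2)).
pose w n := (t b n `^ r)^-1.
have tr0 n : 0 < t b n `^ r by exact: powR_gt0.
have w1 n : 1 <= w n.
  rewrite invf_ge1 //; apply: le_trans (_ : 1 `^ r <= _); last by rewrite powR1.
  by apply: ge0_ler_powR; rewrite ?nnegrE // ltW.
pose B := (1 + K) `^ r; have B0 : 0 < B by rewrite powR_gt0 // ltr_wpDr.
pose k1 := kappa / B; have k10 : 0 < k1 by exact: divr_gt0.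
have inc n : (n0 <= n)%N -> w n + k1 <= w n.+1.
  move=> nn; set x := t b n.+1; set y := t b n.
  have x0 : 0 < x by exact: t0.
  have y0 : 0 < y by exact: t0.
  have xe : x < e.
    have : x <= t b n0 by apply: tle; exact: leq_trans (leqnSn n).
    by move: hn0; rewrite -/(t b n0); lra.
  have X0 : 0 < x `^ r by exact: powR_gt0.
  have Y0 : 0 < y `^ r by exact: powR_gt0.
  have yx : x * (1 + kappa * x `^ r) <= y.
    have := hgap x x0 xe; rewrite powRD ?powRr1 ?(ltW x0) //; last first.
      by apply/implyP => _; rewrite gt_eqF.
    by rewrite /y tgap -/x mulrDr mulr1 lerD2l mulrCA.
  have yr : x `^ r * (1 + kappa * x `^ r) <= y `^ r.
    have u1 : 1 <= 1 + kappa * x `^ r by rewrite lerDl mulr_ge0 // ltW.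
    apply: le_trans (_ : (x * (1 + kappa * x `^ r)) `^ r <= _).
      rewrite powRM ?(ltW x0) ?(le_trans ler01) //.
      rewrite ler_pM2l // -[leLHS]powRr1 ?(le_trans ler01) //.
      exact: ler_powR.
    apply: ge0_ler_powR; rewrite ?nnegrE // ?(ltW r0) ?(ltW y0) //.
    by rewrite mulr_ge0 ?(ltW x0) // (le_trans ler01).
  have yB : y `^ r <= B * x `^ r.
    rewrite -powRM ?(ltW x0) ?addr_ge0 //; apply: ge0_ler_powR.
    - exact: ltW.
    - by rewrite nnegrE ltW.
    - by rewrite nnegrE; apply: mulr_ge0; [exact: addr_ge0 | exact: ltW].
    - exact: tail_le_grow.
  have P0 : 0 < x `^ r * y `^ r by exact: mulr_gt0.
  rewrite /w -/x -/y -(ler_pM2r P0).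
  have -> : ((y `^ r)^-1 + k1) * (x `^ r * y `^ r) = x `^ r + k1 * x `^ r * y `^ r.
    by field; rewrite gt_eqF.
  have -> : (x `^ r)^-1 * (x `^ r * y `^ r) = y `^ r by field; rewrite gt_eqF.
  apply: le_trans yr; rewrite mulrDr mulr1 lerD2l.
  have -> : x `^ r * (kappa * x `^ r) = k1 * x `^ r * (B * x `^ r).
    by rewrite /k1; field; rewrite gt_eqF.
  by apply: ler_wpM2l => //; rewrite mulr_ge0 // ltW.
have lin n : k1 * n%:R <= w n + k1 * n0%:R.
  elim: n => [|n IH].
    rewrite mulr0; apply: addr_ge0; first exact: le_trans ler01 _.
    by apply: mulr_ge0 => //; exact: ltW.
  case: (ltnP n n0) => nn.
    have : k1 * n.+1%:R <= k1 * n0%:R by rewrite ler_pM2l // ler_nat.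
    by have := w1 n.+1; lra.
  by have := inc n nn; rewrite -natr1; lra.
pose q := 1 + k1 * n0%:R; have q0 : 0 < q by rewrite ltr_wpDr // mulr_ge0 // ltW.
exists (k1 / q); first exact: divr_gt0.
move=> n; have h : k1 * n%:R <= w n * q.
  apply: le_trans (lin n) _; rewrite /q mulrDr mulr1 lerD2l.
  by rewrite ler_peMl // mulr_ge0 // ltW.
have -> : k1 / q * n%:R * t b n `^ r = k1 * n%:R / (w n * q).
  by rewrite /w; field; rewrite !gt_eqF.
by rewrite ler_pdivrMr ?mul1r // mulr_gt0 // (lt_le_trans ltr01).
Qed.

(** By convexity. This makes the ratio of the powers of successive tails linear
    in the power of the tail. *)
Lemma expr_chord (C z : R) k : 0 <= C -> 0 <= z <= 1 ->
  (1 + C * z) ^+ k <= 1 + ((1 + C) ^+ k - 1) * z.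
Proof.
move=> C0 /andP[z0 z1]; elim: k => [|k IH].
  by rewrite !expr0 subrr mul0r addr0.
rewrite exprS; have Cz : 0 <= 1 + C * z by rewrite addr_ge0 // mulr_ge0.
apply: le_trans (ler_wpM2l Cz IH) _.
have a0 : 0 <= (1 + C) ^+ k - 1 by rewrite subr_ge0 exprn_ege1 // lerDl.
rewrite exprS; set a := (1 + C) ^+ k - 1 in a0 *.
have -> : (1 + C) ^+ k = a + 1 by rewrite /a subrK.
rewrite -subr_ge0.
have -> : 1 + ((1 + C) * (a + 1) - 1) * z - (1 + C * z) * (1 + a * z) =
  C * a * z * (1 - z) by ring.
apply: mulr_ge0; last by rewrite subr_ge0.
by apply: mulr_ge0 => //; exact: mulr_ge0.
Qed.

(** The quantity [t b n `^ (- r)] grows by at most a fixed amount at each step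
    from [n0] on. *)
Lemma tail_power_ge b r C e : 0 < C -> 1 <= r -> 0 < e ->
    (forall z, 0 < z -> z < e -> gap b z <= C * z `^ (1 + r)) ->
  exists2 B, 0 < B & forall n, (0 < n)%N -> 1 <= B * n%:R * t b n `^ r.
Proof.
move=> C0 r1 e0 hgap.
have r0 : 0 < r by exact: lt_le_trans r1.
have [n0 hn0] := tail_small hg b (divr_gt0 e0 (ltr0n R 2)).
pose w n := (t b n `^ r)^-1.
have tr0 n : 0 < t b n `^ r by exact: powR_gt0.
have tr1 n : t b n `^ r <= 1.
  apply: le_trans (_ : 1 `^ r <= _); last by rewrite powR1.
  by apply: ge0_ler_powR; rewrite ?nnegrE // ltW.
have w0 n : 0 < w n by rewrite invr_gt0.
pose k := Num.bound r; pose a := (1 + C) ^+ k - 1.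
have a0 : 0 <= a by rewrite subr_ge0 exprn_ege1 // lerDl ltW.
have inc n : (n0 <= n)%N -> w n.+1 <= w n + a.
  move=> nn; set x := t b n.+1; set y := t b n.
  have x0 : 0 < x by exact: t0.
  have y0 : 0 < y by exact: t0.
  have xe : x < e.
    have : x <= t b n0 by apply: tle; exact: leq_trans (leqnSn n).
    by move: hn0; rewrite -/(t b n0); lra.
  have X0 : 0 < x `^ r by exact: powR_gt0.
  have Y0 : 0 < y `^ r by exact: powR_gt0.
  have X1 : x `^ r <= 1 by exact: tr1.
  have Y1 : y `^ r <= 1 by exact: tr1.
  have u0 : 1 <= 1 + C * x `^ r by rewrite lerDl mulr_ge0 // ltW.
  have yx : y <= x * (1 + C * x `^ r).
    have := hgap x x0 xe; rewrite powRD ?powRr1 ?(ltW x0) //; last first.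
      by apply/implyP => _; rewrite gt_eqF.
    by rewrite /y tgap -/x mulrDr mulr1 lerD2l mulrCA.
  have yr : y `^ r <= x `^ r * (1 + a * x `^ r).
    apply: le_trans (_ : (x * (1 + C * x `^ r)) `^ r <= _).
      apply: ge0_ler_powR; rewrite ?nnegrE ?(ltW r0) ?(ltW y0) //.
      by rewrite mulr_ge0 ?(ltW x0) // (le_trans ler01).
    rewrite powRM ?(ltW x0) ?(le_trans ler01) // ler_pM2l //.
    apply: le_trans (_ : (1 + C * x `^ r) `^ k%:R <= _).
      by apply: ler_powR => //; rewrite ltW // archi_boundP // ltW.
    rewrite powR_mulrn ?(le_trans ler01) //; apply: expr_chord; first exact: ltW.
    by rewrite ltW.
  have P0 : 0 < x `^ r * y `^ r by exact: mulr_gt0.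
  rewrite /w -/x -/y -(ler_pM2r P0).
  have -> : ((y `^ r)^-1 + a) * (x `^ r * y `^ r) = x `^ r + a * x `^ r * y `^ r.
    by field; rewrite gt_eqF.
  have -> : (x `^ r)^-1 * (x `^ r * y `^ r) = y `^ r by field; rewrite gt_eqF.
  have yx1 : x `^ r <= y `^ r.
    by apply: ge0_ler_powR; rewrite ?nnegrE ?(ltW r0) ?(ltW y0) ?(ltW x0) // tle.
  apply: le_trans yr _; rewrite mulrDr mulr1 lerD2l mulrCA mulrA.
  by apply: ler_wpM2l => //; rewrite mulr_ge0 // ltW.
have lin n : w n <= w n0 + a * n%:R.
  elim: n => [|n IH].
    rewrite mulr0 addr0 lef_pV2 ?posrE //.
    by apply: ge0_ler_powR; rewrite ?nnegrE ?(ltW r0) ?(ltW (t0 _ _)) // tle.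
  case: (ltnP n n0) => nn.
    apply: le_trans (_ : w n0 <= _); last by rewrite lerDl mulr_ge0.
    rewrite lef_pV2 ?posrE //.
    by apply: ge0_ler_powR; rewrite ?nnegrE ?(ltW r0) ?(ltW (t0 _ _)) // tle.
  by have := inc n nn; rewrite -natr1; lra.
exists (w n0 + a); first by rewrite ltr_wpDr.
move=> n n1; have n1' : 1 <= n%:R :> R by rewrite ler1n.
have -> : (w n0 + a) * n%:R * t b n `^ r = (w n0 + a) * n%:R / w n.
  by rewrite /w invrK.
rewrite ler_pdivlMr // mul1r; apply: le_trans (lin n) _.
by rewrite [leRHS]mulrDl; apply: lerD => //; rewrite ler_peMr // ltW.
Qed.

End TailDecay.

(** * Vanishing frequency of one side *)

Section VanishingFrequency.
Context {R : realType} (c : R) (T : R -> R) (g d gap : bool -> R -> R) (K rho : R)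
  (hg : inverse_branches c g d gap K rho)
  (gT : forall b x, lo c b < x < hi c b -> g b (T x) = x)
  (T01 : forall b x, lo c b < x < hi c b -> 0 < T x < 1).
Implicit Types (x : R) (m n i : nat).

Local Notation mu := (@lebesgue_measure R).
Local Notation len := (cyl_length g).
Local Notation law := (cyl_length_law hg).

Definition zeros n x := count_mem false (itinerary c T n x).

Lemma zerosE n x : zeros n x = (\sum_(k < n) ~~ (c < iter k T x)%R)%N.
Proof.
rewrite /zeros; elim: n x => [|n IH] x; first by rewrite big_ord0.
rewrite big_ord_recl /= IH; congr (_ + _)%N; first by case: (c < x).
by apply: eq_bigr => k _; rewrite /bump /= -iterS iterSr.
Qed.

Lemma zeros_le n m x : (n <= m)%N -> (zeros n x <= zeros m x)%N.
Proof.
by move=> /subnKC <-; rewrite /zeros itineraryD count_cat leq_addr.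
Qed.

(** Markov's inequality and Borel--Cantelli along the times [2 ^ i]. *)
Lemma zeros_frequency (C th : R) : 0 <= C -> 0 <= th < 1 ->
    (forall i, \sum_(t < 2 ^ i) visit len false t.+1 <= C * (2 ^ i)%:R * th ^+ i) ->
  exists2 N, mu.-negligible N & forall x, generic c T x -> ~ N x ->
    forall e : R, 0 < e -> exists I, forall i, (I <= i)%N ->
      (zeros (2 ^ i) x)%:R < e * (2 ^ i)%:R.
Proof.
move=> C0 th01 hC.
pose P j i w := (j.+1%:R^-1 * (2 ^ i)%:R : R) <= (count_mem false w)%:R.
exists (\bigcup_j lim_sup_set (fun i => cylinders g (2 ^ i) (P j i))).
  apply: negligible_bigcup => j.
  apply: (limsup_negligible hg th01 (_ : 0 <= C * j.+1%:R)) => [|i].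
    by rewrite mulr_ge0.
  have p2 : 0 < (2 ^ i)%:R :> R by rewrite ltr0n expn_gt0.
  have e0 : 0 < j.+1%:R^-1 * (2 ^ i)%:R :> R by rewrite mulr_gt0 // invr_gt0.
  have := le_trans (count_mass_le law false (2 ^ i) e0) (hC i).
  rewrite -ler_pdivlMl // => /le_trans; apply.
  rewrite le_eqVlt; apply/orP; left; apply/eqP; field.
  by rewrite !lt0r_neq0 // ltr0n.
move=> x gx nN e e0.
have [j je] : exists j, j.+1%:R^-1 <= e.
  exists (Num.bound e^-1); rewrite invf_ple ?posrE //.
  by rewrite ltW // (lt_trans (archi_boundP _)) ?invr_ge0 ?(ltW e0) // ltr_nat.
apply: contrapT => /forallNP nI; apply: nN; exists j => // I _.
have /existsNP[i /not_implyP[Ii hi]] := nI I.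
exists i => //; apply: (generic_cylinders hg gT) => //; rewrite /P.
move/negP: hi; rewrite -leNgt; apply: le_trans.
by rewrite ler_wpM2r.
Qed.

Context (dA dB : R) (hA : 0 < dA < 1) (hB : 0 < dB < 1).

(** Unless the point is deep in the right-hand side, one of the next [m] letters
    is a zero, and each zero serves at most [m] such times. *)
Lemma occ_zeros m n x : generic c T x ->
    (forall b y, generic c T y -> itinerary c T m y = nseq m b ->
       side dA dB b y /\ ~ side dA dB (~~ b) y) ->
  occ T (side dA dB false) n x <= (m * zeros (n + m) x)%:R /\
  n%:R - (m * zeros (n + m) x)%:R <= occ T (side dA dB true) n x.
Proof.
move=> gx hm.
pose bad k : nat := itinerary c T m (iter k T x) != nseq m true.
have hbad : ((\sum_(k < n) bad k) <= m * zeros (n + m) x)%N.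
  apply: (@leq_trans (\sum_(k < n) zeros m (iter k T x))).
    apply: leq_sum => k _; rewrite /bad; case: eqP => // ne /=.
    rewrite lt0n; apply/eqP => z0; apply: ne.
    have : all (pred1 true) (itinerary c T m (iter k T x)).
      apply/allP => a ax; case: a ax => // ax.
      by move: z0; rewrite /zeros => /eqP; rewrite -leqn0 leqNgt -has_count has_pred1 ax.
    by move/all_pred1P; rewrite size_itinerary.
  under eq_bigr do rewrite zerosE.
  rewrite exchange_big /=.
  have -> : (m * zeros (n + m) x = \sum_(i < m) zeros (n + m) x)%N.
    by rewrite sum_nat_const card_ord.
  apply: leq_sum => i _; rewrite zerosE.
  apply: (@leq_trans (\sum_(k < i + n) ~~ (c < iter k T x)%R)%N).
    rewrite big_split_ord /= addnC; apply: leq_trans (leq_addr _ _).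
    by apply: leq_sum => k _; rewrite -iterD addnC.
  have le : (i + n <= n + m)%N by rewrite addnC leq_add2l ltnW.
  move: (n + m)%N le => q /subnKC <-.
  by rewrite [leqRHS]big_split_ord leq_addr.
have hA1 : occ T (side dA dB false) n x <= (\sum_(k < n) bad k)%:R.
  rewrite natr_sum; apply: ler_sum => k _; rewrite /bad indicE.
  case: eqP => [E|_] /=; last by case: (_ \in _).
  by rewrite memNset //; have [] := hm true _ (generic_iter k gx) E.
have hB1 : n%:R - (\sum_(k < n) bad k)%:R <= occ T (side dA dB true) n x.
  have -> : n%:R = \sum_(k < n) (1 : R) by rewrite sumr_const card_ord.
  rewrite natr_sum -sumrB; apply: ler_sum => k _; rewrite /bad indicE.
  case: eqP => [E|_] /=; last by rewrite subrr; case: (_ \in _).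
  by rewrite mem_set ?subr0 //; have [] := hm true _ (generic_iter k gx) E.
split; first by apply: le_trans hA1 _; rewrite ler_nat.
by apply: le_trans hB1; rewrite lerD2l lerN2 ler_nat.
Qed.

Theorem ratio_cvg0 (C th : R) : 0 <= C -> 0 <= th < 1 ->
    (forall i, \sum_(t < 2 ^ i) visit len false t.+1 <= C * (2 ^ i)%:R * th ^+ i) ->
  ae_unit (fun x =>
    occ_ratio T (side dA dB false) (side dA dB true) x @ \oo --> (0 : R)).
Proof.
move=> C0 th01 hC; have [N hN h] := zeros_frequency C0 th01 hC.
have [m m0 hm] := side_block hg gT hA hB.
apply: (ae_unit_generic gT T01 hN) => x gx nN.
apply/cvgrPdist_le => e e0.
pose dl := Num.min (2^-1) (e / 2).
have dl0 : 0 < dl by rewrite lt_min invr_gt0 ltr0n divr_gt0.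
have dl1 : dl <= 2^-1 by rewrite ge_min lexx.
have dl2 : dl <= e / 2 by rewrite ge_min lexx orbT.
have mR : 0 < m%:R :> R by rewrite ltr0n.
have eta0 : 0 < dl / (4 * m%:R) by rewrite divr_gt0 // mulr_gt0.
have [I hI] := h x gx nN _ eta0.
near=> n.
have nm : (m <= n)%N by near: n; exact: nbhs_infty_ge.
have nI : (2 ^ I <= n)%N by near: n; exact: nbhs_infty_ge.
have n0 : (0 < n)%N by exact: leq_trans nm.
have nm0 : (0 < n + m)%N by rewrite addn_gt0 n0.
pose i := (trunc_log 2 (n + m)).+1.
have i1 : (n + m < 2 ^ i)%N by exact: trunc_log_ltn.
have i2 : (2 ^ i <= 4 * n)%N.
  have := trunc_logP (ltnSn 1) nm0; rewrite /i expnS; lia.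
have iI : (I <= i)%N.
  apply: leqW; apply: trunc_log_max => //.
  exact: leq_trans (leq_addr _ _).
have Z : (m * zeros (n + m) x)%:R <= dl * n%:R.
  rewrite natrM; apply: le_trans (_ : m%:R * (dl / (4 * m%:R) * (4 * n)%:R) <= _).
    rewrite ler_pM2l //; apply: le_trans (_ : (zeros (2 ^ i) x)%:R <= _).
      by rewrite ler_nat zeros_le // ltnW.
    apply: le_trans (ltW (hI i iI)) _.
    by rewrite ler_pM2l // ler_nat.
  rewrite natrM le_eqVlt; apply/orP; left; apply/eqP; field.
  by rewrite lt0r_neq0.
have [oA oB] := occ_zeros n gx hm.
have nR : 0 < n%:R :> R by rewrite ltr0n.
have oB' : n%:R / 2 <= occ T (side dA dB true) n x.
  apply: le_trans oB; have := ler_wpM2r (ltW nR) dl1; move: Z; lra.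
have oBpos : 0 < occ T (side dA dB true) n x by apply: lt_le_trans oB'; rewrite divr_gt0.
rewrite sub0r normrN ger0_norm; last by rewrite divr_ge0 ?occ_ge0.
rewrite /occ_ratio ler_pdivrMr //.
apply: le_trans oA _; apply: le_trans Z _.
apply: le_trans (_ : e * (n%:R / 2) <= _); last by rewrite ler_pM2l.
by have := ler_wpM2r (ltW nR) dl2; lra.
Unshelve. all: by end_near. Qed.

End VanishingFrequency.

(** * Occupation ratios and the displacements at the two fixed points *)

Lemma eqO_near0 (R : realType) (f h : R -> R) : f =O_ (0^'+) h ->
  exists2 C : nat, (0 < C)%N & exists2 e : R, 0 < e &
    forall z, 0 < z -> z < e -> `|f z| <= C%:R * `|h z|.
Proof.
move=> /eqO_exP[k k0 /near0_right[e e0 he]].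
exists (Num.bound k).+1 => //; exists e => // z z0 ze.
apply: le_trans (he z z0 ze) _; apply: ler_wpM2r => //.
by apply: ltW; apply: lt_le_trans (archi_boundP (ltW k0)) _; rewrite ler_nat.
Qed.

Section Displacements.
Context {R : realType} (c : R) (T : R -> R) (F d g : bool -> R -> R) (K rho : R)
  (c01 : 0 < c < 1) (hF : branches c T F d K)
  (hg : inverse_branches c g d (displacement F) K rho).

(** Distance covered in one step from the point at distance [z] of the fixed point
    of the side [b]. *)
Definition boundary_gap (b : bool) (z : R) : R :=
  if b then 1 - z - T (1 - z) else T z - z.

Lemma displacementE b z : 0 < z -> z < width c b -> displacement F b z = boundary_gap b z.
Proof.
have /andP[c0 c1] := c01.
case: b => z0 zw; rewrite /displacement /boundary_gap.
  by rewrite (br_T hF (b := true)) //=; move: zw; rewrite /width => zw; apply/andP; split; lra.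
by rewrite (br_T hF (b := false)) //= z0.
Qed.

Lemma width_gt0 b : 0 < width c b.
Proof. by have /andP[c0 c1] := c01; case: b; rewrite /width ?subr_gt0. Qed.

Lemma tail_compare_eqO b : boundary_gap b =O_ (0^'+) boundary_gap (~~ b) ->
  exists C j0, forall i,
    tail (cyl_length g) (~~ b) (j0 + C * i) <= tail (cyl_length g) b i.
Proof.
move=> /eqO_near0[C C0 [e e0 he]].
pose w := Num.min e (Num.min (width c true) (width c false)).
have w0 : 0 < w by rewrite !lt_min e0 !width_gt0.
have we : w <= e by rewrite ge_min lexx.
have ww a : w <= width c a by case: a; rewrite !ge_min lexx ?orbT.
have [j0 hj0] : exists j0, forall i,
    tail (cyl_length g) (~~ b) (j0 + C * i) <= tail (cyl_length g) b i.
  apply: (tail_compare hg w0) => z z0 zw.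
  have zb a := lt_le_trans zw (ww a).
  have := he z z0 (lt_le_trans zw we).
  have pos a : 0 < boundary_gap a z.
    by rewrite -displacementE //; apply: (ib_gap_gt0 hg); rewrite z0 ltW.
  by rewrite !displacementE // !gtr0_norm.
by exists C, j0.
Qed.

Lemma regular_displacement b (p : R) (l : R -> R) : slowly_varying0 l ->
    (\forall z \near 0^'+, boundary_gap b z = z `^ (1 + p) * l z) ->
  exists w, [/\ 0 < w, w <= width c b &
    forall z, 0 < z -> z < w -> displacement F b z = z `^ (1 + p) * l z].
Proof.
move=> svl /near0_right[e e0 he]; exists (Num.min e (width c b)); split.
- by rewrite lt_min e0 width_gt0.
- by rewrite ge_min lexx orbT.
- by move=> z z0; rewrite lt_min => /andP[ze zw]; rewrite displacementE // he.
Qed.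

(** Exponents strictly between [p0] and [p1] absorb the slowly varying factors, so
    that the tails at [2 ^ l] are compared with the powers of [2^-(1 / r0)] and
    [2^-(1 / r1)]. *)
Lemma visits_power (p0 p1 : R) (l0 l1 : R -> R) : 1 < p0 -> p0 < p1 ->
    slowly_varying0 l0 -> slowly_varying0 l1 ->
    (\forall z \near 0^'+, boundary_gap false z = z `^ (1 + p0) * l0 z) ->
    (\forall z \near 0^'+, boundary_gap true z = z `^ (1 + p1) * l1 z) ->
  exists C th : R, [/\ 0 <= C, 0 <= th < 1 & forall i,
    \sum_(t < 2 ^ i) visit (cyl_length g) false t.+1 <= C * (2 ^ i)%:R * th ^+ i].
Proof.
move=> p0_1 p01 sv0 sv1 h0 h1.
pose r0 := p0 + (p1 - p0) / 3; pose r1 := p0 + (p1 - p0) * 2 / 3.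
have [e1 e2 e3 e4] : [/\ p0 < r0, r0 < r1, r1 < p1 & 1 < r0].
  by rewrite /r0 /r1; split; lra.
have gpos b w : w <= width c b -> forall z, 0 < z -> z <= w -> 0 < displacement F b z.
  move=> ww z z0 zw; apply: (ib_gap_gt0 hg); rewrite z0 /=; exact: le_trans ww.
have gmon b w : w <= width c b -> forall z z', 0 < z -> z <= z' -> z' <= w ->
    displacement F b z <= displacement F b z'.
  move=> ww z z' z0 zz zw; apply: (ib_gap_le hg) => //; first exact: ltW.
  exact: le_trans ww.
have [w0 [w00 w0w hw0]] := regular_displacement sv0 h0.
have [w1 [w10 w1w hw1]] := regular_displacement sv1 h1.
have r00 : 0 <= 1 + r0 by lra.
have r10 : 0 <= 1 + r1 by lra.
have [ka [ea [ka0 ea0 hka]]] :=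
  regular_lower w00 (gpos _ _ w0w) (gmon _ _ w0w) hw0 sv0 e1 r00.
have [Cb [eb [Cb0 eb0 hCb]]] :=
  regular_upper w10 (gpos _ _ w1w) (gmon _ _ w1w) hw1 sv1 e3 r10.
have r0ge : 1 <= r0 by exact: ltW.
have r1ge : 1 <= r1 by lra.
have [k k0 hk] := tail_power_le hg ka0 r0ge ea0 hka.
have [B B0 hB] := tail_power_ge hg Cb0 r1ge eb0 hCb.
have r0p : 0 < r0 by lra.
have r1p : 0 < r1 by lra.
have half0 : 0 < 2^-1 :> R by rewrite invr_gt0.
pose a0 : R := 2^-1 `^ r0^-1; pose a1 : R := 2^-1 `^ r1^-1.
have ln_half : ln (2^-1 : R) < 0 by rewrite ln_lt0 // half0 invf_lt1 // ltr1n.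
have a0half : 2^-1 < a0.
  rewrite -[ltLHS]powRr1 ?(ltW half0) // /a0 /powR !gt_eqF // ltr_expR.
  by rewrite ltr_nM2r // invf_lt1.
have a01 : a0 < a1.
  by rewrite /a0 /a1 /powR !gt_eqF // ltr_expR ltr_nM2r // ltf_pV2.
have powR_root (x r : R) : 0 < x -> 0 < r -> x = (x `^ r) `^ r^-1.
  by move=> x0 rp; rewrite -powRrM divff ?gt_eqF // powRr1 // ltW.
have tpos b n : 0 < tail (cyl_length g) b n by exact: (tail_gt0 hg).
have p2 l : 0 < (2 ^ l)%:R :> R by rewrite ltr0n expn_gt0.
have pw (a r : R) l : 0 < a -> (a * (2 ^ l)%:R)^-1 `^ r^-1 =
    (a^-1) `^ r^-1 * (2^-1 `^ r^-1) ^+ l.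
  move=> ap; rewrite invfM natrX -exprVn powRM ?invr_ge0 ?(ltW ap) ?exprn_ge0 ?(ltW half0) //.
  by rewrite powR_half_pow.
have up l : tail (cyl_length g) false (2 ^ l) <= k^-1 `^ r0^-1 * a0 ^+ l.
  rewrite -pw // [leLHS](powR_root _ r0 (tpos false (2 ^ l)%N) r0p); apply: ge0_ler_powR.
  - by rewrite invr_ge0 ltW.
  - by rewrite nnegrE powR_ge0.
  - by rewrite nnegrE invr_ge0 mulr_ge0 // ltW.
  - by rewrite -[leRHS]mul1r ler_pdivlMr ?mulr_gt0 // mulrC.
have down l : B^-1 `^ r1^-1 * a1 ^+ l <= tail (cyl_length g) (~~ false) (2 ^ l).
  rewrite -pw // [leRHS](powR_root _ r1 (tpos true (2 ^ l)%N) r1p); apply: ge0_ler_powR.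
  - by rewrite invr_ge0 ltW.
  - by rewrite nnegrE invr_ge0 mulr_ge0 // ltW.
  - by rewrite nnegrE powR_ge0.
  - by rewrite -[leLHS]mul1r ler_pdivrMr ?mulr_gt0 // mulrC hB // expn_gt0.
have B1 : 0 < B^-1 `^ r1^-1 by rewrite powR_gt0 // invr_gt0.
have [C [C0 hC]] := visits_dyadic (cyl_length_law hg) (powR_ge0 _ _) B1 a0half a01 up down.
exists C, (a0 / a1); split => //.
have a00 : 0 < a0 by exact: lt_trans a0half.
have a10 : 0 < a1 by exact: lt_trans a01.
by rewrite divr_ge0 ?(ltW a00) ?(ltW a10) //= ltr_pdivrMr // mul1r.
Qed.

End Displacements.

Theorem theorem2 (R : realType) (c : R) (T : R -> R) (dA dB : R)
    (c01 : 0 < c < 1) (hT : indifferent_map c T)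
    (hA : 0 < dA < 1) (hB : 0 < dB < 1) :
  let A : set R := `[0, dA[%classic in
  let B : set R := `]1 - dB, 1]%classic in
  let liminf0 := ae_unit (fun x =>
    limn_einf (fun n => (occ_ratio T A B x n)%:E) = 0%E) in
  let limsup_oo := ae_unit (fun x =>
    limn_esup (fun n => (occ_ratio T A B x n)%:E) = +oo%E) in
  let gap0 : R -> R := fun x => T x - x in
  let gap1 : R -> R := fun x => 1 - x - T (1 - x) in
  [/\ liminf0 \/ limsup_oo,
      gap0 =O_ (0^'+) gap1 -> limsup_oo,
      gap0 =O_ (0^'+) gap1 /\ gap1 =O_ (0^'+) gap0 -> liminf0 /\ limsup_oo &
      forall (p0 p1 : R) (l0 l1 : R -> R),
        1 < p0 -> p0 < p1 ->
        slowly_varying0 l0 -> slowly_varying0 l1 ->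
        (\forall x \near 0^'+, T x = x + x `^ (1 + p0) * l0 x) ->
        (\forall x \near 0^'+, 1 - T (1 - x) = x + x `^ (1 + p1) * l1 x) ->
        ae_unit (fun x => occ_ratio T A B x @ \oo --> (0 : R))].
Proof.
move=> A B liminf0 limsup_oo gap0 gap1.
have [F [d [K hF]]] := indifferent_map_branches c01 hT.
have [g [rho [hg gT]]] := branches_inverse c01 hF.
have T01 b x := @br_T01 _ _ _ _ _ _ hF b x.
have sup := limsup_of_runs hg gT T01 hA hB.
have inf := liminf_of_runs hg gT T01 hA hB.
have supO : gap0 =O_ (0^'+) gap1 -> limsup_oo.
  move=> /(tail_compare_eqO c01 hF hg (b := false))[C [j0 hC]].
  by apply: sup => M M0; exact: (not_summable_of_transfer hg hC M0).
have infO : gap1 =O_ (0^'+) gap0 -> liminf0.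
  move=> /(tail_compare_eqO c01 hF hg (b := true))[C [j0 hC]].
  by apply: inf => M M0; exact: (not_summable_of_transfer hg hC M0).
split.
- by case: (runs_dichotomy hg) => h; [right; exact: sup | left; exact: inf].
- exact: supO.
- by move=> [h1 h2]; split; [exact: infO | exact: supO].
- move=> p0 p1 l0 l1 p0_1 p01 sv0 sv1 h0 h1.
  have [||C [th [C0 th01 hC]]] := visits_power c01 hF hg p0_1 p01 sv0 sv1.
  + by apply: filterS h0 => x; rewrite /boundary_gap => ->; rewrite addrAC subrr add0r.
  + by apply: filterS h1 => x; rewrite /boundary_gap => E; rewrite addrAC E addrAC subrr add0r.
  exact: (ratio_cvg0 hg gT T01 hA hB C0 th01 hC).
Qed.
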